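(* Let $\gamma>-1$ and let $\phi\in L^\infty(\mathbb{D},dA_\gamma)$ be a complex-valued function that is harmonic on $\mathbb{D}$. Then the Toeplitz operator $T_\phi$ on $A^2_\gamma(\mathbb{D})$ satisfies $\mathbf{Ber}(T_\phi)=\phi(\mathbb{D})$.
   Context: $\mathbb{D}=\{w\in\mathbb{C}:|w|<1\}$; $dA$ is area measure on $\mathbb{D}$ normalized so that $\mathbb{D}$ has area $1$; for $\gamma>-1$, $dA_\gamma(w)=(\gamma+1)(1-|w|^2)^\gamma dA(w)$. The weighted Bergman space $A^2_\gamma(\mathbb{D})$ is the Hilbert space of holomorphic functions $f$ on $\mathbb{D}$ with $\int_{\mathbb{D}}|f|^2dA_\gamma<\infty$, with inner product $\langle f,g\rangle=\int_{\mathbb{D}}f\bar g\,dA_\gamma$. Its normalized reproducing kernel at $\xi\in\mathbb{D}$ is $\hat k^\gamma_\xi(w)=\frac{(1-|\xi|^2)^{(\gamma+2)/2}}{(1-\bar\xi w)^{\gamma+2}}$ (principal branch of the power). For $\phi\in L^\infty(\mathbb{D},dA_\gamma)$ (essentially bounded complex measurable functions), the Toeplitz operator is $T_\phi f=P_\gamma(\phi f)$, $f\in A^2_\gamma(\mathbb{D})$, where $P_\gamma$ is the orthogonal projection of $L^2(\mathbb{D},dA_\gamma)$ onto $A^2_\gamma(\mathbb{D})$. For a bounded linear operator $T$ on $A^2_\gamma(\mathbb{D})$, the Berezin transform is $\widetilde T(\xi)=\langle T\hat k^\gamma_\xi,\hat k^\gamma_\xi\rangle$, $\xi\in\mathbb{D}$,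 and the Berezin range is $\mathbf{Ber}(T)=\{\widetilde T(\xi):\xi\in\mathbb{D}\}$. *)

(* Defs.v *)
From HB Require Import structures.
From mathcomp Require Import all_boot all_order all_algebra.
From mathcomp Require Import complex.
From mathcomp Require Import all_classical all_reals all_analysis.
From mathcomp Require Import measurable_realfun.

Set Implicit Arguments.
Unset Strict Implicit.
Unset Printing Implicit Defensive.

Import Order.TTheory GRing.Theory Num.Theory.
Import numFieldNormedType.Exports.
Import Normc.

Local Open Scope classical_set_scope.
Local Open Scope ring_scope.
Local Open Scope complex_scope.

(* The plane occurs in two guises: [R[i]] carries complex arithmetic and complex
   differentiability, [R * R] carries real partial derivatives and the Borel
   sigma-algebra (through the alias [plane], on which the library's Lebesgue
   measure lives).  Functions on the disk are total functions on [R[i]] whose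
   values outside the disk are irrelevant. *)
Definition plane (R : realType) : Type :=
  (measurableTypeR R * measurableTypeR R)%type.

HB.instance Definition _ (R : realType) := Measurable.on (plane R).

Section Plane.
Context {R : realType}.

Definition toC (p : R * R) : R[i] := p.1 +i* p.2.

Definition disk : set R[i] := [set w | normc w < 1].
Definition disk2 : set (plane R) := toC @^-1` disk.

(* [derivable] is taken over the field [R[i]]: the difference quotient has a
   limit as its complex increment tends to 0. *)
Definition holomorphic_on (U : set R[i]) (f : R[i] -> R[i]) : Prop :=
  forall z, U z -> derivable (f : R[i]^o -> R[i]^o) z 1.

Definition ex : R * R := (1, 0).
Definition ey : R * R := (0, 1).

Definition C1_on (U : set (R * R)) (u : R * R -> R) : Prop :=
  forall p, U p ->
    [/\ {for p, continuous u},
        derivable u p ex /\ derivable u p ey,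
        {for p, continuous ('D_ex u)} &
        {for p, continuous ('D_ey u)}].

Definition C2_on (U : set (R * R)) (u : R * R -> R) : Prop :=
  [/\ C1_on U u, C1_on U ('D_ex u) & C1_on U ('D_ey u)].

Definition real_harmonic_on (U : set (R * R)) (u : R * R -> R) : Prop :=
  C2_on U u /\
  forall p, U p -> 'D_ex ('D_ex u) p + 'D_ey ('D_ey u) p = 0.

Definition harmonic_on (U : set R[i]) (f : R[i] -> R[i]) : Prop :=
  real_harmonic_on (toC @^-1` U) (@complex.Re R \o f \o toC) /\
  real_harmonic_on (toC @^-1` U) (@complex.Im R \o f \o toC).

Definition cmeasurable_on (U : set R[i]) (f : R[i] -> R[i]) : Prop :=
  measurable_fun (toC @^-1` U : set (plane R)) (@complex.Re R \o f \o toC) /\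
  measurable_fun (toC @^-1` U : set (plane R)) (@complex.Im R \o f \o toC).

Definition cintegral (mu : {measure set (plane R) -> \bar R}) (U : set R[i])
    (f : R[i] -> R[i]) : R[i] :=
  Rintegral mu (toC @^-1` U : set (plane R)) (@complex.Re R \o f \o toC)
  +i* Rintegral mu (toC @^-1` U : set (plane R)) (@complex.Im R \o f \o toC).

(* Principal argument, in ]-pi, pi] for [z != 0]. *)
Definition carg (z : R[i]) : R :=
  let t := acos (complex.Re z / normc z) in
  if 0 <= complex.Im z then t else - t.

(* Principal branch of [z ^ a]. *)
Definition cpow (z : R[i]) (a : R) : R[i] :=
  (normc z `^ a)%:C * (cos (a * carg z) +i* sin (a * carg z)).

Lemma pi_inv_ge0 : 0 <= (pi : R)^-1.
Proof. by rewrite invr_ge0 pi_ge0. Qed.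

(* Area measure scaled so that the unit disk has area 1. *)
Definition dA : {measure set (plane R) -> \bar R} :=
  mscale (NngNum pi_inv_ge0)
    ((@lebesgue_measure R) \x (@lebesgue_measure R))%E.

Lemma normc_toCE (p : plane R) : normc (toC p) ^+ 2 = p.1 ^+ 2 + p.2 ^+ 2.
Proof. by rewrite /= sqr_sqrtr// addr_ge0// sqr_ge0. Qed.

Lemma measurable_normc_toC :
  measurable_fun setT (fun p : plane R => normc (toC p) ^+ 2).
Proof.
under eq_fun do rewrite normc_toCE.
by apply: measurable_funD; apply: measurable_funX;
  [exact: measurable_fst|exact: measurable_snd].
Qed.

Lemma measurable_disk2 : measurable disk2.
Proof.
have -> : disk2 = setT `&`
    (fun p : plane R => normc (toC p) ^+ 2) @^-1` `]-oo, 1[.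
  apply/seteqP; split => p; rewrite /disk2 /disk /= in_itv /=.
    by move=> h; split => //; rewrite expr_lt1// sqrtr_ge0.
  by move=> [_]; rewrite expr_lt1// sqrtr_ge0.
by apply: measurable_normc_toC => //; exact: measurable_itv.
Qed.

End Plane.

Section WeightedMeasure.
Context {R : realType} {gamma : R} (hgamma : -1 < gamma).

Definition dA_weight (p : plane R) : R :=
  (gamma + 1) * (1 - normc (toC p) ^+ 2) `^ gamma.

(* The unused argument makes the density nonnegative, which the [Measure]
   instance below needs. *)
Definition dA_ (_ : -1 < gamma) : set (plane R) -> \bar R :=
  fun A => (\int[dA]_(p in A `&` disk2) (dA_weight p)%:E)%E.

Lemma dA_weight_ge0 p : 0 <= dA_weight p.
Proof. by rewrite mulr_ge0 ?powR_ge0// -lerBlDr sub0r ltW. Qed.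

Lemma measurable_dA_weight : measurable_fun setT dA_weight.
Proof.
apply: measurable_funM => //.
apply: (measurableT_comp (measurable_powR gamma)).
by apply: measurable_funB => //; exact: measurable_normc_toC.
Qed.

Let dA_0 : dA_ hgamma set0 = 0%E.
Proof. by rewrite /dA_ set0I integral_set0. Qed.

Let dA_ge0 A : (0 <= dA_ hgamma A)%E.
Proof. by apply: integral_ge0 => p _; rewrite lee_fin dA_weight_ge0. Qed.

Let dA_sigma_additive : semi_sigma_additive (dA_ hgamma).
Proof.
move=> F mF tF mUF; rewrite /dA_ setI_bigcupl.
apply: (@semi_sigma_additive_nng_induced _ _ _ dA (EFin \o dA_weight)).
- by apply/measurable_EFinP; apply: measurable_dA_weight.
- by move=> p; rewrite lee_fin dA_weight_ge0.
- by move=> n; apply: measurableI => //; exact: measurable_disk2.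
- exact: trivIset_setIr.
- apply: bigcup_measurable => n _.
  by apply: measurableI => //; exact: measurable_disk2.
Qed.

HB.instance Definition _ := isMeasure.Build _ _ _
  (dA_ hgamma) dA_0 dA_ge0 dA_sigma_additive.

End WeightedMeasure.

Section Bergman.
Context {R : realType} {gamma : R} (hgamma : -1 < gamma).

Local Notation mu := (dA_ hgamma).

Definition Linfty (phi : R[i] -> R[i]) : Prop :=
  cmeasurable_on disk phi /\
  exists M : R, {ae mu, forall p, disk2 p -> normc (phi (toC p)) <= M}.

Definition L2 (f : R[i] -> R[i]) : Prop :=
  cmeasurable_on disk f /\
  (\int[mu]_(p in disk2) (normc (f (toC p)) ^+ 2)%:E < +oo)%E.

Definition inner (f g : R[i] -> R[i]) : R[i] :=
  cintegral mu disk (fun w => f w * (g w)^*).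

Definition A2 (f : R[i] -> R[i]) : Prop := holomorphic_on disk f /\ L2 f.

Definition is_bergman_proj (g h : R[i] -> R[i]) : Prop :=
  A2 h /\ forall f, A2 f -> inner (fun w => g w - h w) f = 0.

(* Orthogonal projection of L2 onto A2; it is determined on the disk.  [xget]
   picks the function given by [is_bergman_proj], and would only yield the
   default value 0 if there were none. *)
Definition bergman_proj (g : R[i] -> R[i]) : R[i] -> R[i] :=
  xget (fun=> 0) (is_bergman_proj g).

Definition toeplitz (phi f : R[i] -> R[i]) : R[i] -> R[i] :=
  bergman_proj (fun w => phi w * f w).

Definition normalized_kernel (xi w : R[i]) : R[i] :=
  ((1 - normc xi ^+ 2) `^ ((gamma + 2) / 2))%:C
  / cpow (1 - xi^* * w) (gamma + 2).

Definition berezin (T : (R[i] -> R[i]) -> (R[i] -> R[i])) (xi : R[i]) : R[i] :=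
  inner (T (normalized_kernel xi)) (normalized_kernel xi).

Definition Ber (T : (R[i] -> R[i]) -> (R[i] -> R[i])) : set R[i] :=
  berezin T @` disk.

End Bergman.

(* Main.v *)
(* The identity [int F |k_xi|^2 dA_gamma = F xi] holds for every holomorphic [F] on
   the disk such that [F |k_xi|^2] is integrable.  For [xi = 0] it is the mean
   value property, integrated over circles; the general case follows through the
   circle inversion that exchanges [0] and [xi], whose Jacobian turns [dA_gamma]
   into [|k_xi|^2 dA_gamma].  A bounded harmonic [phi] is [f + conj g] with [f] and
   [g] holomorphic, and both are square integrable because the mean value property
   of the square of a holomorphic function controls its imaginary part by its real
   part.  Applied to [(g - g xi) h / k_xi], the identity shows that
   [(f + conj (g xi)) k_xi] is the projection of [phi k_xi]; hence the Berezin
   transform at [xi] is [int phi |k_xi|^2 dA_gamma = f xi + conj (g xi) = phi xi]. *)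

From HB Require Import structures.
Require Import Defs.
From mathcomp Require Import all_boot all_order all_algebra.
From mathcomp Require Import complex.
From mathcomp Require Import all_classical all_reals all_analysis.
From mathcomp Require Import measurable_realfun lebesgue_integral ring lra.

Set Implicit Arguments.
Unset Strict Implicit.
Unset Printing Implicit Defensive.

Import Order.TTheory GRing.Theory Num.Theory.
Import numFieldNormedType.Exports Normc.

Local Open Scope classical_set_scope.
Local Open Scope ring_scope.

(** Everything is reduced to calculus on the line. Inversion changes area, but in polar coordinates
    with squared radius [s] it is [s -> 1 / s] at a fixed angle, so its Jacobian comes from a
    substitution in one variable. The mean value property and the existence of harmonic conjugates
    both come from Goursat's theorem for a closed form [P dx + Q dy] on a rectangle, used in polar
    and in Cartesian coordinates respectively. The obstacle is integrability: [f] and [g] may be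
    unbounded although [phi] is bounded. Changes of variables and slicing are therefore proved for
    nonnegative functions, and signed identities are recovered by moving negative terms to the other
    side or by treating positive and negative parts separately. The projection comes from [phi k -
    (f + conj (g xi)) k = conj (g - g xi) k]. Pairing the right side with [h] gives the conjugate of
    the integral of [F |k|^2], where [F = (g - g xi) h / k] is holomorphic because [k] has no zero
    in the disk, and vanishes at [xi]. *)

(** * Integration against a measure with a density *)

Section Density.
Local Open Scope ereal_scope.
Context d (T : measurableType d) (R : realType).
Variables (mu nu : {measure set T -> \bar R}) (w : T -> R).
Hypotheses (mw : measurable_fun setT w) (w0 : forall x, (0 <= w x)%R).
Hypothesis nuE : forall A, measurable A -> nu A = \int[mu]_(x in A) (w x)%:E.

Import HBNNSimple.

(** Simple functions and monotone convergence. The relation between [nu] and [mu] is a hypothesis,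
    so that the lemma serves both the measure [density] and [dA_], whose weight counts on the disk
    only. *)
Lemma ge0_integral_density (f : T -> \bar R) :
  measurable_fun setT f -> (forall x, 0 <= f x) ->
  \int[nu]_x f x = \int[mu]_x (f x * (w x)%:E).
Proof.
move=> mf f0; pose f_ := nnsfun_approx measurableT mf.
transitivity (limn (fun n => \int[nu]_x (f_ n x)%:E)).
  rewrite -monotone_convergence//.
  - apply: eq_integral => y _; apply/esym/cvg_lim => //.
    by apply: cvg_nnsfun_approx => // *; apply: f0.
  - by move=> n; exact/measurable_EFinP/measurable_funP.
  - by move=> n y _; rewrite lee_fin.
  - by move=> y _ m n mn; rewrite lee_fin; exact/lefP/nd_nnsfun_approx.
have mEw : measurable_fun setT (EFin \o w) by exact/measurable_EFinP.
rewrite [X in limn X](_ : _ =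
    (fun n => \int[mu]_x ((f_ n x)%:E * (w x)%:E))).
  rewrite -monotone_convergence//; last 3 first.
    - move=> n; apply: emeasurable_funM => //.
      exact/measurable_EFinP/measurable_funP.
    - by move=> n x _; rewrite mule_ge0// lee_fin.
    - move=> x _ m n mn; rewrite lee_wpmul2r ?lee_fin//.
      exact/lefP/nd_nnsfun_approx.
  apply: eq_integral => x _; apply/cvg_lim => //.
  apply: cvgeZr => //; apply: cvg_nnsfun_approx => // y _; exact: f0.
apply/funext => n.
have mfn r : measurable (f_ n @^-1` [set r]).
  by rewrite -(setTI (_ @^-1` _)); exact: measurable_funP.
transitivity (\sum_(k \in range (f_ n))
    \int[nu]_x (k * \1_(f_ n @^-1` [set k]) x)%:E).
  under eq_integral do rewrite fimfunE -fsumEFin//.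
  rewrite ge0_integral_fsum//.
  - by move=> y; exact/measurable_EFinP/measurable_funM.
  - by move=> y x _; rewrite nnfun_muleindic_ge0.
transitivity (\sum_(k \in range (f_ n))
    \int[mu]_x ((k * \1_(f_ n @^-1` [set k]) x)%:E * (w x)%:E)).
  apply: eq_fsbigr => r; rewrite inE/= => -[x0 _ fx0].
  have r0 : (0 <= r)%R by rewrite -fx0.
  rewrite integralZl_indic_nnsfun// integral_indic// setIT nuE//.
  rewrite [in LHS]integral_mkcond -ge0_integralZl//; last 2 first.
  - by apply/(measurable_restrictT _ (mfn r)); exact: measurable_funS mEw.
  - by move=> x _; apply: erestrict_ge0 => ? _; rewrite lee_fin.
  - by apply: eq_integral => x _; rewrite patchE indicE EFinM -muleA;
    case: ifPn => _; rewrite ?mul1e ?mul0e// mule0.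
rewrite -ge0_integral_fsum//.
- apply: eq_integral => x _; rewrite -ge0_mule_fsuml; last first.
    by move=> r; rewrite EFinM nnfun_muleindic_ge0.
  by congr (_ * _); rewrite fsumEFin// -fimfunE.
- move=> r; apply: emeasurable_funM => //.
  by exact/measurable_EFinP/measurable_funM.
- by move=> r x _; apply: mule_ge0; [rewrite EFinM nnfun_muleindic_ge0|rewrite lee_fin].
Qed.

End Density.

Section DensityMeasure.
Context d (T : measurableType d) (R : realType).
Variables (mu : {measure set T -> \bar R}) (w : T -> R).

Definition density of measurable_fun setT w & (forall x, 0 <= w x) : set T -> \bar R :=
  fun A => (\int[mu]_(x in A) (w x)%:E)%E.

Variables (mw : measurable_fun setT w) (w0 : forall x, 0 <= w x).

Let density0 : density mw w0 set0 = 0%E.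
Proof. by rewrite /density integral_set0. Qed.

Let density_ge0 A : (0 <= density mw w0 A)%E.
Proof. by apply: integral_ge0 => x _; rewrite lee_fin. Qed.

Let density_sigma_additive : semi_sigma_additive (density mw w0).
Proof.
move=> F mF tF mUF.
apply: (@semi_sigma_additive_nng_induced _ _ _ mu (EFin \o w)) => //.
by exact/measurable_EFinP.
Qed.

HB.instance Definition _ := isMeasure.Build _ _ _
  (density mw w0) density0 density_ge0 density_sigma_additive.

End DensityMeasure.

(** * Increasing substitutions on the line *)

Section Substitution.
Context {R : realType}.
Notation lambda := (@lebesgue_measure R).
Implicit Types (f : R -> \bar R) (g : R -> R) (a b : R).

Lemma integral_derive_cc g (g' : R -> R) a b : a <= b ->
  (forall x, a <= x <= b -> is_derive x 1 g (g' x)) ->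
  {within `[a, b], continuous g'} ->
  (\int[lambda]_(x in `[a, b]) (g' x)%:E = (g b - g a)%:E)%E.
Proof.
rewrite le_eqVlt => /predU1P[->|ab] dg cg'.
  by rewrite set_itv1 integral_set1 subrr.
have cg x : a <= x <= b -> {for x, continuous g}.
  move=> /dg gx; apply: differentiable_continuous.
  by apply/derivable1_diffP; exact: ex_derive.
rewrite (continuous_FTC2 ab cg' (F := g)) ?EFinB//; last first.
  move=> x; rewrite in_itv/= => /andP[ax xb].
  have ? : is_derive x 1 g (g' x) by apply: dg; rewrite !ltW.
  by rewrite derive1E derive_val.
split.
- move=> x; rewrite in_itv/= => /andP[ax xb].
  have ? : is_derive x 1 g (g' x) by apply: dg; rewrite !ltW.
  exact: ex_derive.
- by apply: cvg_at_right_filter; apply: cg; rewrite lexx ltW.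
- by apply: cvg_at_left_filter; apply: cg; rewrite lexx ltW.
Qed.

(** The intermediate value theorem gives end points with [g p = c] and [g q = min d (g b)]. The flag
    [s] is there because for [c < g a] the left end is [a] itself, which then belongs to the
    preimage. *)
Let setI_itv_preim g (a b c d : R) :
  {in `[a, b] &, {homo g : x y / x < y}} -> {within `[a, b], continuous g} ->
  a <= b -> c < d ->
  let X := `]c, d] `&` `[g a, g b] in
  exists2 pq : R * R, a <= pq.1 <= pq.2 /\ pq.2 <= b &
   (lambda X = (g pq.2 - g pq.1)%:E /\
   exists s, `[a, b] `&` g @^-1` `]c, d] = [set` Interval (BSide s pq.1) (BRight pq.2)])
   \/ (X = set0 /\ `[a, b] `&` g @^-1` `]c, d] = set0).
Proof.
move=> ginc cg ab cd X.
have gle x y : a <= x <= b -> a <= y <= b -> (g x <= g y) = (x <= y).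
  move=> xab yab; apply/idP/idP => [|].
    by apply: contraTT; rewrite -!ltNge; apply: ginc; rewrite in_itv.
  by rewrite le_eqVlt => /predU1P[->//|/ginc]; rewrite !in_itv/= => /(_ xab yab)/ltW.
have aab : a <= a <= b by rewrite lexx.
have bab : a <= b <= b by rewrite lexx andbT.
have gab : g a <= g b by rewrite gle.
have [dga|gad] := ltP d (g a).
  exists (a, a); [by rewrite /= lexx|right; split].
    apply/seteqP; split=> // x [] /=; rewrite !in_itv/= => /andP[_ xd] /andP[ax _].
    by have := lt_le_trans dga (le_trans ax xd); rewrite ltxx.
  apply/seteqP; split=> // x [] /=; rewrite !in_itv/= => xab /andP[_ xd].
  have : g a <= g x by rewrite gle//; case/andP: xab.
  by move=> ax; have := lt_le_trans dga (le_trans ax xd); rewrite ltxx.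
have [gbc|cgb] := leP (g b) c.
  exists (a, a); [by rewrite /= lexx|right; split].
    apply/seteqP; split=> // x [] /=; rewrite !in_itv/= => /andP[cx _] /andP[_ xb].
    by have := lt_le_trans cx (le_trans xb gbc); rewrite ltxx.
  apply/seteqP; split=> // x [] /=; rewrite !in_itv/= => xab /andP[cx _].
  have : g x <= g b by rewrite gle//; case/andP: xab.
  by move=> xb; have := lt_le_trans cx (le_trans xb gbc); rewrite ltxx.
have [q qab gq] : exists2 q, q \in `[a, b] & g q = Num.min d (g b).
  apply: IVT => //.
  by rewrite (min_idPl gab) (max_idPr gab) le_min gad gab ge_min lexx orbT.
have {}qab : a <= q <= b by move: qab; rewrite in_itv.
have [cga|gac] := ltP c (g a).
  exists (a, q); first by rewrite /= lexx; case/andP: qab.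
  left; split.
    have -> : X = `[g a, g q]%classic.
      rewrite /X gq; apply/seteqP; split=> x /=; rewrite !in_itv/= ?le_min.
        by move=> [/andP[_ ->] /andP[-> ->]].
      move=> /and3P[ax xd xb]; split; last by rewrite ax xb.
      by rewrite xd andbT (lt_le_trans cga).
    rewrite /= lebesgue_measure_itv/= lte_fin; case: ltP => // h.
    have /eqP : g a == g q by rewrite eq_le h gle//; case/andP: qab => ->.
    by move=> ->; rewrite subrr.
  exists true; apply/seteqP; split=> x /=; rewrite !in_itv/=.
    move=> [xab /andP[_ xd]]; have := xab; rewrite -(gle x q)// gq le_min xd.
    by rewrite gle//; case/andP: xab => -> ->.
  move=> /andP[ax xq]; have xab : a <= x <= b.
    by rewrite ax (le_trans xq)//; case/andP: qab.
  split => //; rewrite (lt_le_trans cga) ?gle//=.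
  by move: xq; rewrite -gle// gq le_min => /andP[].
have [p pab gp] : exists2 p, p \in `[a, b] & g p = c.
  apply: IVT => //.
  by rewrite (min_idPl gab) (max_idPr gab) gac ltW.
have {}pab : a <= p <= b by move: pab; rewrite in_itv.
have pq : p <= q by rewrite -gle// gp gq le_min !ltW.
exists (p, q); first by rewrite /= pq; case/andP: pab => ->; case/andP: qab => _ ->.
left; split.
  have -> : X = `]g p, g q]%classic.
    rewrite /X gq gp; apply/seteqP; split=> x /=; rewrite !in_itv/= ?le_min.
      by move=> [/andP[-> ->] /andP[_ ->]].
    by move=> /and3P[cx xd xb]; rewrite cx xd xb (le_trans gac)// ltW.
  rewrite /= lebesgue_measure_itv/= lte_fin; case: (ltP (g p) (g q)) => // h.
  have /eqP : g p == g q by rewrite eq_le h gle ?pq.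
  by move=> ->; rewrite subrr.
exists false; apply/seteqP; split=> x /=; rewrite !in_itv/=.
  move=> [xab /andP[cx xd]]; rewrite -(gle x q)// gq le_min xd ltNge -gle// gp -ltNge cx.
  by rewrite gle//; case/andP: xab => _ ->.
move=> /andP[px xq]; have xab : a <= x <= b.
  rewrite (le_trans _ (ltW px)) ?(le_trans xq)//; first by case/andP: qab.
  by case/andP: pab.
split => //; rewrite -gp ltNge gle// -ltNge px/=.
by move: xq; rewrite -gle// gq le_min => /andP[].
Qed.

(** The measure with density [g'] on [[a, b]], pushed forward by [g], is Lebesgue measure on
    [[g a, g b]]: the fundamental theorem of calculus shows that they agree on half-open
    intervals. *)
Lemma ge0_substitution_cc (f : R -> \bar R) (g g' : R -> R) (a b : R) : a <= b ->
  measurable_fun setT g -> measurable_fun setT g' -> (forall x, a <= x <= b -> 0 <= g' x) ->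
  {in `[a, b] &, {homo g : x y / x < y}} ->
  (forall x, a <= x <= b -> is_derive x 1 g (g' x)) ->
  {within `[a, b], continuous g'} ->
  measurable_fun setT f -> (forall x, 0 <= f x)%E ->
  (\int[lambda]_(y in `[g a, g b]) f y =
   \int[lambda]_(x in `[a, b]) (f (g x) * (g' x)%:E))%E.
Proof.
move=> ab mg mg' g'0 ginc dg cg' mf f0.
have cg : {within `[a, b], continuous g}.
  apply: continuous_in_subspaceT => x /[!inE]/=; rewrite in_itv/= => /dg gx.
  by apply: differentiable_continuous; apply/derivable1_diffP; exact: ex_derive.
pose w := g' \_ `[a, b].
have mw : measurable_fun setT w.
  by apply/(measurable_restrictT _ (measurable_itv _)); exact: measurable_funS mg'.
have w0 x : 0 <= w x.
  by rewrite /w patchE; case: ifPn => // /[!inE]/=; rewrite in_itv; exact: g'0.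
pose J : set R := `[g a, g b]%classic.
have mJ : measurable J by exact: measurable_itv.
pose dens : {measure set (measurableTypeR R) -> \bar R} := density lambda mw w0.
pose mg_mixin := isMeasurableFun.Build _ _ (measurableTypeR R) (measurableTypeR R) g mg.
pose gm : {mfun (measurableTypeR R) >-> (measurableTypeR R)} := HB.pack g mg_mixin.
pose nu_ : {measure set (measurableTypeR R) -> \bar R} := pushforward dens gm.
pose nu := nu_ mg.
have densE A : measurable A -> dens A = (\int[lambda]_(x in `[a, b] `&` A) (g' x)%:E)%E.
  move=> mA; rewrite /dens /= /density /w setIC [RHS]integral_mkcondr.
  by apply: eq_integral => x _; rewrite restrict_EFin.
have nuE A : measurable A -> A `<=` J -> lambda A = nu A.
  move=> mA AJ.
  (* The pushforward does not charge the complement of [J]. Lebesgue measure is added there, because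
     its uniqueness theorem concerns measures on the whole line. *)
  pose m2 : {measure set (measurableTypeR R) -> \bar R} :=
    measure_add nu (mrestr lambda (measurableC mJ)).
  have m2E B : m2 B = (nu B + lambda (B `&` ~` J))%E.
    by rewrite /m2/= /measure_add/= /msum !big_ord_recr/= big_ord0 add0e.
  rewrite (lebesgue_measure_unique (mu := m2))//.
    by rewrite m2E (_ : A `&` _ = set0) ?measure0 ?adde0//; apply/disjoints_subset; rewrite setCK.
  move=> _ [[c d] /= cd <-].
  have {cd}[dc|cd] := leP d c.
    by rewrite set_itv_ge ?measure0// bnd_simp -leNgt.
  rewrite m2E -[in LHS](setIT `]c, d]%classic) -(setUv J) setIUr measureU//=; last 3 first.
  - exact: measurableI.
  - by apply: measurableI => //; exact: measurableC.
  - by rewrite setIACA setICr setI0.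
  congr (_ + _)%E.
  have [[p q] [/andP[/= ap pq] qb]] := setI_itv_preim ginc cg ab cd.
  rewrite /nu/= /pushforward densE; last first.
    by rewrite -(setTI (g @^-1` _)); exact: (mg).
  case=> [[-> [s ->]]|[-> ->]]; last by rewrite measure0 integral_set0.
  have pqE : (\int[lambda]_(x in `[p, q]) (g' x)%:E = (g q - g p)%:E)%E.
    apply: integral_derive_cc => //.
      by move=> x /andP[px xq]; apply: dg; rewrite (le_trans ap)//= (le_trans xq).
    apply: continuous_subspaceW cg' => x /=; rewrite !in_itv/= => /andP[px xq].
    by rewrite (le_trans ap)//= (le_trans xq).
  rewrite -pqE; case: s => //; rewrite integral_itv_obnd_cbnd//.
  by apply/measurable_EFinP; exact: measurable_funS mg'.
rewrite (eq_measure_integral nu)//.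
rewrite ge0_integral_pushforward//; last exact: measurable_funS mf.
have mgJ : measurable (g @^-1` J) by rewrite -(setTI (g @^-1` _)); exact: (mg).
have mfg : measurable_fun setT (f \o g) by exact: measurableT_comp.
rewrite integral_mkcond (@ge0_integral_density _ _ _ lambda _ w)//; last 2 first.
- by apply/(measurable_restrictT _ mgJ); exact: measurable_funS mfg.
- by move=> x; apply: erestrict_ge0 => y _ /=.
rewrite [RHS]integral_mkcond; apply: eq_integral => x _.
rewrite /w !patchE; case: (boolP (x \in `[a, b]%classic)) => [|_]; last first.
  by rewrite mule0.
rewrite inE/= in_itv/= => xab; rewrite mem_set//= /J/= in_itv/=.
have gle x' y' : a <= x' <= y' -> y' <= b -> g x' <= g y'.
  move=> /andP[ax xy] yb; move: xy; rewrite le_eqVlt => /predU1P[->//|xy].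
  by apply/ltW/ginc; rewrite ?in_itv//= ?ax ?yb ?andbT/= ?(le_trans (ltW xy))// ?(le_trans ax (ltW xy)).
by case/andP: xab => ax xb; rewrite !gle ?lexx ?ax.
Qed.

(** Compact intervals exhaust [I], and monotone convergence passes to the limit. This admits
    unbounded intervals, and derivatives that blow up at an end point such as [(1 - s) ^ gamma] with
    [gamma < 0]. *)
Lemma ge0_substitution (f : R -> \bar R) (g g' : R -> R) (a b : R^nat) (I J : set R) :
  measurable_fun setT g -> measurable_fun setT g' -> (forall x, I x -> 0 <= g' x) ->
  (forall n, a n <= b n) ->
  {homo a : n m / (n <= m)%N >-> n >= m} -> {homo b : n m / (n <= m)%N >-> n <= m} ->
  I = \bigcup_n `[a n, b n]%classic -> is_interval J ->
  (forall x, I x -> J (g x)) -> (forall y, J y -> exists2 x, I x & g x = y) ->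
  {in I &, {homo g : x y / x < y}} ->
  (forall x, I x -> is_derive x 1 g (g' x)) ->
  (forall x, I x -> {for x, continuous g'}) ->
  measurable_fun setT f -> (forall x, 0 <= f x)%E ->
  (\int[lambda]_(y in J) f y = \int[lambda]_(x in I) (f (g x) * (g' x)%:E))%E.
Proof.
move=> mg mg' g'0 ab da nb IE iJ IJ JI ginc dg cg' mf f0.
have sI n : `[a n, b n]%classic `<=` I by rewrite IE => x xn; exists n.
have gle x y : I x -> I y -> x <= y -> g x <= g y.
  move=> Ix Iy; rewrite le_eqVlt => /predU1P[->//|xy].
  by apply/ltW/ginc; rewrite ?inE.
have Ia n : I (a n) by apply: (sI n); rewrite /= in_itv/= lexx ab.
have Ib n : I (b n) by apply: (sI n); rewrite /= in_itv/= lexx ab.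
have JE : J = \bigcup_n `[g (a n), g (b n)]%classic.
  apply/seteqP; split=> [y /JI[x Ix <-]|y [n _]].
    have := Ix; rewrite {1}IE => -[n _ xn]; exists n => //.
    have := xn; rewrite /= !in_itv/= => /andP[ax xb].
    by rewrite !gle.
  by rewrite /= in_itv/=; apply: iJ; exact: IJ.
have hJ : (\int[lambda]_(y in `[g (a n), g (b n)]) f y @[n --> \oo] -->
    \int[lambda]_(y in J) f y)%E.
  rewrite JE; apply: ge0_nondecreasing_set_cvg_integral => //.
  - move=> n m nm; apply/subsetPset => x /=; rewrite !in_itv/= => /andP[ax xb].
    by rewrite (le_trans _ ax) ?(le_trans xb)//; apply: gle => //; [exact: nb|exact: da].
  - by move=> n; exact: measurable_funS mf.
have hI : (\int[lambda]_(x in `[a n, b n]) (f (g x) * (g' x)%:E) @[n --> \oo] -->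
    \int[lambda]_(x in I) (f (g x) * (g' x)%:E))%E.
  rewrite IE; apply: ge0_nondecreasing_set_cvg_integral => //.
  - move=> n m nm; apply/subsetPset => x /=; rewrite !in_itv/= => /andP[ax xb].
    by rewrite (le_trans _ ax) ?(le_trans xb)//; [exact: nb|exact: da].
  - move=> n; apply: emeasurable_funM.
      by apply: measurable_funS (measurableT_comp mf mg).
    by apply/measurable_EFinP; exact: measurable_funS mg'.
  - by move=> n x /sI/g'0 ?; rewrite mule_ge0 ?lee_fin.
apply: cvg_unique hI => //.
apply: cvg_trans hJ; apply: near_eq_cvg; apply: nearW => n /=.
have := @ge0_substitution_cc f g g' (a n) (b n) (ab n) mg mg'.
apply=> //.
- by move=> x xab; apply: g'0; apply: (sI n); rewrite /= in_itv.
- by move=> x y xab yab; apply: ginc; rewrite inE; apply: (sI n).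
- by move=> x xab; apply: dg; apply: (sI n); rewrite /= in_itv.
- apply: continuous_in_subspaceT => x /[!inE] xab; apply: cg'; exact: (sI n).
Qed.

End Substitution.

(** * The substitutions used below *)

Section SubstitutionInstances.
Context {R : realType}.
Notation lambda := (@lebesgue_measure R).
Implicit Types f : R -> \bar R.
Local Open Scope ereal_scope.

Lemma setT_bigcup_cc : [set: R] = \bigcup_n `[(- n%:R)%R, n%:R]%classic.
Proof.
apply/seteqP; split=> // x _; exists (Num.truncn `|x|).+1 => //=.
rewrite in_itv/= -ler_norml; apply/ltW/truncnS_gt.
Qed.

Lemma oy_bigcup_cc : (`]0%R, +oo[%classic : set R) = \bigcup_n `[n.+1%:R^-1%R, n.+1%:R]%classic.
Proof.
apply/seteqP; split=> x /=; rewrite in_itv/= ?andbT.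
  (* Both [x] and [x^-1] are below [x + x^-1], so one integer serves both ends. *)
  move=> x0; exists (Num.truncn (x + x^-1)%R) => //=.
  have h := truncnS_gt (x + x^-1)%R.
  rewrite in_itv/= invf_ple ?posrE//; apply/andP; split.
    by rewrite (le_trans _ (ltW h))// lerDr ltW.
  by rewrite (le_trans _ (ltW h))// lerDl invr_ge0 ltW.
by move=> [n _] /=; rewrite in_itv/= => /andP[nx _]; rewrite (lt_le_trans _ nx).
Qed.

(** Starting at [n.+2] keeps the end points in order, as [ge0_substitution] requires: [1 / (n + 2)]
    is at most [1 / 2]. *)
Lemma oo01_bigcup_cc : (`]0%R, 1%R[%classic : set R) =
  \bigcup_n `[n.+2%:R^-1%R, (1 - n.+2%:R^-1)%R]%classic.
Proof.
apply/seteqP; split=> x /=; rewrite in_itv/=.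
  move=> /andP[x0 x1]; exists (Num.truncn (x^-1 + (1 - x)^-1)%R) => //=.
  have h := truncnS_gt (x^-1 + (1 - x)^-1)%R; set N := Num.truncn _ in h *.
  have x1' : (0 < 1 - x)%R by rewrite subr_gt0.
  have hN : (x^-1 + (1 - x)^-1 <= N.+2%:R)%R by rewrite (le_trans (ltW h))// ler_nat.
  rewrite in_itv/= invf_ple ?posrE// lerBrDr addrC -lerBrDr.
  rewrite (@invf_ple _ _ (1 - x)%R) ?posrE//; apply/andP; split.
    by rewrite (le_trans _ hN)// lerDl invr_ge0 ltW.
  by rewrite (le_trans _ hN)// lerDr invr_ge0 ltW.
move=> [n _] /=; rewrite in_itv/= => /andP[nx xn].
by rewrite (lt_le_trans _ nx)// (le_lt_trans xn)// ltrBlDr ltrDl.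
Qed.

Lemma ge0_substitution_affine f (k c : R) : (0 < k)%R ->
  measurable_fun setT f -> (forall x, 0 <= f x) ->
  \int[lambda]_y f y = \int[lambda]_x (f (k * x + c)%R * k%:E).
Proof.
move=> k0 mf f0.
have dg (x : R) : is_derive x 1%R (fun x : R => (k * x + c)%R) k.
  by apply: is_derive_eq; rewrite addr0 /GRing.scale/= mulr1.
apply: (@ge0_substitution _ f (fun x => k * x + c)%R (cst k)
  (fun n => - n%:R)%R (fun n => n%:R)) => //.
- by apply: measurable_funD => //; exact: measurable_funM.
- by move=> x _ /=; exact: ltW.
- by move=> n; rewrite ge0_cp.
- by move=> n m nm; rewrite lerN2 ler_nat.
- by move=> n m nm; rewrite ler_nat.
- exact: setT_bigcup_cc.
- by move=> y _; exists ((y - c) / k)%R => //; rewrite mulrCA divff ?gt_eqF// mulr1 subrK.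
- by move=> x y _ _ xy; rewrite ltrD2r ltr_pM2l.
- by move=> x _; exact: cst_continuous.
Qed.

Lemma ge0_substitution_sqr f (k : R) : (0 < k)%R ->
  measurable_fun setT f -> (forall x, 0 <= f x) ->
  \int[lambda]_(y in `]0%R, +oo[) f y =
  \int[lambda]_(x in `]0%R, +oo[) (f (k * x ^+ 2)%R * (2 * k * x)%:E).
Proof.
move=> k0 mf f0.
have dg (x : R) : is_derive x 1%R (fun x : R => (k * x ^+ 2)%R) (2 * k * x)%R.
  by apply: is_derive_eq; rewrite /GRing.scale/=; ring.
apply: (@ge0_substitution _ f (fun x => k * x ^+ 2)%R (fun x => 2 * k * x)%R
  (fun n => n.+1%:R^-1)%R (fun n => n.+1%:R)) => //.
- by apply: measurable_funM => //; exact: measurable_funX.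
- exact: measurable_funM.
- by move=> x /=; rewrite in_itv/= andbT => x0; rewrite !mulr_ge0// ltW.
- by move=> n; rewrite (@le_trans _ _ 1%R) ?ler1n// invf_le1// ler1n.
- by move=> n m nm; rewrite lef_pV2 ?posrE// ler_nat.
- by move=> n m nm; rewrite ler_nat.
- exact: oy_bigcup_cc.
- exact: interval_is_interval.
- by move=> x /=; rewrite !in_itv/= !andbT => x0; rewrite mulr_gt0// exprn_gt0.
- move=> y /=; rewrite in_itv/= andbT => y0; exists (Num.sqrt (y / k)).
    by rewrite /= in_itv/= andbT sqrtr_gt0 divr_gt0.
  by rewrite sqr_sqrtr ?divr_ge0 ?ltW// mulrC divfK// gt_eqF.
- move=> x y /[!inE]/=; rewrite !in_itv/= !andbT => x0 y0 xy.
  by rewrite ltr_pM2l// ltrXn2r// ?nnegrE ltW.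
- move=> x _; apply: continuousM; [exact: cst_continuous|exact: cvg_id].
Qed.

(** Inversion is discontinuous at 0. It is rewritten as the product of [x] and a real power of
    [x ^+ 2], which agrees with it at 0 as well. *)
Lemma measurable_invr : measurable_fun [set: R] (@GRing.inv R).
Proof.
have -> : @GRing.inv R = (fun x => x * (x ^+ 2) `^ (-1))%R.
  apply/funext => x; have [->|x0] := eqVneq x 0%R; first by rewrite invr0 mul0r.
  by rewrite powR_inv1 ?sqr_ge0// expr2 invfM mulVKf.
apply: measurable_funM => //; apply: (measurableT_comp (measurable_powR (-1)%R)).
exact: measurable_funX.
Qed.

Lemma ge0_substitution_inv f :
  measurable_fun setT f -> (forall x, 0 <= f x) ->
  \int[lambda]_(y in `]0%R, +oo[) f y =
  \int[lambda]_(x in `]0%R, +oo[) (f (x^-1)%R * (x ^- 2)%:E).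
Proof.
move=> mf f0.
(* The map [x -> x^-1] decreases, so the integrand is first reflected to the negative half-line,
   which [- x^-1] parametrizes increasingly. *)
rewrite integral_itv_obnd_cbnd; last exact: measurable_funS mf.
rewrite ge0_integration_by_substitution0//.
have mfN : measurable_fun setT (fun r : R => f (- r)%R).
  by apply: measurableT_comp mf _; exact: oppr_measurable.
rewrite -integral_itv_bndo_bndc; last exact: measurable_funS mfN.
have dg (x : R) : x \in `]0%R, +oo[ -> is_derive x 1%R (fun x : R => - x^-1)%R (x ^- 2).
  rewrite in_itv/= andbT => x0.
  have x0' : x != 0%R by rewrite gt_eqF.
  have ? := is_deriveV x0' (is_derive_id x 1%R).
  by apply: is_derive_eq; rewrite /GRing.scale/= mulr1 opprK.
rewrite (@ge0_substitution _ (fun r : R => f (- r)%R) (fun x => - x^-1)%R (fun x => x ^- 2)%R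
  (fun n => n.+1%:R^-1)%R (fun n => n.+1%:R) `]0%R, +oo[%classic)//.
- by apply: eq_integral => x _; rewrite opprK.
- by apply: measurable_funN; exact: measurable_invr.
- apply: (measurableT_comp measurable_invr); exact: measurable_funX.
- by move=> x /=; rewrite in_itv/= andbT => x0; rewrite invr_ge0 exprn_ge0// ltW.
- by move=> n; rewrite (@le_trans _ _ 1%R) ?ler1n// invf_le1// ler1n.
- by move=> n m nm; rewrite lef_pV2 ?posrE// ler_nat.
- by move=> n m nm; rewrite ler_nat.
- exact: oy_bigcup_cc.
- exact: interval_is_interval.
- by move=> x /=; rewrite !in_itv/= !andbT => x0; rewrite oppr_lt0 invr_gt0.
- move=> y /=; rewrite in_itv/= => y0; exists (- y^-1)%R.
    by rewrite /= in_itv/= andbT oppr_gt0 invr_lt0.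
  by rewrite invrN opprK invrK.
- move=> x y /[!inE]/=; rewrite !in_itv/= !andbT => x0 y0 xy.
  by rewrite ltrN2 ltf_pV2.
- move=> x /=; rewrite in_itv/= andbT => x0; apply: cvgV; first by rewrite expf_neq0// gt_eqF.
  exact: exprn_continuous.
Qed.

Lemma ge0_substitution_atan f :
  measurable_fun setT f -> (forall x, 0 <= f x) ->
  \int[lambda]_(t in `](- (pi / 2))%R, (pi / 2)%R[) f t =
  \int[lambda]_x (f (atan x) * ((1 + x ^+ 2)^-1)%:E).
Proof.
move=> mf f0.
have c0 (x : R) : (1 + x ^+ 2)%R != 0%R by rewrite gt_eqF// ltr_wpDr// sqr_ge0.
apply: (@ge0_substitution _ f atan (fun x => (1 + x ^+ 2)^-1)%R
  (fun n => - n%:R)%R (fun n => n%:R)) => //.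
- by apply: continuous_measurable_fun => x; exact: continuous_atan.
- apply: (measurableT_comp measurable_invr).
  by apply: measurable_funD => //; exact: measurable_funX.
- by move=> x _ /=; rewrite invr_ge0 addr_ge0// sqr_ge0.
- by move=> n; rewrite ge0_cp.
- by move=> n m nm; rewrite lerN2 ler_nat.
- by move=> n m nm; rewrite ler_nat.
- exact: setT_bigcup_cc.
- exact: interval_is_interval.
- by move=> x _; rewrite /= in_itv/= atan_gtNpi2 atan_ltpi2.
- by move=> y yI; exists (tan y) => //; rewrite tanK.
- by move=> x y _ _; exact: lt_atan.
- move=> x _; apply: cvgV => //; apply: cvgD; [exact: cvg_cst|exact: exprn_continuous].
Qed.

(** The antiderivative [- (1 - s) ^ (g + 1)] maps []0, 1[] increasingly onto []-1, 0[]. Taken as the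
    new variable, it turns the integral into the length of that interval, and the singularity at 1
    for [g < 0] does no harm. *)
Lemma integral_weight01 (g : R) : (-1 < g)%R ->
  \int[lambda]_(s in `]0%R, 1%R[) ((g + 1) * (1 - s) `^ g)%:E = 1.
Proof.
move=> g1; have g0 : (0 < g + 1)%R by rewrite -ltrBlDr sub0r.
have dg (x : R) : (0 < x < 1)%R ->
    is_derive x 1%R (fun x : R => - (1 - x) `^ (g + 1))%R ((g + 1) * (1 - x) `^ g)%R.
  move=> /andP[x0 x1]; have x1' : (0 < 1 - x)%R by rewrite subr_gt0.
  have h : is_derive x 1%R (fun x : R => 1 - x)%R (- 1)%R.
    by apply: is_derive_eq; rewrite ?sub0r ?add0r ?mul1r.
  have ? := @is_derive1_comp _ (fun y : R => y `^ (g + 1))%R (fun y => 1 - y)%R _ _ _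
    (is_derive1_powR (g + 1) x1') h.
  apply: is_derive_eq; rewrite /GRing.scale/= addrK; ring.
transitivity (\int[lambda]_(y in `](-1)%R, 0%R[) (cst 1 : R -> \bar R) y).
  rewrite (@ge0_substitution _ (cst 1) (fun x => - (1 - x) `^ (g + 1))%R
    (fun x => (g + 1) * (1 - x) `^ g)%R
    (fun n => n.+2%:R^-1)%R (fun n => 1 - n.+2%:R^-1)%R `]0%R, 1%R[%classic)//.
  - by apply: eq_integral => x _; rewrite mul1e.
  - apply: measurable_funN; apply: (measurableT_comp (measurable_powR (g + 1)%R)).
    exact: measurable_funB.
  - apply: measurable_funM => //; apply: (measurableT_comp (measurable_powR g)).
    exact: measurable_funB.
  - by move=> x _; rewrite mulr_ge0 ?powR_ge0// ltW.
  - move=> n; have : (n.+2%:R^-1 <= 2^-1 :> R)%R by rewrite lef_pV2 ?posrE// ler_nat.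
    by move: (n.+2%:R^-1 : R)%R => z; lra.
  - by move=> n m nm; rewrite lef_pV2 ?posrE// ler_nat !ltnS.
  - by move=> n m nm; rewrite lerD2l lerN2 lef_pV2 ?posrE// ler_nat !ltnS.
  - exact: oo01_bigcup_cc.
  - exact: interval_is_interval.
  - move=> x /=; rewrite !in_itv/= => /andP[x0 x1].
    have x1' : (0 < 1 - x)%R by rewrite subr_gt0.
    rewrite ltrN2 oppr_lt0 powR_gt0// andbT.
    have : ((1 - x) `^ (g + 1) < 1 `^ (g + 1))%R.
      by rewrite gt0_ltr_powR ?nnegrE// ?ltW// ltrBlDr ltrDl.
    by rewrite powR1.
  - move=> y /=; rewrite in_itv/= => /andP[y1 y0].
    have Ny0 : (0 < - y)%R by rewrite oppr_gt0.
    exists (1 - (- y) `^ (g + 1)^-1)%R.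
      rewrite /= in_itv/= subr_gt0 ltrBlDr ltrDl powR_gt0// andbT.
      have : ((- y) `^ (g + 1)^-1 < 1 `^ (g + 1)^-1)%R.
        by rewrite gt0_ltr_powR ?nnegrE ?invr_gt0 ?ler01// ?ltW// ltrNl.
      by rewrite powR1.
    by rewrite opprB addrC subrK -powRrM mulVf ?gt_eqF// powRr1 ?opprK// ltW.
  - move=> x y /[!inE]/=; rewrite !in_itv/= => /andP[x0 x1] /andP[y0 y1] xy.
    by rewrite ltrN2 gt0_ltr_powR ?nnegrE ?subr_ge0 ?ltW// ltrD2l ltrN2.
  - move=> x /=; rewrite in_itv/= => /andP[x0 x1].
    have x1' : (0 < 1 - x)%R by rewrite subr_gt0.
    apply: differentiable_continuous; apply/derivable1_diffP.
    have h : is_derive x 1%R (fun x : R => 1 - x)%R (- 1)%R.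
      by apply: is_derive_eq; rewrite ?sub0r ?add0r ?mul1r.
    have ? := @is_derive1_comp _ (fun y : R => y `^ g)%R (fun y => 1 - y)%R _ _ _
      (is_derive1_powR g x1') h.
    exact: ex_derive.
rewrite integral_cst// mul1e /= lebesgue_measure_itv/= lte_fin ltrN10.
by rewrite -EFinB sub0r opprK.
Qed.

End SubstitutionInstances.

(** * Polar coordinates *)

Section Polar.
Context {R : realType}.
Notation lambda := (@lebesgue_measure R).
Local Notation RR := (measurableTypeR R * measurableTypeR R)%type.
Local Open Scope ereal_scope.

(** Tonelli's theorem for [F] extended by 0. Nonnegativity is asked on the rectangle only, since an
    integrand such as [M1] below may be negative outside it. *)
Lemma ge0_fubini_setX (A B : set R) (F : RR -> \bar R) :
  measurable A -> measurable B -> measurable_fun setT F ->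
  (forall x y, A x -> B y -> 0 <= F (x, y)) ->
  \int[lambda]_(x in A) \int[lambda]_(y in B) F (x, y) =
  \int[lambda]_(y in B) \int[lambda]_(x in A) F (x, y).
Proof.
move=> mA mB mF F0.
have mAB : measurable (A `*` B : set RR) by exact: measurableX.
pose G := F \_ (A `*` B : set RR).
have mG : measurable_fun setT G.
  by apply/(measurable_restrictT _ mAB); exact: measurable_funS mF.
have G0 z : 0 <= G z.
  by case: z => x y; apply: erestrict_ge0 => -[x' y'] [/=]; exact: F0.
have GE x y : G (x, y) = if x \in A then (if y \in B then F (x, y) else 0) else 0.
  by rewrite /G patchE in_setX/=; case: (x \in A) => //=; case: (y \in B).
transitivity (\int[lambda]_x \int[lambda]_y G (x, y)).
  rewrite [LHS]integral_mkcond; apply: eq_integral => x _; rewrite patchE.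
  case: ifPn => xA; last by rewrite integral0_eq// => y _; rewrite GE (negbTE xA).
  by rewrite integral_mkcond; apply: eq_integral => y _; rewrite GE xA patchE.
rewrite (fubini_tonelli _ mG G0).
rewrite [RHS]integral_mkcond; apply: eq_integral => y _; rewrite patchE.
case: ifPn => yB; last first.
  by rewrite integral0_eq// => x _; rewrite GE (negbTE yB); case: ifP.
by rewrite [RHS]integral_mkcond; apply: eq_integral => x _; rewrite GE yB patchE.
Qed.

Lemma ge0_integral_oppr (f : R -> \bar R) :
  measurable_fun setT f -> (forall x, 0 <= f x) ->
  \int[lambda]_x f x = \int[lambda]_x f (- x)%R.
Proof.
move=> mf f0.
have mN : measurable_fun [set: measurableTypeR R] (-%R : _ -> measurableTypeR R).
  exact: oppr_measurable.
rewrite [RHS](_ : _ = \int[lambda]_(x in -%R @^-1` setT) (f \o -%R) x)//.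
rewrite -(ge0_integral_pushforward mN)//.
by apply: eq_measure_integral => A mA _; exact/esym/lebesgue_measureN.
Qed.

Let opp2 (p : RR) : RR := (- p.1, - p.2)%R.

Let measurable_opp2 : measurable_fun setT opp2.
Proof.
by apply: measurable_fun_pair; apply: measurable_funN;
  [exact: measurable_fst|exact: measurable_snd].
Qed.

(** The left half-plane is folded over by [z -> - z] and not by a reflection. This pairs opposite
    points, and the evenness argument on circles later relies on that pairing. *)
Let ge0_integral_halfplane (f : RR -> \bar R) :
  measurable_fun setT f -> (forall z, 0 <= f z) ->
  \int[lambda \x lambda]_z f z =
  \int[lambda]_(x in `]0%R, +oo[) \int[lambda]_y (f (x, y) + f (- x, - y)%R).
Proof.
move=> mf f0.
have mfo : measurable_fun setT (f \o opp2) by exact: measurableT_comp.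
pose F x := \int[lambda]_y f (x, y).
have mF : measurable_fun setT F.
  exact: (@measurable_fun_fubini_tonelli_F _ _ _ _ _ lambda f).
have F0 x : 0 <= F x by apply: integral_ge0.
rewrite (fubini_tonelli1 _ mf f0).
have TE : [set: R] = (`]-oo, 0%R] `|` `]0%R, +oo[)%classic.
  apply/seteqP; split=> // x _ /=; rewrite !in_itv/= andbT.
  by case: (leP x 0%R); [left|right].
rewrite [LHS](_ : _ = \int[lambda]_(x in (`]-oo, 0%R] `|` `]0%R, +oo[)%classic) F x); last first.
  by rewrite -TE.
rewrite ge0_integral_setU//=; first last.
- apply/disj_set2P/seteqP; split=> // x [] /=; rewrite !in_itv/= andbT.
  by move=> x0; rewrite ltNge x0.
- exact: measurable_funS mF.
have mFN : measurable_fun setT (fun r : R => F (- r)%R).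
  by apply: measurableT_comp mF _; exact: oppr_measurable.
have -> : \int[lambda]_(x in `]-oo, 0%R]) F x = \int[lambda]_(x in `]0%R, +oo[) F (- x)%R.
  rewrite [RHS]integral_itv_obnd_cbnd; last exact: measurable_funS mFN.
  rewrite (@ge0_integration_by_substitution0 _ (fun r : R => F (- r)%R) mFN (fun r => F0 _)).
  by apply: eq_integral => x _; rewrite opprK.
rewrite addeC -ge0_integralD//; last 2 first.
- exact: measurable_funS mF.
- exact: measurable_funS mFN.
apply: eq_integral => x _.
have mfx u : measurable_fun setT (fun y : R => f (u, y)).
  by apply: measurableT_comp mf _; exact: pair1_measurable.
rewrite /F [X in _ + X]ge0_integral_oppr// -ge0_integralD//.
  exact: mfx.
have mfox : measurable_fun setT (fun y : R => (f \o opp2) (x, y)).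
  by apply: measurableT_comp mfo _; exact: pair1_measurable.
exact: mfox.
Qed.

(** The angle enters through the slope: [y = c x] gives [x dx dc], then [s = (1 + c ^ 2) x ^ 2] at
    fixed [c] gives [ds dc / (2 (1 + c ^ 2))], and [c = tan t] gives [ds dt / 2]. Each step is a
    substitution in one variable, with Tonelli's theorem in between to exchange the order. *)
Lemma ge0_integral_polar (f : RR -> \bar R) :
  measurable_fun setT f -> (forall z, 0 <= f z) ->
  \int[lambda \x lambda]_z f z =
  \int[lambda]_(s in `]0%R, +oo[) \int[lambda]_(t in `](- (pi / 2))%R, (pi / 2)%R[)
    ((f (Num.sqrt s * cos t, Num.sqrt s * sin t)%R +
      f (- (Num.sqrt s * cos t), - (Num.sqrt s * sin t))%R) * (2^-1)%:E).
Proof.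
move=> mf f0; rewrite (ge0_integral_halfplane mf f0).
pose e (z : RR) := f z + f (opp2 z).
have me : measurable_fun setT e.
  by apply: emeasurable_funD => //; exact: measurableT_comp.
have e0 z : 0 <= e z by rewrite adde_ge0.
have msqrt : measurable_fun setT (@Num.sqrt R).
  by apply: continuous_measurable_fun => x; exact: sqrt_continuous.
have kgt0 (c : R) : (0 < 1 + c ^+ 2)%R by rewrite ltr_pwDl// sqr_ge0.
pose M1 (z : RR) := e (z.1, (z.1 * z.2)%R) * z.1%:E.
have mM1 : measurable_fun setT M1.
  apply: emeasurable_funM; last by apply/measurable_EFinP; exact: measurable_fst.
  apply: measurableT_comp me _; apply: measurable_fun_pair => //.
  exact: measurable_funM.
transitivity (\int[lambda]_(x in `]0%R, +oo[) \int[lambda]_y M1 (x, y)).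
  apply: eq_integral => x; rewrite inE/= in_itv/= andbT => x0.
  have mex : measurable_fun setT (fun y : R => e (x, y)).
    by apply: measurableT_comp me _; exact: pair1_measurable.
  transitivity (\int[lambda]_y e (x, y)) => //.
  rewrite (@ge0_substitution_affine _ _ x 0%R)//.
  by apply: eq_integral => y _; rewrite addr0.
rewrite (@ge0_fubini_setX `]0%R, +oo[%classic setT M1 (measurable_itv _) measurableT mM1); last first.
  move=> x y /=; rewrite in_itv/= andbT => x0 _.
  by rewrite /M1 mule_ge0// lee_fin ltW.
pose M2 (z : RR) := e (Num.sqrt (z.1 / (1 + z.2 ^+ 2)), z.2 * Num.sqrt (z.1 / (1 + z.2 ^+ 2)))%R *
    ((2 * (1 + z.2 ^+ 2))^-1)%:E.
have mk : measurable_fun [set: RR] (fun z : RR => 1 + z.2 ^+ 2)%R.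
  by apply: measurable_funD => //; apply: measurable_funX; exact: measurable_snd.
have mM2 : measurable_fun setT M2.
  have ms : measurable_fun [set: RR] (fun z : RR => Num.sqrt (z.1 / (1 + z.2 ^+ 2))).
    apply: (measurableT_comp msqrt); apply: measurable_funM; first exact: measurable_fst.
    exact: (measurableT_comp measurable_invr).
  apply: emeasurable_funM; last first.
    apply/measurable_EFinP; apply: (measurableT_comp measurable_invr).
    exact: measurable_funM.
  apply: measurableT_comp me _; apply: measurable_fun_pair => //.
  exact: measurable_funM.
transitivity (\int[lambda]_c \int[lambda]_(s in `]0%R, +oo[) M2 (s, c)).
  apply: eq_integral => c _.
  have mM2c : measurable_fun setT (fun s : R => M2 (s, c)).
    by apply: measurableT_comp mM2 _; exact: pair2_measurable.
  rewrite [RHS](@ge0_substitution_sqr _ _ (1 + c ^+ 2)%R)//; last first.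
    by move=> s; rewrite /M2 mule_ge0// lee_fin invr_ge0 mulr_ge0// ltW.
  apply: eq_integral => x; rewrite inE/= in_itv/= andbT => x0.
  have k0 : (1 + c ^+ 2 != 0)%R by rewrite gt_eqF.
  rewrite /M1 /M2/= [((1 + c ^+ 2) * x ^+ 2)%R]mulrC mulfK// sqrtr_sqr gtr0_norm//.
  by rewrite [(c * x)%R]mulrC -muleA -EFinM mulKf// mulf_neq0.
rewrite -(@ge0_fubini_setX `]0%R, +oo[%classic setT M2 (measurable_itv _) measurableT mM2); last first.
  by move=> s c _ _; rewrite /M2 mule_ge0// lee_fin invr_ge0 mulr_ge0// ltW.
apply: eq_integral => s; rewrite inE/= in_itv/= andbT => s0.
pose h (t : R) := e (Num.sqrt s * cos t, Num.sqrt s * sin t)%R * (2^-1)%:E.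
have mh : measurable_fun setT h.
  apply: emeasurable_funM => //.
  apply: measurableT_comp me _; apply: measurable_fun_pair => //; apply: measurable_funM => //;
    apply: continuous_measurable_fun; [exact: continuous_cos|exact: continuous_sin].
rewrite [RHS](_ : _ = \int[lambda]_(t in `](- (pi / 2))%R, (pi / 2)%R[) h t)//.
rewrite ge0_substitution_atan//; last by move=> t; rewrite mule_ge0// lee_fin.
apply: eq_integral => c _; rewrite /M2/h/=.
have sinE : sin (atan c) = (c * cos (atan c))%R.
  have cn0 : cos (atan c) != 0%R by rewrite cos_atan invr_eq0 sqrtr_eq0 -ltNge.
  by rewrite -[LHS](divfK cn0) -/(tan (atan c)) atanK.
have sE : Num.sqrt (s / (1 + c ^+ 2)) = (Num.sqrt s * cos (atan c))%R.
  by rewrite cos_atan sqrtrM ?ltW// sqrtrV// ltW.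
by rewrite sinE sE mulrCA -muleA -EFinM invfM.
Qed.

End Polar.

(** * Affine maps and inversion of the plane *)

Section PlaneSubstitution.
Context {R : realType}.
Notation lambda := (@lebesgue_measure R).
Local Notation RR := (measurableTypeR R * measurableTypeR R)%type.
Local Open Scope ereal_scope.
Implicit Type f : RR -> \bar R.

Lemma ge0_integral_affine2 f (k a b : R) : (0 < k)%R ->
  measurable_fun setT f -> (forall z, 0 <= f z) ->
  \int[lambda \x lambda]_z f z =
  \int[lambda \x lambda]_z (f (k * z.1 + a, k * z.2 + b)%R * (k ^+ 2)%:E).
Proof.
move=> k0 mf f0.
pose g (z : RR) : RR := (k * z.1 + a, k * z.2 + b)%R.
have mg : measurable_fun setT g.
  by apply: measurable_fun_pair; apply: measurable_funD => //; exact: measurable_funM.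
have mfg : measurable_fun setT (f \o g) by exact: measurableT_comp.
have mfgk : measurable_fun setT (fun z => f (g z) * (k ^+ 2)%:E).
  by apply: emeasurable_funM.
have fgk0 z : 0 <= f (g z) * (k ^+ 2)%:E.
  by rewrite mule_ge0// lee_fin exprn_ge0// ltW.
rewrite (fubini_tonelli1 _ mf f0) (fubini_tonelli1 _ mfgk fgk0) /fubini_F.
have mF : measurable_fun setT (fun x => \int[lambda]_y f (x, y)).
  exact: (@measurable_fun_fubini_tonelli_F _ _ _ _ _ lambda f).
rewrite (@ge0_substitution_affine _ _ k a)//; last first.
  by move=> x; apply: integral_ge0.
have mfx x : measurable_fun setT (fun y : R => f (x, y)).
  by apply: measurableT_comp mf _; exact: pair1_measurable.
apply: eq_integral => x _.
rewrite -ge0_integralZr ?lee_fin ?(ltW k0)//; last exact: mfx.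
rewrite (@ge0_substitution_affine _ _ k b)//; last 2 first.
- apply: emeasurable_funM => //; exact: mfx.
- by move=> y; rewrite mule_ge0// lee_fin ltW.
by apply: eq_integral => y _ /=; rewrite -muleA -EFinM expr2.
Qed.

Lemma ge0_integral_opp_snd f :
  measurable_fun setT f -> (forall z, 0 <= f z) ->
  \int[lambda \x lambda]_z f z = \int[lambda \x lambda]_z f (z.1, - z.2)%R.
Proof.
move=> mf f0.
have mg : measurable_fun [set: RR] (fun z : RR => (z.1, - z.2)%R : RR).
  by apply: measurable_fun_pair => //; exact: measurable_funN.
have mfg : measurable_fun setT (fun z : RR => f (z.1, - z.2)%R).
  exact: (measurableT_comp mf mg).
rewrite (fubini_tonelli1 _ mf f0) (fubini_tonelli1 _ mfg (fun _ => f0 _)) /fubini_F.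
apply: eq_integral => x _; rewrite ge0_integral_oppr//.
by apply: measurableT_comp mf _; exact: pair1_measurable.
Qed.

Definition sqn (z : R * R) : R := (z.1 ^+ 2 + z.2 ^+ 2)%R.

Lemma measurable_sqn : measurable_fun setT (sqn : RR -> R).
Proof. by apply: measurable_funD; apply: measurable_funX. Qed.

(** In polar coordinates inversion fixes the angle and sends the squared radius [s] to [s^-1]; the
    Jacobian [s ^- 2] on the line is the factor [sqn z ^- 2]. *)
Lemma ge0_integral_inversion f :
  measurable_fun setT f -> (forall z, 0 <= f z) ->
  \int[lambda \x lambda]_z f z =
  \int[lambda \x lambda]_z (f (z.1 / sqn z, z.2 / sqn z)%R * (sqn z ^- 2)%:E).
Proof.
move=> mf f0.
pose g (z : RR) : RR := (z.1 / sqn z, z.2 / sqn z)%R.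
have msV : measurable_fun setT (fun z : RR => (sqn z)^-1)%R.
  exact: measurableT_comp measurable_invr measurable_sqn.
have mg : measurable_fun setT g.
  by apply: measurable_fun_pair; exact: measurable_funM.
have mh : measurable_fun setT (fun z : RR => f (g z) * (sqn z ^- 2)%:E).
  apply: emeasurable_funM; first exact: (measurableT_comp mf mg).
  apply/measurable_EFinP; under eq_fun do rewrite -exprVn.
  exact: measurable_funX.
have h0 z : 0 <= f (g z) * (sqn z ^- 2)%:E.
  by rewrite mule_ge0// lee_fin invr_ge0 exprn_ge0// addr_ge0 ?sqr_ge0.
rewrite (ge0_integral_polar mf f0) (ge0_integral_polar mh h0).
have msqrt : measurable_fun setT (@Num.sqrt R).
  by apply: continuous_measurable_fun => x; exact: sqrt_continuous.
have mcos : measurable_fun setT (@cos R).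
  by apply: continuous_measurable_fun; exact: continuous_cos.
have msin : measurable_fun setT (@sin R).
  by apply: continuous_measurable_fun; exact: continuous_sin.
pose E (z : RR) := (f (Num.sqrt z.1 * cos z.2, Num.sqrt z.1 * sin z.2)%R +
  f (- (Num.sqrt z.1 * cos z.2), - (Num.sqrt z.1 * sin z.2))%R) * (2^-1)%:E.
have E0 z : 0 <= E z by rewrite mule_ge0 ?adde_ge0// lee_fin.
have mE : measurable_fun setT E.
  have m1 : measurable_fun setT (fun z : RR => Num.sqrt z.1 * cos z.2)%R.
    by apply: measurable_funM; [exact: (measurableT_comp msqrt)|exact: (measurableT_comp mcos)].
  have m2 : measurable_fun setT (fun z : RR => Num.sqrt z.1 * sin z.2)%R.
    by apply: measurable_funM; [exact: (measurableT_comp msqrt)|exact: (measurableT_comp msin)].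
  apply: emeasurable_funM => //; apply: emeasurable_funD.
    by apply: measurableT_comp mf _; exact: measurable_fun_pair.
  by apply: measurableT_comp mf _; apply: measurable_fun_pair; exact: measurable_funN.
transitivity (\int[lambda]_(s in `]0%R, +oo[)
  \int[lambda]_(t in `](- (pi / 2))%R, (pi / 2)%R[) E (s, t)); first reflexivity.
rewrite (@ge0_fubini_setX _ `]0%R, +oo[%classic `](- (pi / 2))%R, (pi / 2)%R[%classic E
  (measurable_itv _) (measurable_itv _) mE (fun _ _ _ _ => E0 _)).
pose E' (z : RR) := E (z.1^-1, z.2)%R * (z.1 ^- 2)%:E.
have mE' : measurable_fun setT E'.
  apply: emeasurable_funM.
    apply: measurableT_comp mE _; apply: measurable_fun_pair => //.
    exact: (measurableT_comp measurable_invr).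
  apply/measurable_EFinP; under eq_fun do rewrite -exprVn.
  by apply: measurable_funX; exact: (measurableT_comp measurable_invr).
transitivity (\int[lambda]_(t in `](- (pi / 2))%R, (pi / 2)%R[)
    \int[lambda]_(s in `]0%R, +oo[) E' (s, t)).
  apply: eq_integral => t _; rewrite ge0_substitution_inv//.
  by apply: measurableT_comp mE _; exact: pair2_measurable.
rewrite -(@ge0_fubini_setX _ `]0%R, +oo[%classic `](- (pi / 2))%R, (pi / 2)%R[%classic E'
  (measurable_itv _) (measurable_itv _) mE'); last first.
  by move=> s t; rewrite /= in_itv/= andbT => s0 _; rewrite mule_ge0// lee_fin invr_ge0 exprn_ge0// ltW.
apply: eq_integral => s; rewrite inE/= in_itv/= andbT => s0.
apply: eq_integral => t _.
have sE : sqn (Num.sqrt s * cos t, Num.sqrt s * sin t)%R = s.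
  by rewrite /sqn/= !exprMn sqr_sqrtr ?ltW// -mulrDr cos2Dsin2 mulr1.
have sE' : sqn (- (Num.sqrt s * cos t), - (Num.sqrt s * sin t))%R = s.
  by rewrite -[RHS]sE /sqn/= !sqrrN.
have hs u : (Num.sqrt s * u / s = Num.sqrt s^-1 * u)%R.
  rewrite mulrAC sqrtrV ?ltW//; congr (_ * _)%R.
  have ss : (Num.sqrt s * Num.sqrt s = s)%R by rewrite -expr2 sqr_sqrtr// ltW.
  by rewrite -{2}ss invfM mulVKf// gt_eqF// sqrtr_gt0.
rewrite /E' /E /g /= sE sE' !mulNr !hs -ge0_muleDl// muleAC//.
Qed.

End PlaneSubstitution.

(** * The weighted area measure under circle inversion *)

Section WeightedIntegrals.
Context {R : realType} {gamma : R} (hgamma : -1 < gamma).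
Notation lambda := (@lebesgue_measure R).
Local Notation RR := (measurableTypeR R * measurableTypeR R)%type.
Local Notation mu := (dA_ hgamma).
Local Open Scope ereal_scope.
Implicit Type f : plane R -> \bar R.

Lemma disk2E : @disk2 R = [set p | (sqn p < 1)%R].
Proof.
have n0 p : (0 <= normc (@toC R p))%R by rewrite /= sqrtr_ge0.
by apply/seteqP; split=> p; rewrite /disk2 /disk /sqn
  /preimage /mkset -normc_toCE expr_lt1.
Qed.

Lemma sqn_ge0 (z : R * R) : (0 <= sqn z)%R.
Proof. by rewrite addr_ge0 ?sqr_ge0. Qed.

(** Extended by 0, so that maps of the whole plane can be applied to it; the constant
    [(gamma + 1) / pi] is kept apart as [k]. *)
Definition disk_weight (z : R * R) : R :=
  if (sqn z < 1)%R then ((1 - sqn z) `^ gamma)%R else 0%R.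

Lemma disk_weight_ge0 z : (0 <= disk_weight z)%R.
Proof. by rewrite /disk_weight; case: ifP => // _; exact: powR_ge0. Qed.

Lemma measurable_disk_weight : measurable_fun setT (disk_weight : RR -> R).
Proof.
apply: measurable_fun_ifT.
- by apply: measurable_fun_ltr => //; exact: measurable_sqn.
- apply: (measurableT_comp (measurable_powR gamma)).
  by apply: measurable_funB => //; exact: measurable_sqn.
- exact: measurable_cst.
Qed.

Let k : R := ((gamma + 1) / pi)%R.

Let k_ge0 : (0 <= k)%R.
Proof. by rewrite divr_ge0 ?pi_ge0// -lerBlDr sub0r ltW. Qed.

Lemma ge0_integral_dA_ f : measurable_fun disk2 f -> (forall z, disk2 z -> 0 <= f z) ->
  \int[mu]_(p in disk2) f p =
  \int[lambda \x lambda]_z ((f \_ disk2) z * (k * disk_weight z)%:E).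
Proof.
move=> mf f0; have mD := @measurable_disk2 R.
have mfD : measurable_fun setT (f \_ disk2) by apply/(measurable_restrictT _ mD).
have fD0 z : 0 <= (f \_ disk2) z by exact: erestrict_ge0.
pose w : plane R -> R := (@dA_weight R gamma) \_ disk2.
have mw : measurable_fun setT w.
  apply/(measurable_restrictT _ mD); apply: measurable_funS (measurable_dA_weight) => //.
have w0 z : (0 <= w z)%R.
  by rewrite /w patchE; case: ifPn => // _; exact: dA_weight_ge0.
rewrite integral_mkcond.
rewrite (@ge0_integral_density _ _ _ dA mu w mw w0)//; last first.
  move=> A mA; rewrite [LHS]integral_mkcondr.
  by apply: eq_integral => z _; rewrite /w restrict_EFin.
have mfw : measurable_fun setT (fun z => (f \_ disk2) z * (w z)%:E).
  by apply: emeasurable_funM => //; exact/measurable_EFinP.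
have fw0 z : 0 <= (f \_ disk2) z * (w z)%:E by rewrite mule_ge0// lee_fin.
rewrite (ge0_integral_mscale _ measurableT _ mfw (fun z _ => fw0 z)) /=.
have pi0 : 0 <= (pi^-1)%:E :> \bar R by rewrite lee_fin pi_inv_ge0.
rewrite -(ge0_integralZl _ measurableT mfw (fun z _ => fw0 z) pi0).
apply: eq_integral => z _; rewrite muleCA -EFinM; congr (_ * _%:E).
rewrite /w /disk_weight patchE /dA_weight disk2E normc_toCE -/(sqn z).
case: ltP => h; last by rewrite memNset ?mulr0//= ltNge h.
by rewrite mem_set// /k mulrA [(pi^-1 * _)%R]mulrC.
Qed.

Variables (c1 c2 : R).
Let kappa : R := (c1 ^+ 2 + c2 ^+ 2 - 1)%R.
Hypothesis kappa_gt0 : (0 < kappa)%R.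

Let sqc (z : R * R) : R := sqn (z.1 - c1, z.2 - c2)%R.

(* Inversion in the circle of centre [(c1, c2)] that is orthogonal to the unit
   circle; it maps the disk onto itself. *)
Definition kelvin (z : R * R) : R * R :=
  (c1 + kappa * ((z.1 - c1) / sqc z), c2 + kappa * ((z.2 - c2) / sqc z))%R.

Lemma sqc_gt0 z : (sqn z < 1)%R -> (0 < sqc z)%R.
Proof.
move=> z1; rewrite lt_neqAle sqn_ge0 andbT eq_sym; apply/negP.
rewrite /sqc /sqn/= paddr_eq0 ?sqr_ge0// !sqrf_eq0 !subr_eq0 => /andP[/eqP h1 /eqP h2].
by move: z1 kappa_gt0; rewrite /sqn /kappa h1 h2 subr_gt0 => /lt_trans h /h; rewrite ltxx.
Qed.

(** Orthogonality to the unit circle, in the form [|c|^2 = 1 + kappa], makes [1 - |z|^2] change by a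
    mere factor. This gives at once that the disk is preserved and how the weight transforms. *)
Lemma sqn_kelvin z : sqc z != 0%R -> (1 - sqn (kelvin z) = kappa / sqc z * (1 - sqn z))%R.
Proof.
move=> h.
have E1 : (sqc z ^+ 2 * (1 - sqn (kelvin z)) = sqc z ^+ 2 -
    (c1 * sqc z + kappa * (z.1 - c1)) ^+ 2 - (c2 * sqc z + kappa * (z.2 - c2)) ^+ 2)%R.
  by rewrite /kelvin /sqn/=; move: (sqc z) h => s h; field.
have E2 : (sqc z ^+ 2 -
    (c1 * sqc z + kappa * (z.1 - c1)) ^+ 2 - (c2 * sqc z + kappa * (z.2 - c2)) ^+ 2 =
    sqc z * kappa * (1 - sqn z))%R.
  by rewrite /sqc /sqn /kappa/=; ring.
apply: (mulfI (expf_neq0 2 h)); rewrite E1 E2.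
by move: (sqc z) h => s h; field.
Qed.

Lemma kelvin_disk z : disk2 z -> disk2 (kelvin z).
Proof.
rewrite disk2E /= => z1; have h := sqc_gt0 z1.
by rewrite -subr_gt0 sqn_kelvin ?gt_eqF// mulr_gt0 ?divr_gt0// subr_gt0.
Qed.

Lemma kelvinK z : disk2 z -> kelvin (kelvin z) = z.
Proof.
rewrite disk2E /= => z1; have h : sqc z != 0%R by rewrite gt_eqF// sqc_gt0.
have k0 : kappa != 0%R by rewrite gt_eqF.
have E : sqc (kelvin z) = (kappa ^+ 2 / sqc z)%R.
  transitivity (kappa ^+ 2 * ((z.1 - c1) ^+ 2 + (z.2 - c2) ^+ 2) / sqc z ^+ 2)%R.
    rewrite {1}/sqc /kelvin /sqn/=; move: (sqc z) h => s h; field.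
    exact: h.
  rewrite -/(sqn (z.1 - c1, z.2 - c2)%R) -/(sqc z).
  by move: (sqc z) h => s h; field.
rewrite {1}/kelvin E /kelvin /=.
move: (sqc z) h {E} => s h; case: z z1 => x y /= _.
by congr (_, _); field; rewrite k0 h.
Qed.

Lemma measurable_kelvin : measurable_fun setT (kelvin : RR -> RR).
Proof.
have m1 : measurable_fun setT (fun z : RR => z.1 - c1)%R by exact: measurable_funB.
have m2 : measurable_fun setT (fun z : RR => z.2 - c2)%R by exact: measurable_funB.
have ms : measurable_fun setT (fun z : RR => (sqc z)^-1)%R.
  apply: (measurableT_comp measurable_invr).
  by apply: measurable_funD; exact: measurable_funX.
by apply: measurable_fun_pair; apply: measurable_funD => //; apply: measurable_funM => //;
  exact: measurable_funM.
Qed.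

(** [kelvin] is the translation by [- c], then inversion, then [z -> kappa z + c]. The factors
    [sqc z ^- 2] and [kappa ^ 2] make up the Jacobian. *)
Let ge0_integral_kelvin (f : RR -> \bar R) :
  measurable_fun setT f -> (forall z, 0 <= f z) ->
  \int[lambda \x lambda]_z f z =
  \int[lambda \x lambda]_z (f (kelvin z) * ((kappa / sqc z) ^+ 2)%:E).
Proof.
move=> mf f0; rewrite (ge0_integral_affine2 c1 c2 kappa_gt0 mf f0).
pose f1 (z : RR) := f (kappa * z.1 + c1, kappa * z.2 + c2)%R * (kappa ^+ 2)%:E.
have mf1 : measurable_fun setT f1.
  apply: emeasurable_funM => //; apply: (measurableT_comp mf).
  by apply: measurable_fun_pair; apply: measurable_funD => //; exact: measurable_funM.
have f10 z : 0 <= f1 z by rewrite mule_ge0// lee_fin sqr_ge0.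
rewrite (ge0_integral_inversion mf1 f10).
pose f2 (z : RR) := f1 (z.1 / sqn z, z.2 / sqn z)%R * (sqn z ^- 2)%:E.
have msV : measurable_fun setT (fun z : RR => (sqn z)^-1)%R.
  exact: measurableT_comp measurable_invr (@measurable_sqn R).
have mf2 : measurable_fun setT f2.
  apply: emeasurable_funM.
    apply: (measurableT_comp mf1).
    by apply: measurable_fun_pair; exact: measurable_funM.
  apply/measurable_EFinP; under eq_fun do rewrite -exprVn.
  exact: measurable_funX.
have f20 z : 0 <= f2 z by rewrite mule_ge0// lee_fin invr_ge0 sqr_ge0.
rewrite (ge0_integral_affine2 (- c1)%R (- c2)%R ltr01 mf2 f20).
apply: eq_integral => -[x y] _; rewrite /f2 /f1 /kelvin /sqc/= !mul1r expr1n mule1 -muleA -EFinM.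
rewrite !(addrC _ c1) !(addrC _ c2) exprMn exprVn.
by congr (_ * _).
Qed.

(** The exponent collects [gamma] from the weight, by [sqn_kelvin], and 2 from the Jacobian. The
    substitution is applied to [f] composed with [kelvin], which is an involution of the disk. *)
Lemma ge0_integral_dA_kelvin f : measurable_fun disk2 f ->
  (forall z, disk2 z -> 0 <= f z) ->
  \int[mu]_(p in disk2) f (kelvin p) =
  \int[mu]_(p in disk2) (f p * ((kappa / sqc p) `^ (gamma + 2))%:E).
Proof.
move=> mf f0; have mD := @measurable_disk2 R.
pose h (z : plane R) := f (kelvin z).
have mh : measurable_fun disk2 h.
  apply: (measurable_comp (F := disk2) mD _ mf).
    by move=> _ [z zD <-]; exact: kelvin_disk.
  by apply: (@measurable_funTS _ _ (plane R) (plane R)); exact: measurable_kelvin.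
have h0 z : disk2 z -> 0 <= h z by move=> zD; apply/f0/kelvin_disk.
pose K (z : R * R) := ((kappa / sqc z) `^ (gamma + 2))%R.
have mK : measurable_fun setT (K : RR -> R).
  apply: (measurableT_comp (measurable_powR (gamma + 2)%R)).
  apply: measurable_funM => //; apply: (measurableT_comp measurable_invr).
  by apply: measurable_funD; apply: measurable_funX; exact: measurable_funB.
rewrite (ge0_integral_dA_ mh h0) [RHS]ge0_integral_dA_//; last 2 first.
- by apply: emeasurable_funM => //; apply/measurable_EFinP; apply: measurable_funTS.
- by move=> z zD; rewrite mule_ge0 ?f0// lee_fin powR_ge0.
pose G (z : RR) := (h \_ disk2) z * (k * disk_weight z)%:E.
have mG : measurable_fun setT G.
  apply: emeasurable_funM; first exact/(measurable_restrictT _ mD).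
  apply/measurable_EFinP; apply: measurable_funM => //; exact: measurable_disk_weight.
have G0 z : 0 <= G z.
  apply: mule_ge0; first exact: erestrict_ge0.
  by rewrite lee_fin mulr_ge0// disk_weight_ge0.
rewrite (ge0_integral_kelvin mG G0).
apply: eq_integral => z _; rewrite /G.
(* Off the disk both sides are 0: by [sqn_kelvin], away from the centre, the image is off the disk
   too, and at the centre the Jacobian factor is 0 because [0^-1 = 0]. *)
have [zD|zD] := pselect (disk2 z); last first.
  have w0 : disk_weight z = 0%R.
    by move: zD; rewrite disk2E /disk_weight /=; case: ifP.
  rewrite w0 mulr0 mule0; have [->|s0] := eqVneq (sqc z) 0%R.
    by rewrite invr0 mulr0 expr0n/= mule0.
  have -> : disk_weight (kelvin z) = 0%R.
    rewrite /disk_weight -subr_gt0 sqn_kelvin// pmulr_rgt0 ?subr_gt0; last first.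
      by rewrite divr_gt0// lt_neqAle eq_sym s0 sqn_ge0.
    by move: zD; rewrite disk2E /=; case: ifP.
  by rewrite mulr0 mule0 mul0e.
rewrite !patchE !mem_set//; last exact: kelvin_disk.
rewrite /h kelvinK// -!muleA -!EFinM; congr (_ * _%:E).
have := zD; rewrite disk2E /= => z1; have s0 := sqc_gt0 z1.
have := kelvin_disk zD; rewrite disk2E /= => kz1.
rewrite /disk_weight kz1 z1 sqn_kelvin ?gt_eqF// powRM ?subr_ge0 ?ltW// ?divr_gt0//.
have q0 : (0 < kappa / sqc z)%R by rewrite divr_gt0.
rewrite (@powRD _ _ gamma 2); last by rewrite (gt_eqF q0) implybT.
rewrite (@powR_mulrn _ _ 2) ?ltW//.
by ring.
Qed.

(** [kelvin] is antiholomorphic; this allows it to be composed with conjugation at no cost. *)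
Lemma ge0_integral_dA_conj f : measurable_fun disk2 f ->
  (forall z, disk2 z -> 0 <= f z) ->
  \int[mu]_(p in disk2) f p = \int[mu]_(p in disk2) f (p.1, - p.2)%R.
Proof.
move=> mf f0; have mD := @measurable_disk2 R.
have sqc' (z : R * R) : sqn (z.1, - z.2)%R = sqn z by rewrite /sqn/= sqrrN.
have cD (z : R * R) : disk2 z -> disk2 (z.1, - z.2)%R by rewrite disk2E /= sqc'.
pose h (z : plane R) := f (z.1, - z.2)%R.
have mh : measurable_fun disk2 h.
  apply: (measurable_comp (F := disk2) mD _ mf).
    by move=> _ [z zD <-]; exact: cD.
  apply: (@measurable_funTS _ _ (plane R) (plane R)).
  by apply: measurable_fun_pair => //; exact: measurable_funN.
have h0 z : disk2 z -> 0 <= h z by move=> /cD; exact: f0.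
rewrite (ge0_integral_dA_ mh h0) ge0_integral_dA_//.
pose G (z : RR) := (f \_ disk2) z * (k * disk_weight z)%:E.
have mG : measurable_fun setT G.
  apply: emeasurable_funM; first exact/(measurable_restrictT _ mD).
  apply/measurable_EFinP; apply: measurable_funM => //; exact: measurable_disk_weight.
have G0 z : 0 <= G z.
  apply: mule_ge0; first exact: erestrict_ge0.
  by rewrite lee_fin mulr_ge0// disk_weight_ge0.
rewrite (ge0_integral_opp_snd mG G0).
apply: eq_integral => z _; rewrite /G !patchE /disk_weight sqc'.
congr (_ * _); have [zD|zD] := pselect (disk2 z).
  by rewrite !mem_set//; exact: cD.
by rewrite !memNset// => /cD/=; rewrite opprK -surjective_pairing.
Qed.

End WeightedIntegrals.

(** * Integrals over the disk, circle by circle *)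

Section MeanValueIntegral.
Context {R : realType} {gamma : R} (hgamma : -1 < gamma).
Notation lambda := (@lebesgue_measure R).
Local Notation RR := (measurableTypeR R * measurableTypeR R)%type.
Local Notation mu := (dA_ hgamma).
Local Notation J := (`](- (pi / 2))%R, (pi / 2)%R[%classic : set R).
Local Open Scope ereal_scope.

(* [s] is the squared radius, so that the area element is [ds dt / 2].  Angles
   run over the half-circle [J] only, and [- polar s t] covers the other half. *)
Definition polar (s t : R) : R * R := (Num.sqrt s * cos t, Num.sqrt s * sin t)%R.

(** The denominator joins the [pi] of the normalized area and the 2 of the area element
    [ds dt / 2]. *)
Definition radial_weight (s : R) : R := ((gamma + 1) * (1 - s) `^ gamma / (2 * pi))%R.

Lemma sqn_polar s t : (0 <= s)%R -> sqn (polar s t) = s.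
Proof. by move=> s0; rewrite /sqn/= !exprMn sqr_sqrtr// -mulrDr cos2Dsin2 mulr1. Qed.

Lemma sqn_polarN s t : (0 <= s)%R -> sqn (- polar s t)%R = s.
Proof. by move=> s0; rewrite -[RHS](sqn_polar t s0) /sqn/= !sqrrN. Qed.

Lemma measurable_polar : measurable_fun setT (fun z : RR => polar z.1 z.2 : RR).
Proof.
have msqrt : measurable_fun setT (@Num.sqrt R).
  by apply: continuous_measurable_fun => x; exact: sqrt_continuous.
have mcos : measurable_fun setT (@cos R).
  by apply: continuous_measurable_fun; exact: continuous_cos.
have msin : measurable_fun setT (@sin R).
  by apply: continuous_measurable_fun; exact: continuous_sin.
apply: measurable_fun_pair; apply: measurable_funM.
- exact: (measurableT_comp msqrt).
- exact: (measurableT_comp mcos).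
- exact: (measurableT_comp msqrt).
- exact: (measurableT_comp msin).
Qed.

Lemma measurable_polarN : measurable_fun setT (fun z : RR => (- polar z.1 z.2)%R : RR).
Proof.
have m1 := measurableT_comp measurable_fst measurable_polar.
have m2 := measurableT_comp measurable_snd measurable_polar.
by apply: measurable_fun_pair; apply: measurable_funN.
Qed.

Lemma measurable_fun_integral_slice (B : set R) (E : RR -> \bar R) :
  measurable B -> measurable_fun setT E -> (forall z, 0 <= E z) ->
  measurable_fun setT (fun s : R => \int[lambda]_(t in B) E (s, t)).
Proof.
move=> mB mE E0.
have mTB : measurable (setT `*` B : set RR) by exact: measurableX.
pose G := E \_ (setT `*` B : set RR).
have mG : measurable_fun setT G.
  by apply/(measurable_restrictT _ mTB); exact: measurable_funS mE.
have G0 z : 0 <= G z by apply: erestrict_ge0.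
have := @measurable_fun_fubini_tonelli_F _ _ _ _ _ lambda G mG G0.
rewrite /fubini_F; congr (measurable_fun _ _); apply/funext => s.
rewrite [RHS]integral_mkcond; apply: eq_integral => t _.
by rewrite /G !patchE in_setX/= in_setT.
Qed.

Lemma ge0_integral_dA_polar (f : plane R -> \bar R) : measurable_fun disk2 f ->
  (forall z, disk2 z -> 0 <= f z) ->
  \int[mu]_(p in disk2) f p =
  \int[lambda]_(s in `]0%R, 1%R[) ((radial_weight s)%:E *
     \int[lambda]_(t in J) (f (polar s t) + f (- polar s t)%R)).
Proof.
move=> mf f0; have mD := @measurable_disk2 R.
rewrite (ge0_integral_dA_ hgamma mf f0).
pose fD : RR -> \bar R := f \_ disk2.
have mfD : measurable_fun setT fD by exact/(measurable_restrictT _ mD).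
have fD0 z : 0 <= fD z by exact: erestrict_ge0.
have k0 : (0 <= (gamma + 1) / pi)%R by rewrite divr_ge0 ?pi_ge0// -lerBlDr sub0r ltW.
pose G (z : RR) := fD z * ((gamma + 1) / pi * disk_weight (gamma := gamma) z)%:E.
have mG : measurable_fun setT G.
  apply: emeasurable_funM => //.
  apply/measurable_EFinP; apply: measurable_funM => //; exact: measurable_disk_weight.
have G0 z : 0 <= G z by rewrite mule_ge0// lee_fin mulr_ge0// disk_weight_ge0.
rewrite (ge0_integral_polar mG G0).
have oy01 : (`]0%R, 1%R[%classic : set R) `<=` `]0%R, +oo[%classic.
  by move=> s /=; rewrite !in_itv/= => /andP[->].
rewrite [RHS]integral_mkcond [LHS]integral_mkcond.
apply: eq_integral => s _; rewrite !patchE.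
have [s01|s01] := pselect ((`]0%R, 1%R[%classic : set R) s); last first.
  rewrite [in RHS]memNset//; case: ifPn => //; rewrite inE => sp.
  have s0 : (0 <= s)%R by move: sp; rewrite /= in_itv/= andbT => /ltW.
  have s1 : (s < 1)%R = false.
    by apply/negP => s1; apply: s01; move: sp; rewrite /= !in_itv/= s1 !andbT.
  rewrite integral0_eq// => t _.
  rewrite /G /disk_weight (sqn_polar _ s0) s1 (sqn_polarN _ s0 : sqn (_, _) = _) s1.
  by rewrite !mulr0 !mule0 adde0 mul0e.
rewrite !mem_set//; last exact: oy01.
have /andP[s0 s1] : (0 < s < 1)%R by move: s01; rewrite /= in_itv.
have sN := sqn_polarN _ (ltW s0).
have pD t : disk2 (polar s t) by rewrite disk2E /= sqn_polar// ltW.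
have pND t : disk2 (- polar s t)%R by rewrite disk2E /= sN.
have mh : measurable_fun setT (fun t : R => fD (polar s t) + fD (- polar s t)%R).
  apply: emeasurable_funD.
    apply: (measurableT_comp mfD).
    exact: (measurableT_comp measurable_polar (pair1_measurable s)).
  apply: (measurableT_comp mfD).
  exact: (measurableT_comp measurable_polarN (pair1_measurable s)).
have fDE z : disk2 z -> fD z = f z by move=> zD; rewrite /fD patchE mem_set.
transitivity (\int[lambda]_(t in J) ((radial_weight s)%:E * (fD (polar s t) + fD (- polar s t)%R))).
  apply: eq_integral => t _.
  rewrite /G /disk_weight (sqn_polar _ (ltW s0)) (sN t : sqn (_, _) = _) s1.
  rewrite -ge0_muleDl// -muleA muleC -EFinM; congr (_%:E * _).
  by rewrite /radial_weight invfM; ring.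
rewrite ge0_integralZl//.
- by congr (_ * _); apply: eq_integral => t _; rewrite !fDE.
- exact: measurable_funS mh.
- by move=> t _; rewrite adde_ge0.
- by rewrite lee_fin /radial_weight divr_ge0 ?mulr_ge0 ?powR_ge0 ?pi_ge0// -lerBlDr sub0r ltW.
Qed.

Lemma integral_radial_weight :
  \int[lambda]_(s in `]0%R, 1%R[) (radial_weight s * (2 * pi))%:E = 1.
Proof.
rewrite -(integral_weight01 hgamma); apply: eq_integral => s _.
by rewrite /radial_weight divfK// mulf_neq0// gt_eqF// pi_gt0.
Qed.

Lemma measurable_radial_weight : measurable_fun setT radial_weight.
Proof.
apply: measurable_funM => //; apply: measurable_funM => //.
by apply: (measurableT_comp (measurable_powR gamma)); exact: measurable_funB.
Qed.

Lemma radial_weight_ge0 s : (0 <= radial_weight s)%R.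
Proof.
by rewrite divr_ge0 ?mulr_ge0 ?powR_ge0 ?pi_ge0// -lerBlDr sub0r ltW.
Qed.

Definition slice (g : plane R -> \bar R) (s : R) :=
  \int[lambda]_(t in J) (g (polar s t) + g (- polar s t)%R).

(** Since [radial_weight s * (2 * pi)] has integral 1, the constant [c] can be spread over the
    circles. Two sums of this kind can then be compared circle by circle, without subtracting
    integrals that may be infinite. *)
Lemma ge0_integral_dA_slice (g : plane R -> \bar R) (c : R) : (0 <= c)%R ->
  measurable_fun disk2 g -> (forall z, 0 <= g z) ->
  \int[mu]_(p in disk2) g p + c%:E =
  \int[lambda]_(s in `]0%R, 1%R[) ((radial_weight s)%:E * (slice g s + (2 * pi * c)%:E)).
Proof.
move=> c0 mg g0; have mD := @measurable_disk2 R.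
have pc0 : (0 <= 2 * pi * c)%R by rewrite !mulr_ge0// pi_ge0.
have -> : c%:E = \int[lambda]_(s in `]0%R, 1%R[) ((radial_weight s)%:E * (2 * pi * c)%:E).
  transitivity (\int[lambda]_(s in `]0%R, 1%R[) (c%:E * (radial_weight s * (2 * pi))%:E)).
    rewrite ge0_integralZl// ?integral_radial_weight ?mule1//.
    - apply/measurable_EFinP; apply: measurable_funM => //.
      by apply: measurable_funTS; exact: measurable_radial_weight.
    - by move=> s _; rewrite lee_fin mulr_ge0 ?radial_weight_ge0// mulr_ge0// pi_ge0.
  by apply: eq_integral => s _; rewrite -!EFinM; congr (_%:E); ring.
pose gD : RR -> \bar R := g \_ disk2.
have mgD : measurable_fun setT gD by exact/(measurable_restrictT _ mD).
have gD0 z : 0 <= gD z by exact: erestrict_ge0.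
have gDE s t : (`]0%R, 1%R[%classic : set R) s ->
    gD (polar s t) = g (polar s t) /\ gD (- polar s t)%R = g (- polar s t)%R.
  rewrite /= in_itv/= => /andP[s0 s1].
  by rewrite /gD !patchE !mem_set// disk2E /= ?sqn_polarN ?sqn_polar// ltW.
have mS : measurable_fun (`]0%R, 1%R[%classic : set R) (slice g).
  apply: (@eq_measurable_fun _ _ _ _ _ (slice gD)) => [s|].
    by rewrite inE => s01; apply: eq_integral => t _; have [-> ->] := gDE s t s01.
  apply: measurable_funTS.
  apply: (@measurable_fun_integral_slice J
    (fun z => gD (polar z.1 z.2) + gD (- polar z.1 z.2)%R)) => //.
  - apply: emeasurable_funD; first exact: (measurableT_comp mgD measurable_polar).
    exact: (measurableT_comp mgD measurable_polarN).
  - by move=> z; rewrite adde_ge0.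
have S0 s : 0 <= slice g s.
  by apply: integral_ge0 => t _; rewrite adde_ge0.
have mw : measurable_fun (`]0%R, 1%R[%classic : set R) (EFin \o radial_weight).
  by apply/measurable_EFinP; apply: measurable_funTS; exact: measurable_radial_weight.
rewrite (ge0_integral_dA_polar mg (fun z _ => g0 z)) -ge0_integralD//.
- by apply: eq_integral => s _; rewrite [RHS]ge0_muleDr// ?S0 ?lee_fin.
- by move=> s _; apply: mule_ge0; [rewrite lee_fin radial_weight_ge0|exact: S0].
- exact: emeasurable_funM.
- by move=> s _; rewrite -EFinM lee_fin mulr_ge0// radial_weight_ge0.
- exact: emeasurable_funM.
Qed.

(** With [P] and [N] the positive and negative parts of [u], the equation on each circle is written
    with nonnegative terms, as [P + |m|] against [N + (|m| + m)]. After integration over the radius,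
    the finiteness of both integrals allows the terms to be moved back. *)
Lemma integral_dA_mean_value (u : plane R -> R) (m : R) :
  measurable_fun disk2 u ->
  \int[mu]_(p in disk2) `|u p|%:E < +oo ->
  (forall s, (0 < s < 1)%R ->
    [/\ lambda.-integrable J (fun t => (u (polar s t))%:E),
        lambda.-integrable J (fun t => (u (- polar s t)%R)%:E) &
        \int[lambda]_(t in J) (u (polar s t))%:E +
        \int[lambda]_(t in J) (u (- polar s t)%R)%:E = (2 * pi * m)%:E]) ->
  \int[mu]_(p in disk2) (u p)%:E = m%:E.
Proof.
move=> mu_ uoo Hm; have mD := @measurable_disk2 R.
have mEu : measurable_fun disk2 (EFin \o u) by exact/measurable_EFinP.
pose P : plane R -> \bar R := (EFin \o u)^\+.
pose N : plane R -> \bar R := (EFin \o u)^\-.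
have mP : measurable_fun disk2 P by exact: measurable_funepos.
have mN : measurable_fun disk2 N by exact: measurable_funeneg.
have P0 z : 0 <= P z by exact: funepos_ge0.
have N0 z : 0 <= N z by exact: funeneg_ge0.
have uE z : `|u z|%:E = P z + N z by have := congr1 (@^~ z) (fune_abse (EFin \o u)).
have Poo : \int[mu]_(p in disk2) P p < +oo.
  apply: le_lt_trans uoo; apply: ge0_le_integral => //.
  - by apply/measurable_EFinP; exact: measurableT_comp.
  - by move=> z _; rewrite uE leeDl.
have Noo : \int[mu]_(p in disk2) N p < +oo.
  apply: le_lt_trans uoo; apply: ge0_le_integral => //.
  - by apply/measurable_EFinP; exact: measurableT_comp.
  - by move=> z _; rewrite uE leeDr.
rewrite integralE -/P -/N.
have nm0 : (0 <= `|m| + m)%R by rewrite -lerBlDr sub0r -normrN ler_norm.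
have PN : \int[mu]_(p in disk2) P p + `|m|%:E = \int[mu]_(p in disk2) N p + (`|m| + m)%:E.
  rewrite (ge0_integral_dA_slice (normr_ge0 m) mP P0) (ge0_integral_dA_slice nm0 mN N0).
  apply: eq_integral => s; rewrite inE/= in_itv/= => s01; congr (_ * _).
  have [i1 i2 i12] := Hm s s01.
  have sE (g : plane R -> \bar R) : (forall z, 0 <= g z) ->
      measurable_fun J (fun t => g (polar s t)) ->
      measurable_fun J (fun t => g (- polar s t)%R) ->
      slice g s = \int[lambda]_(t in J) g (polar s t) +
        \int[lambda]_(t in J) g (- polar s t)%R.
    by move=> g0 m1 m2; rewrite /slice ge0_integralD.
  have m1 := measurable_int _ i1; have m2 := measurable_int _ i2.
  have [P1 P2 N1 N2] : [/\ (fun t => P (polar s t)) = (fun t => (u (polar s t))%:E)^\+,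
      (fun t => P (- polar s t)%R) = (fun t => (u (- polar s t)%R)%:E)^\+,
      (fun t => N (polar s t)) = (fun t => (u (polar s t))%:E)^\- &
      (fun t => N (- polar s t)%R) = (fun t => (u (- polar s t)%R)%:E)^\-].
    by split; apply/funext => t; rewrite ?/P ?/N ?funeposE ?funenegE.
  rewrite (sE P) ?P1 ?P2//; [|exact: measurable_funepos..].
  rewrite (sE N) ?N1 ?N2//; [|exact: measurable_funeneg..].
  move: i12; rewrite integralE [in X in _ + X = _]integralE.
  have /(_ (measurable_itv _)) p1 := fun mJ => integrable_pos_fin_num mJ i1.
  have /(_ (measurable_itv _)) p2 := fun mJ => integrable_pos_fin_num mJ i2.
  have /(_ (measurable_itv _)) n1 := fun mJ => integrable_neg_fin_num mJ i1.
  have /(_ (measurable_itv _)) n2 := fun mJ => integrable_neg_fin_num mJ i2.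
  move: p1 p2 n1 n2.
  move=> /EFin_fin_numP[p1 ->] /EFin_fin_numP[p2 ->] /EFin_fin_numP[n1 ->] /EFin_fin_numP[n2 ->].
  rewrite -!EFinB -!EFinD => -[e]; congr (_%:E).
  by rewrite [(2 * pi * (_ + m))%R]mulrDr -e; ring.
have : \int[mu]_(p in disk2) P p \is a fin_num.
  by rewrite ge0_fin_numE// integral_ge0.
have : \int[mu]_(p in disk2) N p \is a fin_num.
  by rewrite ge0_fin_numE// integral_ge0.
move: PN => /[swap] /EFin_fin_numP[n ->] /[swap] /EFin_fin_numP[p ->].
rewrite -?EFinB -!EFinD => -[e]; congr (_%:E); apply/eqP.
by rewrite subr_eq -(inj_eq (addIr `|m|%R)) e; apply/eqP; ring.
Qed.

End MeanValueIntegral.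

(** * Differentiability of functions of two real variables *)

Section Frechet.
Context {R : realType}.
Implicit Types (u v x y : R * R -> R) (p q : R * R) (a b e d : R).

Definition norm1 (p q : R * R) : R := `|q.1 - p.1| + `|q.2 - p.2|.

(** Differentiability at the single point [p] with gradient [(a, b)], without continuous partial
    derivatives: this is all that Goursat's argument asks. The sum norm separates the two
    coordinates. *)
Definition frechet u p a b := forall e, 0 < e -> exists2 d, 0 < d &
  forall q, norm1 p q <= d ->
  `|u q - u p - (a * (q.1 - p.1) + b * (q.2 - p.2))| <= e * norm1 p q.

Lemma norm1_ge0 p q : 0 <= norm1 p q.
Proof. by rewrite addr_ge0. Qed.

Lemma frechet_lipschitz u p a b : frechet u p a b ->
  exists2 d, 0 < d & forall q, norm1 p q <= d ->
  `|u q - u p| <= (1 + `|a| + `|b|) * norm1 p q.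
Proof.
move=> /(_ 1 ltr01)[d d0 H]; exists d => // q /H; rewrite mul1r => h.
rewrite -[u q - u p](subrK (a * (q.1 - p.1) + b * (q.2 - p.2))).
have -> : (1 + `|a| + `|b|) * norm1 p q = norm1 p q + (`|a| + `|b|) * norm1 p q by ring.
rewrite (le_trans (ler_normD _ _))// lerD//.
rewrite (le_trans (ler_normD _ _))// !normrM mulrDl.
by rewrite lerD// ler_wpM2l// /norm1 ?lerDl ?lerDr.
Qed.

(** The rules for products, sums and composition with a function of one variable below are all
    obtained from this chain rule. *)
Lemma frechet_comp2 u x y p a b (x1 x2 y1 y2 : R) :
  frechet u (x p, y p) a b -> frechet x p x1 x2 -> frechet y p y1 y2 ->
  frechet (fun q => u (x q, y q)) p (a * x1 + b * y1) (a * x2 + b * y2).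
Proof.
move=> Hu Hx Hy e e0.
have [dx dx0 Lx] := frechet_lipschitz Hx.
have [dy dy0 Ly] := frechet_lipschitz Hy.
(* The error has three parts, each allowed [e / 3]: that of [u], at a point moved by at most [K]
   times the distance, and those of [x] and [y], multiplied by coefficients bounded by [A]. *)
set K := (1 + `|x1| + `|x2|) + (1 + `|y1| + `|y2|).
have K0 : 0 < K by rewrite /K !ltr_wpDr.
have A0 : 0 < 1 + `|a| + `|b| by rewrite !ltr_wpDr.
have eK : 0 < e / (3 * K) by rewrite divr_gt0// mulr_gt0.
have [du du0 Hu'] := Hu _ eK.
set A := 1 + `|a| + `|b| in A0 *.
have eA : 0 < e / (3 * A) by rewrite divr_gt0// mulr_gt0.
have [ex ex0 Hx'] := Hx _ eA.
have [ey ey0 Hy'] := Hy _ eA.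
exists (Num.min (Num.min dx dy) (Num.min (du / K) (Num.min ex ey))).
  by rewrite !lt_min dx0 dy0 ex0 ey0 divr_gt0.
move=> q; rewrite !le_min => /andP[/andP[qx qy] /and3P[qu qex qey]].
have hK : norm1 (x p, y p) (x q, y q) <= K * norm1 p q.
  by rewrite /norm1/= -/(norm1 p q) /K mulrDl lerD ?Lx ?Ly.
have hu := Hu' (x q, y q); rewrite /= in hu.
have {}hu : `|u (x q, y q) - u (x p, y p) - (a * (x q - x p) + b * (y q - y p))|
    <= e / 3 * norm1 p q.
  apply: le_trans (hu _) _.
    by rewrite (le_trans hK)// mulrC -ler_pdivlMr.
  apply: le_trans (ler_wpM2l (ltW eK) hK) _.
  by rewrite le_eqVlt; apply/orP; left; apply/eqP; field; rewrite gt_eqF.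
have := Hx' q qex; have := Hy' q qey.
set Rx := x q - x p - _; set Ry := y q - y p - _ => hy hx.
have -> : u (x q, y q) - u (x p, y p) -
    ((a * x1 + b * y1) * (q.1 - p.1) + (a * x2 + b * y2) * (q.2 - p.2)) =
  (u (x q, y q) - u (x p, y p) - (a * (x q - x p) + b * (y q - y p))) + (a * Rx + b * Ry).
  by rewrite /Rx /Ry; ring.
rewrite (le_trans (ler_normD _ _))//.
have hab : `|a * Rx + b * Ry| <= e / 3 * norm1 p q + e / 3 * norm1 p q.
  have aA : `|a| <= A by rewrite /A; have := normr_ge0 b; lra.
  have bA : `|b| <= A by rewrite /A; have := normr_ge0 a; lra.
  have E : A * (e / (3 * A) * norm1 p q) = e / 3 * norm1 p q.
    by field; rewrite gt_eqF.
  rewrite (le_trans (ler_normD _ _))// !normrM lerD// -E.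
    by rewrite ler_pM.
  by rewrite ler_pM.
lra.
Qed.

Lemma frechet_eq u p a b a' b' : a = a' -> b = b' -> frechet u p a b -> frechet u p a' b'.
Proof. by move=> -> ->. Qed.

Lemma frechet_ext u v p a b d : 0 < d -> (forall q, norm1 p q <= d -> u q = v q) ->
  frechet u p a b -> frechet v p a b.
Proof.
move=> d0 uv H e /H[d' d'0 {}H]; exists (Num.min d d'); first by rewrite lt_min d0.
move=> q; rewrite le_min => /andP[qd qd'].
by rewrite -!uv ?H// /norm1 !subrr normr0 addr0 ltW.
Qed.

Lemma frechet_affine a b c p : frechet (fun q => a * q.1 + b * q.2 + c) p a b.
Proof.
move=> e e0; exists 1 => // q _.
rewrite [X in `|X|](_ : _ = 0); last by ring.
by rewrite normr0 mulr_ge0 ?norm1_ge0 ?ltW.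
Qed.

Lemma frechet_fst p : frechet fst p 1 0.
Proof.
apply: frechet_ext ltr01 _ (frechet_affine 1 0 0 p) => q _.
by rewrite mul1r mul0r !addr0.
Qed.

Lemma frechet_snd p : frechet snd p 0 1.
Proof.
apply: frechet_ext ltr01 _ (frechet_affine 0 1 0 p) => q _.
by rewrite mul1r mul0r addr0 add0r.
Qed.

Lemma frechet_cst c p : frechet (fun=> c) p 0 0.
Proof.
apply: frechet_ext ltr01 _ (frechet_affine 0 0 c p) => q _.
by rewrite !mul0r !add0r.
Qed.

Lemma frechetM x y p (x1 x2 y1 y2 : R) : frechet x p x1 x2 -> frechet y p y1 y2 ->
  frechet (fun q => x q * y q) p (x1 * y p + x p * y1) (x2 * y p + x p * y2).
Proof.
move=> Hx Hy.
have Hm : frechet (fun q => q.1 * q.2) (x p, y p) (y p) (x p).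
  move=> e e0; exists e => // q /= qe.
  rewrite [X in `|X|](_ : _ = (q.1 - x p) * (q.2 - y p)); last by ring.
  rewrite normrM mulrC /norm1/= in qe *.
  have h1 := normr_ge0 (q.1 - x p); have h2 := normr_ge0 (q.2 - y p).
  by rewrite ler_pM//; lra.
apply: frechet_eq (frechet_comp2 Hm Hx Hy); ring.
Qed.

Lemma frechetD x y p (x1 x2 y1 y2 : R) : frechet x p x1 x2 -> frechet y p y1 y2 ->
  frechet (fun q => x q + y q) p (x1 + y1) (x2 + y2).
Proof.
move=> Hx Hy; have Ha := frechet_affine 1 1 0 (x p, y p).
have := frechet_comp2 Ha Hx Hy; rewrite !mul1r.
by apply: frechet_ext ltr01 _ => q _ /=; rewrite !mul1r addr0.
Qed.

Lemma frechetN x p (x1 x2 : R) : frechet x p x1 x2 -> frechet (fun q => - x q) p (- x1) (- x2).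
Proof.
move=> Hx; apply: (frechet_ext (u := fun q => -1 * x q) ltr01) => [q _|].
  by rewrite mulN1r.
by apply: frechet_eq (frechetM (frechet_cst _ _) Hx); ring.
Qed.

Lemma is_derive_eps (f : R -> R) (x l : R) : is_derive x 1 f l ->
  forall e, 0 < e -> exists2 d, 0 < d & forall y : R, `|y - x| <= d ->
  `|f y - f x - l * (y - x)| <= e * `|y - x|.
Proof.
move=> [df dl] e e0; move: df => /cvg_ex[l' hl].
have {}hl : h^-1 *: ((f \o shift x) (h *: 1) - f x) @[h --> 0^'] --> l.
  by rewrite -dl /derive; move/cvg_lim : (hl) => ->.
move/cvgrPdist_le : hl => /(_ e e0).
rewrite near_withinE => /nbhs_ballP[d /= d0 H].
exists (d / 2); first by rewrite divr_gt0.
move=> y yd; have [->|yx] := eqVneq y x.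
  by rewrite !subrr mulr0 subr0 normr0 mulr0.
have yx0 : y - x != 0 by rewrite subr_eq0.
have := H (y - x); rewrite /= /ball/= sub0r normrN => /(_ _ yx0).
have yd' : `|y - x| < d by apply: le_lt_trans yd _; lra.
move=> /(_ yd'); rewrite [_ *: 1]mulr1 subrK -[_ *: (_ - _)]/(_ * _) => h.
have -> : f y - f x - l * (y - x) = - (l - (y - x)^-1 * (f y - f x)) * (y - x).
  by field.
by rewrite normrM normrN ler_wpM2r.
Qed.

Lemma frechet_comp1 (f : R -> R) x p (x1 x2 l : R) : is_derive (x p) 1 f l ->
  frechet x p x1 x2 -> frechet (f \o x) p (l * x1) (l * x2).
Proof.
move=> /is_derive_eps Hf Hx.
have Hf' : frechet (f \o fst) (x p, 0) l 0.
  move=> e e0; have [d d0 {}Hf] := Hf e e0; exists d => // q /= qd.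
  rewrite mul0r addr0 (le_trans (Hf _ _))//.
    by rewrite (le_trans _ qd)// /norm1/= lerDl.
  by rewrite /norm1/= mulrDr lerDl mulr_ge0// ltW.
apply: frechet_eq (frechet_comp2 Hf' Hx (frechet_cst 0 p)); ring.
Qed.

Lemma frechet_continuous_fst u p a b : frechet u p a b ->
  {for p.1, continuous (fun x : R => u (x, p.2))}.
Proof.
move=> /frechet_lipschitz[d d0 H]; apply/cvgrPdist_le => e e0.
set K := 1 + `|a| + `|b| in H.
have K0 : 0 < K by rewrite /K !ltr_wpDr.
near=> x; rewrite distrC -surjective_pairing.
have hx : norm1 p (x, p.2) = `|x - p.1| by rewrite /norm1/= subrr normr0 addr0.
have : `|x - p.1| <= Num.min d (e / K).
  rewrite distrC; near: x; apply: cvgr_dist_le => //.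
  by rewrite lt_min d0 divr_gt0.
rewrite le_min => /andP[xd xe].
have := H (x, p.2); rewrite hx => /(_ xd) h; apply: le_trans h _.
by rewrite mulrC -ler_pdivlMr.
Unshelve. all: by end_near. Qed.

Lemma frechet_continuous_snd u p a b : frechet u p a b ->
  {for p.2, continuous (fun y : R => u (p.1, y))}.
Proof.
move=> H.
have H' : frechet (fun q => u (q.2, q.1)) (p.2, p.1) b a.
  rewrite [p]surjective_pairing in H.
  apply: frechet_eq (@frechet_comp2 u snd fst (p.2, p.1) _ _ _ _ _ _ H
    (frechet_snd (p.2, p.1)) (frechet_fst (p.2, p.1))); ring.
exact: (frechet_continuous_fst H').
Qed.

End Frechet.

(** * Integrals over segments *)

Section SegmentIntegral.
Context {R : realType}.
Notation lambda := (@lebesgue_measure R).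
Implicit Types (f g : R -> R) (a b m e k : R).

Definition sint f a b : R := \int[lambda]_(x in `[a, b]) f x.

(** Continuity is two-sided even at [a] and [b], so that subintervals need no care at their ends. *)
Definition cont_on f a b := forall x, a <= x <= b -> {for x, continuous f}.

Lemma cont_on_sub f a b c d : a <= c -> d <= b -> cont_on f a b -> cont_on f c d.
Proof.
by move=> ac db H x /andP[cx xd]; apply: H; rewrite (le_trans ac)//= (le_trans xd).
Qed.

Lemma cont_onB f g a b : cont_on f a b -> cont_on g a b ->
  cont_on (fun x => f x - g x) a b.
Proof. by move=> cf cg x xab; apply: cvgB; [exact: cf|exact: cg]. Qed.

Lemma cont_on_within f a b : cont_on f a b -> {within `[a, b], continuous f}.
Proof.
move=> cf; apply: continuous_in_subspaceT => x /[!inE]/=.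
by rewrite in_itv/= => /cf.
Qed.

Lemma cont_on_integrable f a b : cont_on f a b ->
  lambda.-integrable `[a, b] (EFin \o f).
Proof.
move=> cf; apply: continuous_compact_integrable; first exact: segment_compact.
exact: cont_on_within.
Qed.

Lemma sint_cat f a m b : a <= m -> m <= b -> cont_on f a b ->
  sint f a b = sint f a m + sint f m b.
Proof.
move=> am mb cf; have fi := cont_on_integrable cf.
have := @Rintegral_itvB R f (BLeft a) (BRight b) m fi.
rewrite !bnd_simp => /(_ am mb) E.
have fi' : lambda.-integrable `]m, b] (EFin \o f).
  apply: integrableS fi => // x /=; rewrite !in_itv/= => /andP[mx ->].
  by rewrite (le_trans am)// ltW.
by rewrite /sint -[in RHS](Rintegral_itv_obnd_cbnd fi') -E; ring.
Qed.

Lemma sintB f g a b : cont_on f a b -> cont_on g a b ->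
  sint (fun x => f x - g x) a b = sint f a b - sint g a b.
Proof. by move=> cf cg; rewrite /sint RintegralB//; exact: cont_on_integrable. Qed.

Lemma sint_cst k a b : a <= b -> sint (fun=> k) a b = k * (b - a).
Proof.
move=> ab; rewrite /sint Rintegral_cst//= lebesgue_measure_itv/= lte_fin.
case: ltP => // ba; have /eqP -> : a == b by rewrite eq_le ab ba.
by rewrite subrr !mulr0.
Qed.

Lemma sint_near_cst f a b k e : a <= b -> cont_on f a b ->
  (forall x, a <= x <= b -> `|f x - k| <= e) ->
  `|sint f a b - k * (b - a)| <= e * (b - a).
Proof.
move=> ab cf H.
have ck c : cont_on (fun=> c : R) a b by move=> x _; exact: cvg_cst.
rewrite -!(sint_cst _ ab) -(sintB cf (ck k)).
have ci := cont_onB cf (ck k).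
have ai := cont_on_integrable ci.
have cn : cont_on (fun x => `|f x - k|) a b.
  by move=> x xab; apply: (@cvg_norm _ _ _ _ _ (fun x => f x - k)); exact: ci.
rewrite /sint; apply: le_trans (le_normr_Rintegral _ ai) _ => //.
apply: le_Rintegral => //.
- exact: (cont_on_integrable cn).
- exact: (cont_on_integrable (ck e)).
Qed.

End SegmentIntegral.

(** * Goursat's theorem for closed forms on rectangles *)

Section Goursat.
Context {R : realType}.
Variables (P Q : R * R -> R).

(** Read as [((left, right), (bottom, top))]. *)
Definition rect : Type := ((R * R) * (R * R))%type.

Definition in_rect (z : rect) (p : R * R) : Prop :=
  z.1.1 <= p.1 <= z.1.2 /\ z.2.1 <= p.2 <= z.2.2.

Definition wf_rect (z : rect) := z.1.1 <= z.1.2 /\ z.2.1 <= z.2.2.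

Definition subrect (z w : rect) :=
  [/\ w.1.1 <= z.1.1, z.1.2 <= w.1.2, w.2.1 <= z.2.1 & z.2.2 <= w.2.2].

(** The counterclockwise line integral of [P dx + Q dy] along the boundary. *)
Definition circulation (z : rect) : R :=
  sint (fun x => P (x, z.2.1)) z.1.1 z.1.2 + sint (fun y => Q (z.1.2, y)) z.2.1 z.2.2
  - sint (fun x => P (x, z.2.2)) z.1.1 z.1.2 - sint (fun y => Q (z.1.1, y)) z.2.1 z.2.2.

(* The shared coefficient [b] says that the form [P dx + Q dy] is closed. *)
Definition closed_on (z : rect) := forall p, in_rect z p ->
  exists a b c, frechet P p a b /\ frechet Q p b c.

Lemma closed_on_cont z : closed_on z ->
  (forall y, z.2.1 <= y <= z.2.2 -> cont_on (fun x => P (x, y)) z.1.1 z.1.2) /\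
  (forall x, z.1.1 <= x <= z.1.2 -> cont_on (fun y => Q (x, y)) z.2.1 z.2.2).
Proof.
move=> H; split=> [y yz x xz|x xz y yz].
  by have [a [b [c [Pp _]]]] := H (x, y) (conj xz yz); exact: frechet_continuous_fst Pp.
by have [a [b [c [_ Qp]]]] := H (x, y) (conj xz yz); exact: frechet_continuous_snd Qp.
Qed.

Lemma subrect_closed z w : subrect z w -> closed_on w -> closed_on z.
Proof.
move=> [h1 h2 h3 h4] H p [/andP[p1 p2] /andP[p3 p4]]; apply: H; split; apply/andP; split.
- exact: le_trans p1.
- exact: le_trans h2.
- exact: le_trans p3.
- exact: le_trans h4.
Qed.

Let mx (z : rect) := (z.1.1 + z.1.2) / 2.
Let my (z : rect) := (z.2.1 + z.2.2) / 2.
Let q1 (z : rect) : rect := ((z.1.1, mx z), (z.2.1, my z)).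
Let q2 (z : rect) : rect := ((mx z, z.1.2), (z.2.1, my z)).
Let q3 (z : rect) : rect := ((z.1.1, mx z), (my z, z.2.2)).
Let q4 (z : rect) : rect := ((mx z, z.1.2), (my z, z.2.2)).

Let circulation_quad z : wf_rect z -> closed_on z ->
  circulation z = circulation (q1 z) + circulation (q2 z) + circulation (q3 z) + circulation (q4 z).
Proof.
move=> [w1 w2] /closed_on_cont[cP cQ].
have hx : z.1.1 <= mx z <= z.1.2 by rewrite /mx; apply/andP; split; lra.
have hy : z.2.1 <= my z <= z.2.2 by rewrite /my; apply/andP; split; lra.
have /andP[hx1 hx2] := hx; have /andP[hy1 hy2] := hy.
have EP y : z.2.1 <= y <= z.2.2 -> sint (fun x => P (x, y)) z.1.1 z.1.2 =
    sint (fun x => P (x, y)) z.1.1 (mx z) + sint (fun x => P (x, y)) (mx z) z.1.2.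
  by move=> yz; apply: sint_cat => //; exact: cP.
have EQ x : z.1.1 <= x <= z.1.2 -> sint (fun y => Q (x, y)) z.2.1 z.2.2 =
    sint (fun y => Q (x, y)) z.2.1 (my z) + sint (fun y => Q (x, y)) (my z) z.2.2.
  by move=> xz; apply: sint_cat => //; exact: cQ.
rewrite /circulation /= (EP z.2.1) ?lexx// (EP z.2.2) ?lexx ?andbT//.
by rewrite (EQ z.1.1) ?lexx// (EQ z.1.2) ?lexx ?andbT//; ring.
Qed.

Let step z := if `|circulation z| <= 4 * `|circulation (q1 z)| then q1 z
  else if `|circulation z| <= 4 * `|circulation (q2 z)| then q2 z
  else if `|circulation z| <= 4 * `|circulation (q3 z)| then q3 z else q4 z.

(** The four quarters add up to the whole, so if the first three each carry less than a fourth of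
    the circulation, the last one cannot. *)
Let step_le z : wf_rect z -> closed_on z -> `|circulation z| <= 4 * `|circulation (step z)|.
Proof.
move=> wz cz; rewrite /step; case: ifPn => // h1; case: ifPn => // h2; case: ifPn => // h3.
rewrite -!ltNge in h1 h2 h3.
have := circulation_quad wz cz.
have := ler_normD (circulation (q1 z) + circulation (q2 z) + circulation (q3 z)) (circulation (q4 z)).
have := ler_normD (circulation (q1 z) + circulation (q2 z)) (circulation (q3 z)).
have := ler_normD (circulation (q1 z)) (circulation (q2 z)).
by move=> l1 l2 l3 e; rewrite -e in l3; lra.
Qed.

Let step_sub z : wf_rect z -> [/\ wf_rect (step z), subrect (step z) z,
  (step z).1.2 - (step z).1.1 = (z.1.2 - z.1.1) / 2 &
  (step z).2.2 - (step z).2.1 = (z.2.2 - z.2.1) / 2].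
Proof.
move=> [w1 w2]; rewrite /step /wf_rect /subrect.
by do 3?[case: ifP => _]; rewrite /q1 /q2 /q3 /q4 /mx /my /=; split;
  try split; try lra.
Qed.

(** To first order the horizontal sides contribute [- b * h * w] and the vertical ones [b * w * h].
    These cancel because [P] and [Q] share [b], and only the errors of the linear approximations
    remain. *)
Let circulation_small z p e a b c : wf_rect z -> closed_on z -> in_rect z p -> 0 < e ->
  (forall q, in_rect z q -> `|P q - P p - (a * (q.1 - p.1) + b * (q.2 - p.2))| <= e * norm1 p q) ->
  (forall q, in_rect z q -> `|Q q - Q p - (b * (q.1 - p.1) + c * (q.2 - p.2))| <= e * norm1 p q) ->
  `|circulation z| <= 2 * e * (z.1.2 - z.1.1 + (z.2.2 - z.2.1)) ^+ 2.
Proof.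
move=> [w1 w2] /closed_on_cont[cP cQ] [/andP[p1 p2] /andP[p3 p4]] e0 HP HQ.
set w := z.1.2 - z.1.1; set h := z.2.2 - z.2.1.
have n1 q : in_rect z q -> norm1 p q <= w + h.
  by move=> [/andP[? ?] /andP[? ?]]; rewrite /norm1 lerD// ler_norml /w /h; apply/andP; split; lra.
have y1 : z.2.1 <= z.2.1 <= z.2.2 by rewrite lexx.
have y2 : z.2.1 <= z.2.2 <= z.2.2 by rewrite lexx andbT.
have x1 : z.1.1 <= z.1.1 <= z.1.2 by rewrite lexx.
have x2 : z.1.1 <= z.1.2 <= z.1.2 by rewrite lexx andbT.
have hE : circulation z =
    sint (fun x => P (x, z.2.1) - P (x, z.2.2)) z.1.1 z.1.2 +
    sint (fun y => Q (z.1.2, y) - Q (z.1.1, y)) z.2.1 z.2.2.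
  by rewrite !sintB; [rewrite /circulation; ring|exact: cQ|exact: cQ|exact: cP|exact: cP].
have bd (A B C : R) q q' : in_rect z q -> in_rect z q' ->
    `|A| <= e * norm1 p q -> `|B| <= e * norm1 p q' -> C = A - B ->
    `|C| <= 2 * e * (w + h).
  move=> /n1 nq /n1 nq' hA hB ->; rewrite (le_trans (ler_normB _ _))//.
  have := ler_wpM2l (ltW e0) nq; have := ler_wpM2l (ltW e0) nq'.
  by lra.
have S1 : `|sint (fun x => P (x, z.2.1) - P (x, z.2.2)) z.1.1 z.1.2 - (- b * h) * w|
    <= 2 * e * (w + h) * w.
  apply: sint_near_cst => //; first by apply: cont_onB; exact: cP.
  move=> x xz; have r1 : in_rect z (x, z.2.1) by [].
  have r2 : in_rect z (x, z.2.2) by [].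
  by apply: (bd _ _ _ _ _ r1 r2 (HP _ r1) (HP _ r2)) => /=; rewrite /h; ring.
have S2 : `|sint (fun y => Q (z.1.2, y) - Q (z.1.1, y)) z.2.1 z.2.2 - (b * w) * h|
    <= 2 * e * (w + h) * h.
  apply: sint_near_cst => //; first by apply: cont_onB; exact: cQ.
  move=> y yz; have r1 : in_rect z (z.1.2, y) by [].
  have r2 : in_rect z (z.1.1, y) by [].
  by apply: (bd _ _ _ _ _ r1 r2 (HQ _ r1) (HQ _ r2)) => /=; rewrite /w; ring.
rewrite hE; set s1 := sint _ _ _ in S1 *; set s2 := sint _ _ _ in S2 *.
have -> : s1 + s2 = (s1 - (- b * h) * w) + (s2 - (b * w) * h) by ring.
have -> : 2 * e * (w + h) ^+ 2 = 2 * e * (w + h) * w + 2 * e * (w + h) * h by ring.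
by rewrite (le_trans (ler_normD _ _))// lerD.
Qed.

(* Goursat's bisection: some nested sequence of quarter rectangles keeps at least
   [4^-n] of the circulation, while differentiability at its limit point makes
   the circulation [o(4^-n)]. *)
Theorem goursat z : wf_rect z -> closed_on z -> circulation z = 0.
Proof.
move=> wz cz; pose r n := iter n step z.
have rS n : [/\ wf_rect (r n) & subrect (r n) z].
  elim: n => [|n [wn [s1 s2 s3 s4]]]; first by split => //; split.
  have [w' [t1 t2 t3 t4] _ _] := step_sub wn; split => //; split.
  - exact: le_trans t1.
  - exact: le_trans s2.
  - exact: le_trans t3.
  - exact: le_trans s4.
have rc n : closed_on (r n) by have [_ s] := rS n; exact: subrect_closed cz.
have rw n : (r n).1.2 - (r n).1.1 = (z.1.2 - z.1.1) / 2 ^+ n /\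
            (r n).2.2 - (r n).2.1 = (z.2.2 - z.2.1) / 2 ^+ n.
  elim: n => [|n [e1 e2]]; first by rewrite expr0 !divr1.
  have [wn _] := rS n; have [_ _ -> ->] := step_sub wn.
  by rewrite -/(r n) e1 e2 exprSr invfM !mulrA.
have rI n : `|circulation z| <= 4 ^+ n * `|circulation (r n)|.
  elim: n => [|n IH]; first by rewrite mul1r.
  have [wn _] := rS n; rewrite (le_trans IH)// exprSr -mulrA ler_wpM2l ?exprn_ge0//.
  exact: step_le.
have sub_mono n m : subrect (r (n + m)%N) (r n).
  elim: m => [|m [s1 s2 s3 s4]]; first by rewrite addn0; split.
  have [wn _] := rS (n + m)%N; have [_ [t1 t2 t3 t4] _ _] := step_sub wn.
  rewrite addnS; split.
  - exact: le_trans t1.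
  - exact: le_trans s2.
  - exact: le_trans t3.
  - exact: le_trans s4.
have cross n m : (r n).1.1 <= (r m).1.2 /\ (r n).2.1 <= (r m).2.2.
  have [s1 _ s3 _] := sub_mono n m; have [_ s2 _ s4] := sub_mono m n.
  have [[w1 w2] _] := rS (n + m)%N; rewrite addnC in s2 s4; split.
    exact: le_trans (le_trans s1 w1) s2.
  exact: le_trans (le_trans s3 w2) s4.
(* By [cross], no left or lower side exceeds any right or upper side, so this point lies in all the
   rectangles. *)
pose p : R * R := (sup (range (fun n => (r n).1.1)), sup (range (fun n => (r n).2.1))).
have pin n : in_rect (r n) p.
  have S1 : has_sup (range (fun n => (r n).1.1)).
    split; first by exists (r 0).1.1; exists 0%N.
    by exists (r 0).1.2 => _ [m _ <-]; have [] := cross m 0%N.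
  have S2 : has_sup (range (fun n => (r n).2.1)).
    split; first by exists (r 0).2.1; exists 0%N.
    by exists (r 0).2.2 => _ [m _ <-]; have [] := cross m 0%N.
  split; apply/andP; split.
  - by apply: sup_upper_bound => //; exists n.
  - apply: ge_sup; first by exists (r 0).1.1; exists 0%N.
    by move=> _ [m _ <-]; have [] := cross m n.
  - by apply: sup_upper_bound => //; exists n.
  - apply: ge_sup; first by exists (r 0).2.1; exists 0%N.
    by move=> _ [m _ <-]; have [] := cross m n.
have [a [b [c [FP FQ]]]] := cz p (pin 0%N).
set L := z.1.2 - z.1.1 + (z.2.2 - z.2.1).
apply/eqP; rewrite -normr_le0; apply/ler_addgt0Pr => e e0; rewrite add0r.
(* The final bound is [2 * e1 * L ^ 2]; adding 1 avoids a division by zero when [L = 0]. *)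
have e' : 0 < e / (2 * (L ^+ 2 + 1)) by rewrite divr_gt0// mulr_gt0// ltr_wpDl// sqr_ge0.
set e1 := e / _ in e'.
have [d1 d10 HP] := FP _ e'; have [d2 d20 HQ] := FQ _ e'.
pose d := Num.min d1 d2.
have d0 : 0 < d by rewrite lt_min d10.
(* As [n < 2 ^ n], the rectangle [r n] has half-perimeter [L / 2 ^ n] at most [d]. *)
pose n := (Num.truncn (L / d)).+1.
have nd : L / 2 ^+ n <= d.
  rewrite ler_pdivrMr ?exprn_gt0// mulrC -ler_pdivrMr//.
  rewrite (le_trans (ltW (truncnS_gt _)))// -natrX ler_nat ltnW// ltn_expl//.
have nr q : in_rect (r n) q -> norm1 p q <= d.
  move=> [/andP[q1' q2'] /andP[q3' q4']]; have [/andP[p1 p2] /andP[p3 p4]] := pin n.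
  have [e1' e2'] := rw n; apply: le_trans nd; rewrite /L mulrDl -e1' -e2'.
  by rewrite /norm1 lerD// ler_norml; apply/andP; split; lra.
have [wn _] := rS n.
have := @circulation_small (r n) p e1 a b c wn (rc n) (pin n) e'.
have [-> ->] := rw n.
move=> H; apply: le_trans (rI n) _.
have {}H : `|circulation (r n)| <= 2 * e1 * (L / 2 ^+ n) ^+ 2.
  have -> : L / 2 ^+ n = (z.1.2 - z.1.1) / 2 ^+ n + (z.2.2 - z.2.1) / 2 ^+ n by rewrite /L mulrDl.
  apply: H => q /nr; rewrite /d le_min => /andP[qd1 qd2].
    exact: HP.
  exact: HQ.
apply: le_trans (ler_wpM2l (exprn_ge0 n _) H) _ => //.
have -> : 4 ^+ n * (2 * e1 * (L / 2 ^+ n) ^+ 2) = e * (L ^+ 2 / (L ^+ 2 + 1)).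
  have -> : (4 : R) ^+ n = (2 ^+ n) ^+ 2 by rewrite -exprM mulnC exprM expr2 -natrM.
  have h2 : (2 : R) ^+ n != 0 by rewrite expf_neq0.
  have hL : L ^+ 2 + 1 != 0 by rewrite gt_eqF// ltr_wpDl// sqr_ge0.
  by rewrite /e1; move: (2 ^+ n : R) h2 => t h2; field; rewrite h2 hL.
rewrite -[leRHS]mulr1 ler_wpM2l ?(ltW e0)// ler_pdivrMr ?ltr_wpDl ?sqr_ge0//.
by rewrite mul1r lerDl.
Qed.

End Goursat.

Local Open Scope complex_scope.

(** * Complex derivatives and the Cauchy-Riemann equations *)

Section ComplexDerivative.

Lemma derivable_epsP (K : numFieldType) (f : K^o -> K^o) (z : K) :
  derivable f z 1 <-> exists l : K, forall e, 0 < e -> exists2 d, 0 < d &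
    forall y, `|y - z| < d -> `|f y - f z - l * (y - z)| <= e * `|y - z|.
Proof.
split=> [/cvg_ex[l /cvgrPdist_le H]|[l H]].
  exists l => e /H; rewrite near_withinE => /nbhs_ballP[d /= d0 {}H].
  exists d => // y yd; have [->|yx] := eqVneq y z.
    by rewrite !subrr mulr0 subr0 normr0 mulr0.
  have yx0 : y - z != 0 by rewrite subr_eq0.
  have := H (y - z); rewrite /= /ball/= sub0r normrN => /(_ yd yx0).
  rewrite [_ *: 1]mulr1 subrK -[_ *: (_ - _)]/(_ * _) => h.
  have -> : f y - f z - l * (y - z) = - (l - (y - z)^-1 * (f y - f z)) * (y - z).
    by field.
  by rewrite normrM normrN ler_wpM2r.
apply/cvg_ex; exists l; apply/cvgrPdist_le => e /H[d d0 {}H].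
rewrite near_withinE; apply/nbhs_ballP; exists d => //= h.
rewrite /ball/= sub0r normrN => hd h0; rewrite [_ *: 1]mulr1 -[_ *: (_ - _)]/(_ * _).
have := H (h + z); rewrite addrK => /(_ hd) {}H.
have -> : l - h^-1 * (f (h + z) - f z) = - (h^-1 * (f (h + z) - f z - l * h)).
  by field.
rewrite normrN normrM normfV mulrC ler_pdivrMr ?normr_gt0//.
Qed.

Lemma derivable_compN (K : numFieldType) (f : K^o -> K^o) (z : K) :
  derivable f (- z) 1 -> derivable (fun x => f (- x)) z 1.
Proof.
move=> /derivable_epsP[l H]; apply/derivable_epsP; exists (- l) => e /H[d d0 {}H].
exists d => // y yz; have := H (- y); rewrite -opprD normrN => /(_ yz).
by rewrite mulrN mulNr.
Qed.

Context {R : realType}.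
Implicit Types (f g : R[i] -> R[i]) (p q : R * R).

Definition re_part f : R * R -> R := @complex.Re R \o f \o toC.
Definition im_part f : R * R -> R := @complex.Im R \o f \o toC.

Lemma toCB p q : toC q - toC p = (q.1 - p.1) +i* (q.2 - p.2).
Proof. by []. Qed.

Lemma normC_le_norm1 p q : `|toC q - toC p| <= (norm1 p q)%:C.
Proof.
rewrite toCB normc_def lecR /= /norm1 -ler_sqr ?nnegrE ?sqrtr_ge0 ?addr_ge0//.
rewrite sqr_sqrtr ?addr_ge0 ?sqr_ge0// [leRHS]sqrrD !real_normK ?num_real// lerD2r lerDl.
by rewrite mulrn_wge0// mulr_ge0.
Qed.

Lemma Re_le_normC (z : R[i]) (e : R) : `|z| <= e%:C -> `|complex.Re z| <= e.
Proof. by move=> h; rewrite -lecR; apply: le_trans (normc_ge_Re z) h. Qed.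

Lemma Im_le_normC (z : R[i]) (e : R) : `|z| <= e%:C -> `|complex.Im z| <= e.
Proof.
move=> h; rewrite -normrN -ReiNIm; apply: Re_le_normC.
by rewrite normrM [X in _ * X](_ : _ = 1) ?mulr1// normc_def/= expr0n/= expr1n add0r sqrtr1.
Qed.

(** In the order of [R[i]] comparable numbers have equal imaginary parts, so the positive radii
    produced by [derivable_epsP] are real. *)
Lemma gt0C (d : R[i]) : 0 < d -> exists2 r : R, 0 < r & d = r%:C.
Proof. by case: d => a b; rewrite ltcE/= => /andP[/eqP -> a0]; exists a. Qed.

(** Multiplication by [a +i* b] has a real part with gradient [(a, - b)] and an imaginary part with
    gradient [(b, a)]: these are the Cauchy-Riemann equations. *)
Lemma derivable_frechet f p : derivable (f : R[i]^o -> R[i]^o) (toC p) 1 ->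
  exists a b, frechet (re_part f) p a (- b) /\ frechet (im_part f) p b a.
Proof.
move=> /derivable_epsP[[a b] H]; exists a, b.
have {}H (e : R) : 0 < e -> exists2 d : R, 0 < d & forall q, norm1 p q <= d ->
    `|f (toC q) - f (toC p) - (a +i* b) * (toC q - toC p)| <= (e * norm1 p q)%:C.
  move=> e0; have e0' : 0 < e%:C by rewrite ltcR.
  have [d /gt0C[r r0 ->] {}H] := H _ e0'.
  exists (r / 2); first by rewrite divr_gt0.
  move=> q qr; have hq := normC_le_norm1 p q.
  have := H (toC q); rewrite (le_lt_trans hq) ?ltcR; last first.
    by rewrite (le_lt_trans qr)// ltr_pdivrMr// ltr_pMr// ltr1n.
  move=> /(_ isT) h; apply: le_trans h _.
  by rewrite rmorphM ler_wpM2l// ltW.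
split=> e /H[d d0 {}H]; exists d => // q /H; [move=> /Re_le_normC|move=> /Im_le_normC].
  rewrite toCB /re_part/=; case: (f (toC q)) => x y; case: (f (toC p)) => x' y' /=.
  by congr (`|_| <= _); ring.
rewrite toCB /im_part/=; case: (f (toC q)) => x y; case: (f (toC p)) => x' y' /=.
by congr (`|_| <= _); ring.
Qed.

Lemma frechet_derivable f p (a b : R) :
  frechet (re_part f) p a (- b) -> frechet (im_part f) p b a ->
  derivable (f : R[i]^o -> R[i]^o) (toC p) 1.
Proof.
move=> Hr Hi; apply/derivable_epsP; exists (a +i* b) => _ /gt0C[e e0 ->].
(* One factor 2 bounds the sum norm by the modulus, the other adds the errors of the real and
   imaginary parts. *)
have e4 : 0 < e / 4 by rewrite divr_gt0.
have [d1 d10 {}Hr] := Hr _ e4; have [d2 d20 {}Hi] := Hi _ e4.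
exists ((Num.min d1 d2 / 2)%:C); first by rewrite ltcR divr_gt0// lt_min d10.
move=> y; rewrite -[y](_ : toC (complex.Re y, complex.Im y) = y); last by case: y.
move: (complex.Re y, complex.Im y) => {}y yd.
have n2 : norm1 p y <= 2 * complex.Re `|toC y - toC p|.
  rewrite /norm1 mulr_natl mulr2n.
  have h : `|toC y - toC p| <= (complex.Re `|toC y - toC p|)%:C.
    by rewrite RRe_real ?normr_real.
  by rewrite lerD//; [exact: Re_le_normC h|exact: Im_le_normC h].
have {}yd : norm1 p y <= Num.min d1 d2.
  apply: le_trans n2 _; rewrite mulrC -ler_pdivlMr// ltW//.
  by move: yd; rewrite ltcE /= => /andP[].
move: yd; rewrite le_min => /andP[/Hr {}Hr /Hi {}Hi].
have nE (z : R[i]) (r s : R) : `|complex.Re z| <= r -> `|complex.Im z| <= s -> `|z| <= (r + s)%:C.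
  move=> hr hs; rewrite normc_def lecR.
  have r0 : 0 <= r by apply: le_trans hr. have s0 : 0 <= s by apply: le_trans hs.
  rewrite -ler_sqr ?nnegrE ?sqrtr_ge0 ?addr_ge0//.
  rewrite sqr_sqrtr ?addr_ge0 ?sqr_ge0//.
  rewrite -(real_normK (num_real (complex.Re z))) -(real_normK (num_real (complex.Im z))).
  apply: (@le_trans _ _ (r ^+ 2 + s ^+ 2)); first by rewrite lerD// ler_sqr ?nnegrE.
  by rewrite [leRHS]sqrrD lerD2r lerDl mulrn_wge0// mulr_ge0.
have : `|f (toC y) - f (toC p) - (a +i* b) * (toC y - toC p)| <= (e / 4 * norm1 p y + e / 4 * norm1 p y)%:C.
  apply: nE.
    move: Hr; rewrite toCB /re_part/=; case: (f (toC y)) => x1 y1; case: (f (toC p)) => x' y' /=.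
    by congr (`|_| <= _); ring.
  move: Hi; rewrite toCB /im_part/=; case: (f (toC y)) => x1 y1; case: (f (toC p)) => x' y' /=.
  by congr (`|_| <= _); ring.
move=> h; apply: le_trans h _.
have -> : `|toC y - toC p| = (complex.Re `|toC y - toC p|)%:C by rewrite RRe_real ?normr_real.
rewrite -rmorphM lecR; have := ler_wpM2l (ltW e4) n2.
by move: (complex.Re _) => r; lra.
Qed.

End ComplexDerivative.

(** * The mean value property on circles *)

Section CircleMeanValue.
Context {R : realType}.
Notation lambda := (@lebesgue_measure R).
Local Notation J := (`](- (pi / 2))%R, (pi / 2)%R[%classic : set R).
Implicit Types f : R[i] -> R[i].

Lemma polar_frechet (u : R * R -> R) (r t a b : R) :
  frechet u (r * cos t, r * sin t) a b ->
  frechet (fun q => u (q.1 * cos q.2, q.1 * sin q.2)) (r, t)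
    (a * cos t + b * sin t) (r * (b * cos t - a * sin t)).
Proof.
move=> Hu; pose p := (r, t).
have Hc := frechet_comp1 (p := p) (is_derive_cos t) (frechet_snd p).
have Hs := frechet_comp1 (p := p) (is_derive_sin t) (frechet_snd p).
have := @frechet_comp2 _ u _ _ p _ _ _ _ _ _ Hu (frechetM (frechet_fst p) Hc)
  (frechetM (frechet_fst p) Hs).
by apply: frechet_eq => /=; ring.
Qed.

(* In polar coordinates the Cauchy-Riemann equations make [(V / r) dr + U dt]
   closed; since [E] is even, the two radial sides of the rectangle cancel. *)
Let mean_even f (E := fun z => f z + f (- z)) r0 r1 : holomorphic_on disk E ->
  0 < r0 -> r0 <= r1 -> r1 < 1 ->
  let M r := sint (fun t => re_part E (r * cos t, r * sin t)) (- (pi / 2)) (pi / 2) in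
  M r0 = M r1.
Proof.
move=> hE r00 r01 r11 M.
pose U (q : R * R) := re_part E (q.1 * cos q.2, q.1 * sin q.2).
pose V (q : R * R) := im_part E (q.1 * cos q.2, q.1 * sin q.2).
pose z : rect := ((r0, r1), (- (pi / 2), pi / 2)).
have wz : wf_rect z.
  by split=> //=; have := pi_gt0 R; lra.
have dk (r t : R) : 0 < r -> r < 1 -> disk (toC (r * cos t, r * sin t)).
  move=> r0' r1'; rewrite /disk/= !exprMn -mulrDr cos2Dsin2 mulr1 sqrtr_sqr.
  by rewrite gtr0_norm.
have cz : closed_on (fun q => V q / q.1) U z.
  move=> [r t] [/= /andP[rr0 rr1] _].
  have rp : 0 < r by exact: lt_le_trans rr0.
  have rn : r != 0 by rewrite gt_eqF.
  have /hE/derivable_frechet[a [b [Hu Hv]]] := dk r t rp (le_lt_trans rr1 r11).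
  have HU := polar_frechet Hu; have HV := polar_frechet Hv.
  have Hi : frechet (fun q : R * R => q.1^-1) (r, t) (- r ^- 2) 0.
    have := @frechet_comp1 _ (@GRing.inv R) fst (r, t) _ _ _
      (is_deriveV rn (is_derive_id r 1)) (frechet_fst (r, t)).
    by apply: frechet_eq; rewrite ?mulr0// mulr1 /GRing.scale/= mulr1.
  exists ((b * cos t + a * sin t) * r^-1 + V (r, t) * - r ^- 2), (a * cos t - b * sin t),
    (r * (- b * cos t - a * sin t)); split.
    by apply: frechet_eq (frechetM HV Hi) => //=; field.
  by apply: frechet_eq HU => //=; ring.
have := goursat wz cz; rewrite /circulation /=.
have -> : sint (fun x => V (x, - (pi / 2)) / x) r0 r1 = sint (fun x => V (x, pi / 2) / x) r0 r1.
  apply: eq_Rintegral => x _; rewrite /V /=; congr (_ / _).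
  rewrite cosN sinN cos_pihalf sin_pihalf mulr0 mulrN mulr1 /im_part/= /E addrC.
  by congr (complex.Im (f _ + f _)); rewrite /toC; simpc.
by rewrite /M /U /=; lra.
Qed.

(** By [mean_even] the half-circle integral of [E z = f z + f (- z)] does not depend on the radius.
    As the radius shrinks, it tends to [pi] times the value of [E] at 0, which is twice that of
    [f]. *)
Lemma holomorphic_circle_mean f r : holomorphic_on disk f -> 0 < r < 1 ->
  sint (fun t => re_part f (r * cos t, r * sin t) + re_part f (- (r * cos t), - (r * sin t)))
    (- (pi / 2)) (pi / 2) = 2 * pi * re_part f (0, 0).
Proof.
move=> hf /andP[r0 r1]; pose E := fun z => f z + f (- z).
have hE : holomorphic_on disk E.
  move=> z zD; apply: derivableD; first exact: hf.
  by apply: derivable_compN; apply: hf; rewrite /disk/= normcN.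
have E0 : re_part E (0, 0) = 2 * re_part f (0, 0).
  rewrite /re_part /E/= (_ : - toC (0, 0) = toC (0, 0)); last by rewrite /toC; simpc.
  by case: (f _) => x y /=; ring.
have D0 : @disk R (toC (0, 0)) by rewrite /disk/= expr0n/= addr0 sqrtr0.
have [a [b [/frechet_lipschitz[d d0 H0] _]]] := derivable_frechet (hE _ D0).
set M := LHS.
have ME r' : 0 < r' -> r' <= r ->
    M = sint (fun t => re_part E (r' * cos t, r' * sin t)) (- (pi / 2)) (pi / 2).
  move=> r'0 r'r; rewrite (mean_even hE r'0 r'r r1).
  apply: eq_Rintegral => t _; rewrite /re_part /E/=.
  rewrite (_ : - toC (r * cos t, r * sin t) = toC (- (r * cos t), - (r * sin t)))//.
  by case: (f _) => x y; case: (f _) => x' y'.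
have pi0 := pi_gt0 R.
suff : `|M - pi * re_part E (0, 0)| <= 0.
  by rewrite normr_le0 subr_eq0 => /eqP ->; rewrite E0; ring.
apply/ler_addgt0Pr => e e0; rewrite add0r.
set C := 1 + `|a| + `|- b| in H0.
have C0 : 0 < C by rewrite /C !ltr_wpDr.
(* The sum norm on the circle is at most [2 * r']: the bound [d / 2] keeps it in the range of the
   Lipschitz estimate, and the last term gives [C * (2 * r') <= e / pi]. *)
pose r' := Num.min r (Num.min (d / 2) (e / (2 * C * pi))).
have r'0 : 0 < r'.
  by rewrite !lt_min r0 divr_gt0//= divr_gt0// !mulr_gt0.
have r'r : r' <= r by rewrite ge_min lexx.
rewrite (ME r' r'0 r'r).
have -> : pi * re_part E (0, 0) = re_part E (0, 0) * (pi / 2 - - (pi / 2)) by field.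
have -> : e = e / pi * (pi / 2 - - (pi / 2)) by rewrite opprK -splitr divfK// gt_eqF.
have n1 t : norm1 (0, 0) (r' * cos t, r' * sin t) <= 2 * r'.
  rewrite /norm1/= !subr0 !normrM (gtr0_norm r'0) -mulrDr mulrC ler_pM2r//.
  have := cos_le1 t; have := cos_geN1 t; have := sin_le1 t; have := sin_geN1 t.
  by move=> ? ? ? ?; rewrite (_ : 2 = 1 + 1)// lerD// ler_norml; apply/andP; split.
apply: sint_near_cst.
- by lra.
- move=> t _.
  have dD : @disk R (toC (r' * cos t, r' * sin t)).
    rewrite /disk/= !exprMn -mulrDr cos2Dsin2 mulr1 sqrtr_sqr gtr0_norm//.
    exact: le_lt_trans r1.
  have [a' [b' [Hu _]]] := derivable_frechet (hE _ dD).
  exact: (frechet_continuous_snd (polar_frechet Hu)).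
- move=> t _; apply: le_trans (H0 _ _) _.
    rewrite (le_trans (n1 t))// mulrC -ler_pdivlMr// /r'.
    by rewrite !ge_min lexx orbT.
  apply: le_trans (ler_wpM2l (ltW C0) (n1 t)) _.
  have : r' <= e / (2 * C * pi) by rewrite !ge_min lexx !orbT.
  have C2 : 0 < 2 * C * pi by rewrite !mulr_gt0.
  rewrite ler_pdivlMr// ler_pdivlMr// => h.
  by apply: le_trans h; rewrite le_eqVlt; apply/orP; left; apply/eqP; ring.
Qed.

End CircleMeanValue.

(** * Measurability of differentiable functions *)

Section OpenMeasurable.
Context {R : realType}.
Local Notation RR := (measurableTypeR R * measurableTypeR R)%type.

(** An open set is the union of the boxes with rational centre and radius [1 / (n + 1)] that it
    contains, and these are countably many. *)
Lemma norm1_open_measurable (U : set RR) :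
  (forall p, U p -> exists2 d : R, 0 < d & forall q, norm1 p q <= d -> U q) -> measurable U.
Proof.
move=> HU.
pose B (r : (rat * rat) * nat) : set RR :=
  ball (ratr r.1.1 : R) r.2.+1%:R^-1 `*` ball (ratr r.1.2 : R) r.2.+1%:R^-1.
have -> : U = \bigcup_r (if `[< B r `<=` U >] then B r else set0).
  apply/seteqP; split=> [p Up|p [r _]]; last first.
    by case: ifPn => // /asboolP; exact.
  have [d d0 Hd] := HU p Up.
  (* A radius at most [d / 4] puts each coordinate of a point of the box within [d / 2] of that of
     [p]. *)
  pose n := Num.truncn (4 / d).
  have nd : n.+1%:R^-1 <= d / 4.
    by rewrite -[d / 4]invf_div lef_pV2 ?posrE ?divr_gt0// ltW// truncnS_gt.
  have lt1 (x : R) : x < x + n.+1%:R^-1 by rewrite ltrDl.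
  have [i iI] := rat_in_itvoo (lt1 p.1); move: iI; rewrite in_itv/= => /andP[i1 i2].
  have [j jI] := rat_in_itvoo (lt1 p.2); move: jI; rewrite in_itv/= => /andP[j1 j2].
  have aux1 (x y t : R) : x < y -> y < x + t -> - t < y - x < t.
    by move=> xy yx; apply/andP; split; lra.
  have aux2 (x y z t : R) : - t < y - x < t -> - t < y - z < t -> t <= d / 4 -> `|z - x| <= d / 2.
    by move=> /andP[? ?] /andP[? ?] ?; rewrite ler_norml; apply/andP; split; lra.
  exists ((i, j), n) => //; rewrite asboolT.
    by split; rewrite /ball/= ltr_norml; exact: aux1.
  move=> q [] /=; rewrite /ball/= !ltr_norml => qi qj; apply: Hd.
  have h1 := aux2 _ _ _ _ (aux1 _ _ _ i1 i2) qi nd.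
  have h2 := aux2 _ _ _ _ (aux1 _ _ _ j1 j2) qj nd.
  by rewrite /norm1; lra.
apply: countable_bigcupT_measurable => // r; case: ifP => // _.
by apply: measurableX; exact: measurable_ball.
Qed.

(** A local Lipschitz bound makes the sets where [x < u] open. *)
Lemma frechet_measurable (U : set RR) (u : RR -> R) :
  (forall p, U p -> exists2 d : R, 0 < d & forall q, norm1 p q <= d -> U q) ->
  (forall p, U p -> exists a b, frechet u p a b) -> measurable_fun U u.
Proof.
move=> oU Hu.
apply: (measurability _ (RGenOInfty.measurableE R)) => _ [_ [x ->] <-].
apply: norm1_open_measurable => p [Up /=]; rewrite in_itv/= andbT => xp.
have [d d0 Hd] := oU p Up; have [a [b /frechet_lipschitz[d' d'0 H]]] := Hu p Up.
set C := 1 + `|a| + `|b| in H.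
have C0 : 0 < C by rewrite /C !ltr_wpDr.
exists (Num.min d (Num.min d' ((u p - x) / (2 * C)))).
  by rewrite !lt_min d0 d'0/= divr_gt0 ?subr_gt0// mulr_gt0.
move=> q; rewrite !le_min => /and3P[qd qd' qx]; split; first exact: Hd.
rewrite /= in_itv/= andbT; have := H q qd'.
move: qx; rewrite ler_pdivlMr ?mulr_gt0// => qx.
rewrite ler_norml => /andP[h _].
by move: h qx; move: (norm1 p q) => t; nra.
Qed.

Lemma disk2_open (p : RR) : disk2 p ->
  exists2 d : R, 0 < d & forall q, norm1 p q <= d -> disk2 q.
Proof.
move=> pD; pose d := (1 - normc (toC p)) / 2.
have d0 : 0 < d by rewrite divr_gt0// subr_gt0.
exists d => // q qd; rewrite /disk2 /disk /preimage /mkset.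
rewrite -[toC q](subrK (toC p)); apply: le_lt_trans (le_normcD _ _) _.
have : `|toC q - toC p| <= d%:C by apply: le_trans (normC_le_norm1 _ _) _; rewrite lecR.
rewrite -[X in X <= _]/(normc (toC q - toC p))%:C lecR /d => h.
by have : normc (toC p) < 1 := pD; lra.
Qed.

Lemma holomorphic_measurable (f : R[i] -> R[i]) : holomorphic_on disk f ->
  measurable_fun disk2 (re_part f : RR -> R) /\ measurable_fun disk2 (im_part f : RR -> R).
Proof.
move=> hf; split; apply: frechet_measurable disk2_open _ => p /hf/derivable_frechet.
  by move=> [a [b [H _]]]; exists a, (- b).
by move=> [a [b [_ H]]]; exists b, a.
Qed.

End OpenMeasurable.

(** * The mean value property on the weighted disk *)

Section HolomorphicMean.
Context {R : realType} {gamma : R} (hgamma : -1 < gamma).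
Notation lambda := (@lebesgue_measure R).
Local Notation mu := (dA_ hgamma).
Local Notation J := (`](- (pi / 2))%R, (pi / 2)%R[%classic : set R).
Implicit Types f : R[i] -> R[i].

Lemma holomorphic_integral_dA f : holomorphic_on disk f ->
  (\int[mu]_(p in disk2) `|re_part f p|%:E < +oo)%E ->
  (\int[mu]_(p in disk2) (re_part f p)%:E = (re_part f (0, 0))%:E)%E.
Proof.
move=> hf foo; have [mf _] := holomorphic_measurable hf.
apply: integral_dA_mean_value => // s /andP[s0 s1].
set r := Num.sqrt s.
have r0 : 0 < r by rewrite sqrtr_gt0.
have r1 : r < 1 by rewrite -sqrtr1 ltr_sqrt.
have pD t : disk2 (polar s t) by rewrite disk2E /= sqn_polar// ltW.
have cE g : holomorphic_on disk g ->
    cont_on (fun t => re_part g (polar s t)) (- (pi / 2)) (pi / 2).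
  move=> hg t _; have [a [b [H _]]] := derivable_frechet (hg _ (pD t)).
  exact: (frechet_continuous_snd (polar_frechet H)).
pose fN z := f (- z).
have hN : holomorphic_on disk fN.
  by move=> z zD; apply: derivable_compN; apply: hf; rewrite /disk/= normcN.
have c1 := cE f hf; have c2 := cE fN hN.
have i1 := cont_on_integrable c1; have i2 := cont_on_integrable c2.
have JS : J `<=` `[(- (pi / 2)), (pi / 2)]%classic by exact: subset_itv_oo_cc.
have j1 : lambda.-integrable J (EFin \o (fun t => re_part f (polar s t))).
  exact: integrableS i1.
have j2 : lambda.-integrable J (EFin \o (fun t => re_part fN (polar s t))).
  exact: integrableS i2.
split => //.
have /(_ (measurable_itv _)) jE := fun mJ => integralD_EFin mJ j1 j2.
rewrite -jE -(holomorphic_circle_mean hf (r := r)) ?r0 ?r1//.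
have c12 : cont_on (fun t => re_part f (polar s t) + re_part fN (polar s t)) (- (pi / 2)) (pi / 2).
  by move=> t tI; apply: cvgD; [exact: c1|exact: c2].
have i12 := cont_on_integrable c12.
rewrite /sint /Rintegral fineK.
  have j12 : lambda.-integrable J
      (EFin \o (fun t => re_part f (polar s t) + re_part fN (polar s t))).
    exact: integrableS i12.
  rewrite [RHS](integral_itv_bndoo) //.
  exact: (measurable_int lambda j12).
by apply: integrable_fin_num => //; exact: i12.
Qed.

End HolomorphicMean.

(** * Transport by a holomorphic involution of inversion type *)

Section MoebiusMean.
Context {R : realType} {gamma : R} (hgamma : -1 < gamma).
Local Notation RR := (measurableTypeR R * measurableTypeR R)%type.
Local Notation mu := (dA_ hgamma).
Variables (c1 c2 : R).
Let kappa : R := c1 ^+ 2 + c2 ^+ 2 - 1.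
Hypothesis kappa_gt0 : 0 < kappa.

Let K (p : R * R) : R := (kappa / sqn (p.1 - c1, p.2 - c2)) `^ (gamma + 2).
Let C : R[i] := c1 +i* c2.
(* [kelvin] precomposed with conjugation, which makes it holomorphic. *)
Let mob (w : R[i]) : R[i] := C + kappa%:C / (w - C^*).

Let conj2 (p : R * R) : R * R := (p.1, - p.2).

Let conj2_disk p : disk2 p -> disk2 (conj2 p).
Proof. by rewrite disk2E /= /sqn/= sqrrN. Qed.

(** [kelvin] carries the change of variables and [mob] the holomorphy; this joins the two. *)
Let mobE (p : R * R) : toC (kelvin c1 c2 (conj2 p)) = mob (toC p).
Proof.
have e : (- p.2 - c2) ^+ 2 = (p.2 + c2) ^+ 2 by ring.
rewrite /mob; set s := (p.1 - c1) ^+ 2 + (p.2 + c2) ^+ 2.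
have -> : toC p - C^* = (p.1 - c1) +i* (p.2 + c2).
  by rewrite -[RHS]/((p.1 - c1) +i* (p.2 + c2)) /C /toC; simpc.
have -> : kappa%:C / ((p.1 - c1) +i* (p.2 + c2)) =
    (kappa * ((p.1 - c1) / s)) +i* (- (kappa * ((p.2 + c2) / s))).
  rewrite -[_^-1]/(((p.1 - c1) / s) +i* (- ((p.2 + c2) / s))); simpc.
  by rewrite ?mulrN.
rewrite /kelvin /toC /sqn /C /= e -/s -/kappa; simpc.
by congr (_ +i* _); ring.
Qed.

Let mob_disk w : disk w -> disk (mob w).
Proof.
case: w => x y wD; have := @mobE (x, y); rewrite /toC/= => <-.
exact: (@kelvin_disk _ _ _ kappa_gt0 _ (@conj2_disk (x, y) wD)).
Qed.

Let mob_derivable w : disk w -> derivable (mob : R[i]^o -> R[i]^o) w 1.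
Proof.
(* The pole is the conjugate of [C], which lies outside the disk because [kappa] is positive. *)
move=> wD; have w0 : w - C^* != 0.
  apply/eqP => /(congr1 (fun z => z + C^*)); rewrite subrK add0r => wC.
  have : @disk2 R (c1, - c2) by move: wD; rewrite wC.
  rewrite disk2E /= /sqn/= sqrrN; move: kappa_gt0; rewrite /kappa; lra.
apply: derivableD => //; apply: derivableM => //; apply: derivableV => //.
Qed.

Let ge0_integral_mob (g : plane R -> \bar R) : measurable_fun disk2 g ->
  (forall z, 0 <= g z)%E ->
  (\int[mu]_(p in disk2) (g p * (K p)%:E) =
   \int[mu]_(p in disk2) g (kelvin c1 c2 (conj2 p)))%E.
Proof.
move=> mg g0; have mD := @measurable_disk2 R.
rewrite -(ge0_integral_dA_kelvin hgamma kappa_gt0 mg)//.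
apply: (ge0_integral_dA_conj hgamma (f := fun p => g (kelvin c1 c2 p))) => //.
apply: (measurable_comp (F := disk2) mD _ mg).
  by move=> _ [z zD <-]; exact: kelvin_disk.
by apply: (@measurable_funTS _ _ (plane R) (plane R)); exact: measurable_kelvin.
Qed.

Lemma holomorphic_integral_moebius (f : R[i] -> R[i]) : holomorphic_on disk f ->
  (\int[mu]_(p in disk2) (`|re_part f p| * K p)%:E < +oo)%E ->
  (\int[mu]_(p in disk2) (re_part f p * K p)%:E =
    (re_part f (kelvin c1 c2 (0, 0)))%:E)%E.
Proof.
move=> hf foo; have [mf _] := holomorphic_measurable hf.
have mEf : measurable_fun disk2 (EFin \o re_part f : plane R -> _) by exact/measurable_EFinP.
have hG : holomorphic_on disk (f \o mob).
  move=> w wD; apply/derivable1_diffP.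
  apply: (@differentiable_comp _ R[i]^o R[i]^o R[i]^o).
    by apply/derivable1_diffP; exact: mob_derivable.
  by apply/derivable1_diffP; apply: hf; exact: mob_disk.
have GE p : re_part (f \o mob) p = re_part f (kelvin c1 c2 (conj2 p)).
  by rewrite /re_part/= mobE.
have K0 p : 0 <= K p by exact: powR_ge0.
have Goo : (\int[mu]_(p in disk2) `|re_part (f \o mob) p|%:E < +oo)%E.
  apply: le_lt_trans foo; under eq_integral do rewrite GE.
  rewrite -(ge0_integral_mob (g := fun p => `|re_part f p|%:E))//.
  by apply/measurable_EFinP; exact: measurableT_comp.
have := holomorphic_integral_dA hG Goo.
have -> : re_part (f \o mob) (0, 0) = re_part f (kelvin c1 c2 (0, 0)).
  by rewrite GE /conj2 /= oppr0.
(* Positive and negative parts are transported separately by [ge0_integral_mob]; the factor [K] is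
   nonnegative and comes out of both. *)
move=> <-; rewrite integralE [RHS]integralE.
have pos (g : plane R -> R) (p : plane R) : ((EFin \o (fun p => (g p * K p)%R))^\+ p)%E =
    (((EFin \o g)^\+ p) * (K p)%:E)%E.
  by rewrite !funeposE/= -[0%E in RHS]/(0%:E) -!EFin_max -EFinM maxr_pMl// mul0r.
have neg (g : plane R -> R) (p : plane R) : ((EFin \o (fun p => (g p * K p)%R))^\- p)%E =
    (((EFin \o g)^\- p) * (K p)%:E)%E.
  rewrite !funenegE/= -[0%E in RHS]/(0%:E) -?EFinN -!EFin_max -EFinM maxr_pMl// mul0r.
  by rewrite mulNr.
congr (_ - _)%E.
  under eq_integral do rewrite pos.
  rewrite ge0_integral_mob//; first by apply: eq_integral => p _; rewrite !funeposE/= GE.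
  exact: measurable_funepos.
under eq_integral do rewrite neg.
rewrite ge0_integral_mob//; first by apply: eq_integral => p _; rewrite !funenegE/= GE.
exact: measurable_funeneg.
Qed.

End MoebiusMean.

(** * Holomorphy of the principal power *)

Section ComplexPower.
Context {R : realType}.
Implicit Types (z : R[i]) (a : R) (p : R * R).

Lemma normc_cpow z a : normc (cpow z a) = normc z `^ a.
Proof.
rewrite /cpow normcM /= expr0n/= addr0 sqrtr_sqr ger0_norm ?powR_ge0//.
by rewrite cos2Dsin2 sqrtr1 mulr1.
Qed.

(** This replaces [acos] and the distinction on the sign of [y] by an expression that is
    differentiable across the positive real axis. *)
Lemma carg_atan (x y : R) : 0 < x -> carg (x +i* y) = atan (y / x).
Proof.
move=> x0; have xn : x != 0 by rewrite gt_eqF.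
have E : x / normc (x +i* y) = cos (atan (y / x)).
  rewrite cos_atan /=.
  have -> : x ^+ 2 + y ^+ 2 = x ^+ 2 * (1 + (y / x) ^+ 2) by field.
  by rewrite sqrtrM ?sqr_ge0// sqrtr_sqr gtr0_norm// invfM mulVKf.
have pi0 := pi_gt0 R.
rewrite /carg E /=; case: ifPn => y0.
  rewrite cosK// in_itv/=; apply/andP; split.
    by rewrite -(@atan0 R) le_atan// divr_ge0// ltW.
  by have := atan_ltpi2 (y / x); lra.
rewrite -ltNge in y0.
rewrite cosKN ?opprK//; apply/andP; split.
  by have := atan_gtNpi2 (y / x); lra.
by rewrite -(@atan0 R) le_atan// pmulr_lle0 ?invr_gt0// ltW.
Qed.

Let frechet_exp_cos_sin (P Q : R * R -> R) p (A B : R) :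
  frechet P p A (- B) -> frechet Q p B A ->
  exists a b, frechet (fun q => expR (P q) * cos (Q q)) p a (- b) /\
    frechet (fun q => expR (P q) * sin (Q q)) p b a.
Proof.
move=> HP HQ; have He := frechet_comp1 (is_derive_expR (P p)) HP.
have Hc := frechet_comp1 (is_derive_cos (Q p)) HQ.
have Hs := frechet_comp1 (is_derive_sin (Q p)) HQ.
exists (expR (P p) * (A * cos (Q p) - B * sin (Q p))),
  (expR (P p) * (A * sin (Q p) + B * cos (Q p))); split.
  by apply: frechet_eq (frechetM He Hc) => /=; ring.
by apply: frechet_eq (frechetM He Hs) => /=; ring.
Qed.

(** Near [z] the power is [exp (P + i Q)] with [P = a ln |z|] and [Q = a atan (y / x)], a pair that
    satisfies the Cauchy-Riemann equations. *)
Lemma cpow_derivable z a : 0 < complex.Re z ->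
  derivable ((fun w => cpow w a) : R[i]^o -> R[i]^o) z 1.
Proof.
case: z => x y /= x0; rewrite -[x +i* y]/(toC (x, y)).
have xn : x != 0 by rewrite gt_eqF.
have s0 : 0 < sqn (x, y) by rewrite /sqn/= ltr_wpDr ?sqr_ge0// exprn_gt0.
have sn : sqn (x, y) != 0 by rewrite gt_eqF.
pose P (q : R * R) := a / 2 * ln (sqn q).
pose Q (q : R * R) := a * atan (q.2 / q.1).
have F1 := frechet_fst (x, y); have F2 := frechet_snd (x, y).
have Fs : frechet sqn (x, y) (2 * x) (2 * y).
  by apply: frechet_eq (frechetD (frechetM F1 F1) (frechetM F2 F2)) => /=; ring.
have FP : frechet P (x, y) (a * x / sqn (x, y)) (- (- a * y / sqn (x, y))).
  have Hl := frechet_comp1 (is_derive1_ln s0) Fs.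
  by apply: frechet_eq (frechetM (frechet_cst (a / 2) (x, y)) Hl) => /=; field.
have FQ : frechet Q (x, y) (- a * y / sqn (x, y)) (a * x / sqn (x, y)).
  have Hi : frechet (fun q : R * R => q.1^-1) (x, y) (- x ^- 2) 0.
    have := @frechet_comp1 _ (@GRing.inv R) fst (x, y) _ _ _
      (is_deriveV xn (is_derive_id x 1)) F1.
    by apply: frechet_eq; rewrite ?mulr0// mulr1 /GRing.scale/= mulr1.
  have Hq := frechetM F2 Hi.
  have Ha := frechet_comp1 (is_derive1_atan _) Hq.
  have kE : (1 + (y / x) ^+ 2)^-1 = x ^+ 2 / sqn (x, y).
    by rewrite -[x ^+ 2 / _]invf_div; congr (_^-1); rewrite /sqn/=; field.
  apply: frechet_eq (frechetM (frechet_cst a (x, y)) Ha) => /=; rewrite kE;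
    by move: (sqn (x, y)) sn => s sn; field; rewrite sn xn.
have [u [v [Hu Hv]]] := frechet_exp_cos_sin FP FQ.
(* Within this distance the real part stays positive, so that [carg_atan] applies. *)
have near q : norm1 (x, y) q <= x / 2 ->
    cpow (toC q) a = (expR (P q) * cos (Q q)) +i* (expR (P q) * sin (Q q)).
  move=> hq; have q0 : 0 < q.1.
    have : `|q.1 - x| <= x / 2 by apply: le_trans hq; rewrite /norm1/= lerDl.
    by rewrite ler_norml => /andP[]; lra.
  have sq0 : 0 < sqn q by rewrite /sqn/= ltr_wpDr ?sqr_ge0// exprn_gt0.
  have -> : expR (P q) = normc (toC q) `^ a.
    rewrite -[normc (toC q)]/(Num.sqrt (sqn q)) -powR12_sqrt ?ltW// -powRrM.
    by rewrite /powR gt_eqF// /P [2^-1 * a]mulrC.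
  rewrite /cpow -[toC q]/(q.1 +i* q.2) carg_atan//.
  by rewrite -/(Q q); simpc.
have x2 : 0 < x / 2 by rewrite divr_gt0.
apply: (frechet_derivable (a := u) (b := v)).
  by apply: frechet_ext x2 _ Hu => q /near; rewrite /re_part /comp => ->.
by apply: frechet_ext x2 _ Hv => q /near; rewrite /im_part /comp => ->.
Qed.

End ComplexPower.

(** * Continuous partial derivatives give differentiability *)

Section ContinuousPartials.
Context {R : realType}.
Implicit Types (p q : R * R).

Lemma mean_value_estimate (g g' : R -> R) (a b l e : R) :
  (forall x, Num.min a b <= x <= Num.max a b -> is_derive x 1 g (g' x)) ->
  (forall x, Num.min a b <= x <= Num.max a b -> `|g' x - l| <= e) ->
  `|g b - g a - l * (b - a)| <= e * `|b - a|.
Proof.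
have main (c d : R) : c <= d -> (forall x, c <= x <= d -> is_derive x 1 g (g' x)) ->
    (forall x, c <= x <= d -> `|g' x - l| <= e) ->
    `|g d - g c - l * (d - c)| <= e * `|d - c|.
  move=> cd dg He.
  have [x xcd ->] : exists2 x, x \in `[c, d] & g d - g c = g' x * (d - c).
    apply: MVT_segment => // [x|].
      by rewrite in_itv/= => /andP[cx xd]; apply: dg; rewrite !ltW.
    apply: continuous_in_subspaceT => x /[!inE]/=; rewrite in_itv/= => /dg gx.
    by apply: differentiable_continuous; apply/derivable1_diffP; exact: ex_derive.
  rewrite -mulrBl normrM ler_wpM2r//; apply: He.
  by move: xcd; rewrite in_itv.
have [ab|ba] := leP a b; move=> dg He.
  exact: main.
have := main b a (ltW ba) dg He.
rewrite -normrN opprB [`|a - b|]distrC; congr (`|_| <= _); ring.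
Qed.

Lemma continuous_norm1 (u : R * R -> R) p : {for p, continuous u} ->
  forall e, 0 < e -> exists2 d, 0 < d & forall q, norm1 p q <= d -> `|u q - u p| <= e.
Proof.
move=> /cvgrPdist_le H e /H /nbhs_ballP[d /= d0 {}H].
exists (d / 2); first by rewrite divr_gt0.
move=> q qd; rewrite distrC; apply: H.
have h1 := normr_ge0 (q.1 - p.1); have h2 := normr_ge0 (q.2 - p.2).
move: qd; rewrite /norm1 => qd.
by split; rewrite /ball/= distrC; lra.
Qed.

(** From [p] one reaches [q] through [(p.1, q.2)]. On each leg the mean value theorem and the
    continuity of one partial derivative at [p] give the estimate, and the two errors add up in the
    sum norm. *)
Lemma frechet_partials (u ux uy : R * R -> R) p (d : R) : 0 < d ->
  (forall q, norm1 p q <= d -> is_derive q.1 1 (fun x => u (x, q.2)) (ux q)) ->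
  (forall q, norm1 p q <= d -> is_derive q.2 1 (fun y => u (q.1, y)) (uy q)) ->
  {for p, continuous ux} -> {for p, continuous uy} -> frechet u p (ux p) (uy p).
Proof.
move=> d0 Hx Hy cx cy e e0.
have [d1 d10 H1] := continuous_norm1 cx e0; have [d2 d20 H2] := continuous_norm1 cy e0.
exists (Num.min d (Num.min d1 d2)); first by rewrite !lt_min d0 d10.
move=> q; rewrite !le_min => /and3P[qd qd1 qd2].
have btw (a b x : R) : Num.min a b <= x <= Num.max a b -> `|x - a| <= `|b - a|.
  case: (leP a b) => ab /andP[h1 h2].
    by rewrite ger0_norm ?ger0_norm; lra.
  by rewrite ler0_norm ?ler0_norm; lra.
have nx x : Num.min p.1 q.1 <= x <= Num.max p.1 q.1 -> norm1 p (x, q.2) <= norm1 p q.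
  by move=> /btw h; rewrite /norm1/= lerD2r.
have ny y : Num.min p.2 q.2 <= y <= Num.max p.2 q.2 -> norm1 p (p.1, y) <= norm1 p q.
  by move=> /btw h; rewrite /norm1/= subrr normr0 add0r (le_trans h)// lerDr.
have E1 : `|u (q.1, q.2) - u (p.1, q.2) - ux p * (q.1 - p.1)| <= e * `|q.1 - p.1|.
  apply: (@mean_value_estimate (fun x => u (x, q.2)) (fun x => ux (x, q.2))) => x /nx xq.
    by apply: (Hx (x, q.2)); exact: le_trans xq qd.
  by apply: H1; exact: le_trans xq qd1.
have E2 : `|u (p.1, q.2) - u (p.1, p.2) - uy p * (q.2 - p.2)| <= e * `|q.2 - p.2|.
  apply: (@mean_value_estimate (fun y => u (p.1, y)) (fun y => uy (p.1, y))) => y /ny yq.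
    by apply: (Hy (p.1, y)); exact: le_trans yq qd.
  by apply: H2; exact: le_trans yq qd2.
rewrite -!surjective_pairing in E1 E2.
rewrite [X in `|X|](_ : _ = (u q - u (p.1, q.2) - ux p * (q.1 - p.1)) +
  (u (p.1, q.2) - u p - uy p * (q.2 - p.2))); last by ring.
apply: le_trans (ler_normD _ _) _.
by rewrite [e * _]mulrDr lerD.
Qed.

Lemma is_derive_ex (u : R * R -> R) p : derivable u p ex ->
  is_derive p.1 1 (fun x => u (x, p.2)) ('D_ex u p).
Proof.
move=> du.
have E : (fun h : R => h^-1 *: (((fun x => u (x, p.2)) \o shift p.1) (h *: 1) - u (p.1, p.2))) =
    (fun h : R => h^-1 *: ((u \o shift p) (h *: ex) - u p)).
  apply/funext => h; rewrite -surjective_pairing; congr (_ *: (_ - _)) => /=.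
  by congr u; rewrite /ex; congr (_, _); rewrite /= [_ *: 0]mulr0 add0r.
by apply: DeriveDef; rewrite /derivable /derive E.
Qed.

Lemma is_derive_ey (u : R * R -> R) p : derivable u p ey ->
  is_derive p.2 1 (fun y => u (p.1, y)) ('D_ey u p).
Proof.
move=> du.
have E : (fun h : R => h^-1 *: (((fun y => u (p.1, y)) \o shift p.2) (h *: 1) - u (p.1, p.2))) =
    (fun h : R => h^-1 *: ((u \o shift p) (h *: ey) - u p)).
  apply/funext => h; rewrite -surjective_pairing; congr (_ *: (_ - _)) => /=.
  by congr u; rewrite /ey; congr (_, _); rewrite /= [_ *: 0]mulr0 add0r.
by apply: DeriveDef; rewrite /derivable /derive E.
Qed.

Lemma C1_frechet (u : R * R -> R) p : C1_on disk2 u -> disk2 p ->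
  frechet u p ('D_ex u p) ('D_ey u p).
Proof.
move=> C1 pD; have [d d0 Hd] := disk2_open pD.
have [_ _ cx cy] := C1 p pD.
apply: (@frechet_partials u ('D_ex u) ('D_ey u) p d d0 _ _ cx cy) => q /Hd/C1[_ [dx dy] _ _].
  exact: is_derive_ex.
exact: is_derive_ey.
Qed.

End ContinuousPartials.

(** * Harmonic conjugates *)

Section HarmonicConjugate.
Context {R : realType}.
Notation lambda := (@lebesgue_measure R).

(** The oriented integral from 0 to [x]; [sint] vanishes when its bounds are in the wrong order, so
    the sign is put in by hand. *)
Definition oint (f : R -> R) (x : R) : R :=
  if 0 <= x then sint f 0 x else - sint f x 0.

(** Whatever the sign of its argument, [oint f] is the integral from [- r] minus a constant, so the
    fundamental theorem of calculus applies, also at 0. *)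
Lemma is_derive_oint (f : R -> R) (r x : R) : - r < x < r -> cont_on f (- r) r ->
  is_derive x 1 (oint f) (f x).
Proof.
move=> /andP[rx xr] cf; have r0 : 0 < r by lra.
have r00 : - r <= 0 by lra.
have oE (y : R) : - r < y < r -> sint f (- r) y - sint f (- r) 0 = oint f y.
  move=> /andP[ry yr]; rewrite /oint; case: (leP 0 y) => y0.
    rewrite (sint_cat r00 y0); last by apply: cont_on_sub cf => //; exact: ltW.
    by rewrite addrAC subrr add0r.
  rewrite (sint_cat (ltW ry) (ltW y0)); last by apply: cont_on_sub cf => //; exact: ltW.
  by rewrite opprD addrA subrr add0r.
have [dF F'] := @continuous_FTC1_closed R f (- r) x r xr (cont_on_integrable cf) rx
  (cf _ (introT andP (conj (ltW rx) (ltW xr)))).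
have hF : is_derive x 1 (fun y => sint f (- r) y) (f x).
  by apply: DeriveDef; [exact: dF|rewrite -derive1E].
have hFc : is_derive x 1 (fun y => sint f (- r) y - sint f (- r) 0) (f x).
  by apply: is_derive_eq; rewrite subr0.
apply: near_eq_is_derive hFc.
have : x \in `]- r, r[ by rewrite in_itv/= rx.
move=> /near_in_itvoo; apply: filterS => y; rewrite in_itv/=; exact: oE.
Qed.

(** Goursat's theorem on the rectangle with opposite corners [(0, 0)] and [(x, y)]: the two paths
    along its sides agree, in each of the four quadrants. *)
Lemma oint_exchange (P Q : R * R -> R) (x y : R) :
  (forall p, `|p.1| <= `|x| -> `|p.2| <= `|y| -> exists a b c, frechet P p a b /\ frechet Q p b c) ->
  oint (fun s => P (s, 0)) x + oint (fun t => Q (x, t)) y =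
  oint (fun t => Q (0, t)) y + oint (fun s => P (s, y)) x.
Proof.
move=> H.
pose z : rect := ((Num.min 0 x, Num.max 0 x), (Num.min 0 y, Num.max 0 y)).
have btw (a s : R) : Num.min 0 a <= s <= Num.max 0 a -> `|s| <= `|a|.
  case: (leP 0 a) => a0 /andP[h1 h2].
    by rewrite ger0_norm ?ger0_norm; lra.
  by rewrite ler0_norm ?ler0_norm; lra.
have wz : wf_rect z by split; rewrite /= ge_min le_max lexx.
have cz : closed_on P Q z by move=> p [/btw h1 /btw h2]; exact: H.
have := goursat wz cz; rewrite /circulation /oint /=.
by case: (leP 0 x) => hx; case: (leP 0 y) => hy; lra.
Qed.

(** The conjugate [v] integrates [- u_y dx + u_x dy] from the origin, a form that the Laplace
    equation makes closed. Its [y]-derivative is read off the path that ends vertically and its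
    [x]-derivative off the one that ends horizontally. *)
Lemma harmonic_re_part (u : R * R -> R) : real_harmonic_on disk2 u ->
  exists f : R[i] -> R[i], holomorphic_on disk f /\ re_part f = u.
Proof.
move=> [[C1u C1x C1y] Lap].
pose P p := - 'D_ey u p; pose Q p := 'D_ex u p.
have PQ p : disk2 p -> exists a b c, frechet P p a b /\ frechet Q p b c.
  move=> pD; exists (- 'D_ex ('D_ey u) p), (- 'D_ey ('D_ey u) p), ('D_ey ('D_ex u) p); split.
    by apply: frechetN; exact: C1_frechet.
  apply: frechet_eq (C1_frechet C1x pD) => //.
  by apply/eqP; rewrite -addr_eq0; apply/eqP; exact: Lap.
(* With a point, the disk contains the whole rectangle on which Goursat's theorem is used. *)
have D2 (x y s t : R) : `|s| <= `|x| -> `|t| <= `|y| -> disk2 (x, y) -> disk2 (s, t).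
  move=> sx ty; rewrite disk2E /= /sqn/=; apply: le_lt_trans.
  by rewrite -[s ^+ 2]real_normK ?num_real// -[t ^+ 2]real_normK ?num_real//
    -[x ^+ 2]real_normK ?num_real// -[y ^+ 2]real_normK ?num_real// lerD// lerXn2r ?nnegrE.
pose v p := oint (fun s => P (s, 0)) p.1 + oint (fun t => Q (p.1, t)) p.2.
have vE p : disk2 p -> v p = oint (fun t => Q (0, t)) p.2 + oint (fun s => P (s, p.2)) p.1.
  move=> pD; apply: oint_exchange => q q1 q2; apply: PQ; rewrite [q]surjective_pairing.
  by apply: (D2 p.1 p.2) => //; rewrite -surjective_pairing.
(* To differentiate at [y], the segment must extend beyond it: [r ^ 2] is the mean of [y ^ 2] and
   [1 - x ^ 2]. *)
have room (x y : R) : x ^+ 2 + y ^+ 2 < 1 -> exists2 r, - r < y < r &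
    forall t, - r <= t <= r -> x ^+ 2 + t ^+ 2 < 1.
  move=> xy; have h0 : 0 <= (y ^+ 2 + (1 - x ^+ 2)) / 2.
    by have := sqr_ge0 y; lra.
  exists (Num.sqrt ((y ^+ 2 + (1 - x ^+ 2)) / 2)).
    rewrite -ltr_norml -sqrtr_sqr ltr_sqrt; first by lra.
    by have := sqr_ge0 y; lra.
  move=> t; rewrite -ler_norml -sqrtr_sqr ler_sqrt// => h; lra.
have vy p : disk2 p -> is_derive p.2 1 (fun y => v (p.1, y)) (Q p).
  rewrite disk2E => pD; have [r pr Hr] := room p.1 p.2 pD.
  have cQ : cont_on (fun t => Q (p.1, t)) (- r) r.
    move=> t tr; have [|a [b [c [_ HQ]]]] := PQ (p.1, t).
      by rewrite disk2E; exact: Hr.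
    exact: (frechet_continuous_snd HQ).
  have := is_derive_oint pr cQ; rewrite -surjective_pairing => h.
  by rewrite /v /=; apply: is_derive_eq; rewrite add0r ?mul1r.
have vx p : disk2 p -> is_derive p.1 1 (fun x => v (x, p.2)) (P p).
  move=> pD; have [d d0 Hd] := disk2_open pD.
  move: (pD); rewrite disk2E => /= pD'.
  have [|r pr Hr] := room p.2 p.1; first by rewrite addrC.
  have cP : cont_on (fun s => P (s, p.2)) (- r) r.
    move=> t tr; have [|a [b [c [HP _]]]] := PQ (t, p.2).
      by rewrite disk2E /= /sqn addrC; exact: Hr.
    exact: (frechet_continuous_fst HP).
  have := is_derive_oint pr cP; rewrite -surjective_pairing => h.
  have h' : is_derive p.1 1 (fun x => oint (fun t => Q (0, t)) p.2 + oint (fun s => P (s, p.2)) x) (P p).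
    by apply: is_derive_eq; rewrite add0r ?mul1r.
  apply: near_eq_is_derive h'.
  have : p.1 \in `](- r), r[ by rewrite in_itv.
  move=> /near_in_itvoo; apply: filterS => x; rewrite in_itv/= => /andP[rx xr].
  by rewrite vE// disk2E /= /sqn addrC; apply: Hr; rewrite !ltW.
pose f (w : R[i]) : R[i] := u (complex.Re w, complex.Im w) +i* v (complex.Re w, complex.Im w).
have fr : re_part f = u by apply/funext => -[].
have fi : im_part f = v by apply/funext => -[].
exists f; split => // w wD.
rewrite -[w](_ : toC (complex.Re w, complex.Im w) = w); last by case: w {wD}.
have : disk2 (complex.Re w, complex.Im w) by rewrite /disk2/=; case: w wD.
move: (complex.Re w, complex.Im w) => {wD}p pD.
have [d d0 Hd] := disk2_open pD; have [_ _ cx cy] := C1u p pD.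
apply: (@frechet_derivable _ f p ('D_ex u p) (- 'D_ey u p)).
  by rewrite fr opprK; exact: C1_frechet.
have cP : {for p, continuous P} by apply: cvgN; exact: cy.
rewrite fi; apply: (@frechet_partials _ v P Q p d d0 _ _ cP cx) => q /Hd.
  exact: vx.
exact: vy.
Qed.

End HarmonicConjugate.

(** * Complex integrals and the Bergman space *)

Section SquareIntegrable.
Context {R : realType} {gamma : R} (hgamma : -1 < gamma).
Local Notation mu := (dA_ hgamma).
Local Notation D2 := (@disk2 R).
Implicit Types (F G f g h : R[i] -> R[i]).

Definition abs2 F (p : plane R) : R := normc (F (toC p)) ^+ 2.

Definition cintegrable F :=
  mu.-integrable D2 (EFin \o (re_part F : plane R -> R)) /\
  mu.-integrable D2 (EFin \o (im_part F : plane R -> R)).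

Lemma abs2E F p : abs2 F p = re_part F p ^+ 2 + im_part F p ^+ 2.
Proof.
rewrite /abs2 /re_part /im_part /=; case: (F _) => a b /=.
by rewrite sqr_sqrtr// addr_ge0 ?sqr_ge0.
Qed.

Lemma abs2_ge0 F p : 0 <= abs2 F p. Proof. exact: sqr_ge0. Qed.

Lemma abs2M F G p : abs2 (fun w => F w * G w) p = abs2 F p * abs2 G p.
Proof. by rewrite /abs2 normcM exprMn. Qed.

Lemma normc_sqr (z : R[i]) : normc z ^+ 2 = complex.Re z ^+ 2 + complex.Im z ^+ 2.
Proof. by case: z => a b /=; rewrite sqr_sqrtr// addr_ge0 ?sqr_ge0. Qed.

Lemma normcD_sqr (z w : R[i]) : normc (z + w) ^+ 2 <= 2 * normc z ^+ 2 + 2 * normc w ^+ 2.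
Proof.
rewrite !normc_sqr; case: z => a b; case: w => c d /=.
have := sqr_ge0 (a - c); have := sqr_ge0 (b - d).
by rewrite !sqrrB !sqrrD; lra.
Qed.

Lemma cmeasurable_abs2 F : cmeasurable_on disk F -> measurable_fun D2 (abs2 F).
Proof.
move=> [m1 m2].
rewrite (_ : abs2 F = fun p => re_part F p ^+ 2 + im_part F p ^+ 2); last first.
  by apply/funext => p; exact: abs2E.
by apply: measurable_funD; apply: measurable_funX.
Qed.

Lemma cmeasurableM F G : cmeasurable_on disk F -> cmeasurable_on disk G ->
  cmeasurable_on disk (fun w => F w * G w).
Proof.
move=> [f1 f2] [g1 g2]; split.
  rewrite (_ : _ \o _ = fun p : plane R => re_part F p * re_part G p - im_part F p * im_part G p).
    by apply: measurable_funB; apply: measurable_funM.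
  apply/funext => p; rewrite /re_part /im_part /=.
  by case: (F _) => a b; case: (G _).
rewrite (_ : _ \o _ = fun p : plane R => re_part F p * im_part G p + im_part F p * re_part G p).
  by apply: measurable_funD; apply: measurable_funM.
apply/funext => p; rewrite /re_part /im_part /=.
by case: (F _) => a b; case: (G _).
Qed.

Lemma cmeasurable_conj F : cmeasurable_on disk F -> cmeasurable_on disk (fun w => (F w)^*).
Proof.
move=> [f1 f2]; split.
  rewrite (_ : _ \o _ = re_part F)//.
  by apply/funext => p; rewrite /re_part /=; case: (F _).
rewrite (_ : _ \o _ = fun p : plane R => - im_part F p); first exact: measurable_funN.
by apply/funext => p; rewrite /im_part /=; case: (F _).
Qed.

Lemma holomorphic_cmeasurable F : holomorphic_on disk F -> cmeasurable_on disk F.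
Proof. exact: holomorphic_measurable. Qed.

Lemma cintegrable_le F (G : plane R -> R) : cmeasurable_on disk F ->
  mu.-integrable D2 (EFin \o G) ->
  (forall p, D2 p -> normc (F (toC p)) <= G p) -> cintegrable F.
Proof.
move=> [m1 m2] iG FG.
have n0 p : 0 <= normc (F (toC p)) by case: (F _) => a b; rewrite sqrtr_ge0.
have le_re p : D2 p -> (`|(re_part F p)%:E| <= `|(G p)%:E|)%E.
  move=> /FG h; rewrite !abse_EFin lee_fin.
  rewrite (le_trans _ (ler_norm _))// (le_trans _ h)//.
  by rewrite -ler_sqr ?nnegrE// real_normK ?num_real// normc_sqr lerDl sqr_ge0.
have le_im p : D2 p -> (`|(im_part F p)%:E| <= `|(G p)%:E|)%E.
  move=> /FG h; rewrite !abse_EFin lee_fin.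
  rewrite (le_trans _ (ler_norm _))// (le_trans _ h)//.
  by rewrite -ler_sqr ?nnegrE// real_normK ?num_real// normc_sqr lerDr sqr_ge0.
have mD := @measurable_disk2 R.
split.
  by apply: (le_integrable mD _ le_re iG); exact/measurable_EFinP.
by apply: (le_integrable mD _ le_im iG); exact/measurable_EFinP.
Qed.

Lemma eq_cintegral F G : (forall w, disk w -> F w = G w) ->
  cintegral mu disk F = cintegral mu disk G.
Proof.
move=> FG; rewrite /cintegral; congr (_ +i* _); apply: eq_Rintegral => p;
  by rewrite inE => pD /=; rewrite FG.
Qed.

Lemma cintegralB F G : cintegrable F -> cintegrable G ->
  cintegral mu disk (fun w => F w - G w) = cintegral mu disk F - cintegral mu disk G.
Proof.
move=> [f1 f2] [g1 g2]; have mD := @measurable_disk2 R.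
rewrite /cintegral -[RHS]/((_ - _) +i* (_ - _)); congr (_ +i* _).
  rewrite -(RintegralB mD f1 g1); apply: eq_Rintegral => p _ /=.
  by rewrite /re_part/=; case: (F _) => a b; case: (G _).
rewrite -(RintegralB mD f2 g2); apply: eq_Rintegral => p _ /=.
by rewrite /im_part/=; case: (F _) => a b; case: (G _).
Qed.

Lemma cintegralD F G : cintegrable F -> cintegrable G ->
  cintegral mu disk (fun w => F w + G w) = cintegral mu disk F + cintegral mu disk G.
Proof.
move=> [f1 f2] [g1 g2]; have mD := @measurable_disk2 R.
rewrite /cintegral -[RHS]/((_ + _) +i* (_ + _)); congr (_ +i* _).
  rewrite -(RintegralD mD f1 g1); apply: eq_Rintegral => p _ /=.
  by rewrite /re_part/=; case: (F _) => a b; case: (G _).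
rewrite -(RintegralD mD f2 g2); apply: eq_Rintegral => p _ /=.
by rewrite /im_part/=; case: (F _) => a b; case: (G _).
Qed.

Lemma cintegrableD F G : cintegrable F -> cintegrable G -> cintegrable (fun w => F w + G w).
Proof.
move=> [f1 f2] [g1 g2]; have mD := @measurable_disk2 R; split.
  have := integrableD mD f1 g1; congr (_.-integrable _ _); apply/funext => p /=.
  by rewrite -EFinD; congr (_%:E); rewrite /re_part /=; case: (F _) => a b; case: (G _).
have := integrableD mD f2 g2; congr (_.-integrable _ _); apply/funext => p /=.
by rewrite -EFinD; congr (_%:E); rewrite /im_part /=; case: (F _) => a b; case: (G _).
Qed.

Lemma cintegrable_conj F : cintegrable F -> cintegrable (fun w => (F w)^*).
Proof.
move=> [f1 f2]; have mD := @measurable_disk2 R; split.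
  rewrite (_ : re_part _ = re_part F)//.
  by apply/funext => p; rewrite /re_part /=; case: (F _).
rewrite (_ : EFin \o _ = (fun p => - ((EFin \o (im_part F : plane R -> R)) p))%E); last first.
  by apply/funext => p; rewrite /im_part /=; case: (F _).
exact: integrableN.
Qed.

Lemma cintegral_conj F : cintegrable F ->
  cintegral mu disk (fun w => (F w)^*) = (cintegral mu disk F)^*.
Proof.
move=> [f1 f2]; have mD := @measurable_disk2 R.
rewrite /cintegral -[RHS]/(_ +i* (- _)); congr (_ +i* _).
  by apply: eq_Rintegral => p _ /=; case: (F _).
rewrite -mulN1r -(RintegralZl (-1) mD f2); apply: eq_Rintegral => p _ /=.
by rewrite /im_part mulN1r/=; case: (F _).
Qed.

Lemma integral_dA_1 : (\int[mu]_(p in D2) 1 = 1)%E.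
Proof.
rewrite (ge0_integral_dA_polar hgamma (f := cst 1%E))//.
rewrite -[RHS](integral_radial_weight hgamma); apply: eq_integral => s _.
rewrite [RHS]EFinM; congr (_ * _)%E.
rewrite [X in integral _ _ X](_ : _ = cst (2%:E)); last first.
  by apply/funext => t; rewrite /cst -EFinD.
rewrite integral_cst// /= lebesgue_measure_itv/= lte_fin ifT; last first.
  by have := pi_gt0 R; lra.
by rewrite -EFinB -EFinM; congr (_%:E); field.
Qed.

Lemma A2_integrable f : A2 hgamma f -> mu.-integrable D2 (EFin \o abs2 f).
Proof.
move=> [_ [mf foo]]; apply/integrableP; split.
  by apply/measurable_EFinP; exact: cmeasurable_abs2.
apply: le_lt_trans foo; rewrite le_eqVlt; apply/orP; left; apply/eqP.
by apply: eq_integral => p _ /=; rewrite ger0_norm// abs2_ge0.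
Qed.

Lemma A2_le f (G : plane R -> R) : holomorphic_on disk f ->
  mu.-integrable D2 (EFin \o G) -> (forall p, D2 p -> abs2 f p <= G p) -> A2 hgamma f.
Proof.
move=> hf iG fG; have mf := holomorphic_cmeasurable hf.
split => //; split => //; case/integrableP: iG => mG; apply: le_lt_trans.
have mD := @measurable_disk2 R.
apply: ge0_le_integral => //.
- by move=> p _; rewrite lee_fin abs2_ge0.
- by apply/measurable_EFinP; exact: cmeasurable_abs2.
- by apply: measurableT_comp mG.
- by move=> p pD; rewrite /= lee_fin (le_trans (fG p pD))// ler_norm.
Qed.

Lemma A2_add f g : A2 hgamma f -> A2 hgamma g -> A2 hgamma (fun w => f w + g w).
Proof.
move=> Af Ag; have mD := @measurable_disk2 R.
apply: (A2_le (G := fun p => 2 * abs2 f p + 2 * abs2 g p)).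
- by move=> w wD; apply: derivableD; [exact: Af.1|exact: Ag.1].
- have := integrableD mD (integrableZl mD 2 (A2_integrable Af)) (integrableZl mD 2 (A2_integrable Ag)).
  by congr (_.-integrable _ _).
- by move=> p _; exact: normcD_sqr.
Qed.

Lemma A2_mul_bounded f h (B : R) : A2 hgamma f -> holomorphic_on disk h ->
  (forall p, D2 p -> abs2 h p <= B) -> A2 hgamma (fun w => f w * h w).
Proof.
move=> Af hh hB; have mD := @measurable_disk2 R.
apply: (A2_le (G := fun p => B * abs2 f p)).
- by move=> w wD; apply: derivableM; [exact: Af.1|exact: hh].
- have := integrableZl mD B (A2_integrable Af).
  by congr (_.-integrable _ _).
- by move=> p pD; rewrite abs2M mulrC ler_wpM2r ?abs2_ge0// hB.
Qed.

Lemma A2_cst (c : R[i]) : A2 hgamma (fun=> c).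
Proof.
have mD := @measurable_disk2 R.
apply: (A2_le (G := cst (normc c ^+ 2))) => //.
apply/integrableP; split; first exact/measurable_EFinP.
rewrite (eq_integral (fun p => (`|normc c ^+ 2|)%:E * cst 1%E p)%E); last first.
  by move=> p _; rewrite /= mule1.
rewrite ge0_integralZl//.
by rewrite [X in (_ * X)%E](integral_dA_1) mule1 ltry.
Qed.

(** The inequality [|f| |g| <= |f|^2 + |g|^2] provides an integrable bound. *)
Lemma cintegrable_mul f g : A2 hgamma f -> A2 hgamma g ->
  cintegrable (fun w => f w * (g w)^*).
Proof.
move=> Af Ag; have mD := @measurable_disk2 R.
apply: (cintegrable_le (G := fun p => abs2 f p + abs2 g p)).
- by apply: cmeasurableM; [exact: Af.2.1|apply: cmeasurable_conj; exact: Ag.2.1].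
- have := integrableD mD (A2_integrable Af) (A2_integrable Ag).
  by congr (_.-integrable _ _).
- move=> p _; rewrite normcM.
  have -> : normc (g (toC p))^* = normc (g (toC p)).
    by case: (g _) => a b /=; rewrite sqrrN.
  rewrite /abs2; set x := normc _; set y := normc _.
  by have := sqr_ge0 (x - y); have := sqr_ge0 (x + y); rewrite sqrrB sqrrD; lra.
Qed.

End SquareIntegrable.

(** * The normalized kernel *)

Section Kernel.
Context {R : realType} {gamma : R} (hgamma : -1 < gamma).
Variables (xi : R[i]) (xiD : disk xi).
Local Notation k := (@normalized_kernel R gamma xi).
Local Notation mu := (dA_ hgamma).
Local Notation D2 := (@disk2 R).

Let xin : R := normc xi.

Let normc_ge0 (z : R[i]) : 0 <= normc z.
Proof. by case: z => a b; rewrite sqrtr_ge0. Qed.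

Let Re_le_normc (z : R[i]) : complex.Re z <= normc z.
Proof.
rewrite (le_trans (ler_norm _))// -ler_sqr ?nnegrE ?normr_ge0 ?normc_ge0//.
by rewrite real_normK ?num_real// normc_sqr lerDl sqr_ge0.
Qed.

Let normcJ (z : R[i]) : normc z^* = normc z.
Proof. by case: z => a b /=; rewrite sqrrN. Qed.

Let xin_lt1 : xin < 1. Proof. exact: xiD. Qed.

Let gamma2 : 0 < gamma + 2. Proof. by move: hgamma; lra. Qed.

(** Since [|xi| < 1], the base of the power stays in a half-plane away from 0. The principal power
    is holomorphic there, and the kernel is bounded for fixed [xi]. *)
Let Re_denom w : disk w -> 1 - xin <= complex.Re (1 - xi^* * w).
Proof.
move=> wD; have h := Re_le_normc (xi^* * w).
have {h} : complex.Re (xi^* * w) <= xin.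
  rewrite (le_trans h)// normcM normcJ -[leRHS]mulr1 ler_wpM2l ?normc_ge0//.
  exact: ltW.
by case: (xi^* * w) => a b /=; lra.
Qed.

Let Re_denom_gt0 w : disk w -> 0 < complex.Re (1 - xi^* * w).
Proof. by move=> /Re_denom; apply: lt_le_trans; rewrite subr_gt0. Qed.

Let normc_denom w : disk w -> 1 - xin <= normc (1 - xi^* * w).
Proof. by move=> wD; apply: le_trans (Re_denom wD) (Re_le_normc _). Qed.

Let normc_denom_gt0 w : disk w -> 0 < normc (1 - xi^* * w).
Proof. by move=> /normc_denom; apply: lt_le_trans; rewrite subr_gt0. Qed.

Let cpow_neq0 w : disk w -> cpow (1 - xi^* * w) (gamma + 2) != 0.
Proof.
move=> /normc_denom_gt0 h; apply/eqP => /(congr1 (@normc R)).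
by rewrite normc_cpow normc0 => /eqP; rewrite gt_eqF// powR_gt0.
Qed.

Let num_gt0 : 0 < 1 - xin ^+ 2.
Proof. by rewrite subr_gt0 expr_lt1 ?normc_ge0. Qed.

Lemma kernel_neq0 w : disk w -> k w != 0.
Proof.
move=> wD; rewrite /normalized_kernel mulf_neq0// ?invr_eq0 ?cpow_neq0//.
by rewrite (inj_eq (@complexI R)) gt_eqF// powR_gt0.
Qed.

Lemma kernel_holomorphic : holomorphic_on disk k.
Proof.
move=> w wD; apply: derivableM => //; apply: derivableV; first exact: cpow_neq0.
apply/derivable1_diffP.
apply: (@differentiable_comp _ R[i]^o R[i]^o R[i]^o (fun w => 1 - xi^* * w)
  (fun z => cpow z (gamma + 2))).
  by apply/derivable1_diffP; apply: derivableB => //; exact: derivableM.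
by apply/derivable1_diffP; apply: cpow_derivable; exact: Re_denom_gt0.
Qed.

(** A single power with exponent [gamma + 2], to match the factor in [ge0_integral_dA_kelvin]. *)
Lemma kernel_abs2 (p : plane R) : D2 p ->
  abs2 k p = ((1 - xin ^+ 2) / normc (1 - xi^* * toC p) ^+ 2) `^ (gamma + 2).
Proof.
move=> pD; have d0 := normc_denom_gt0 pD.
have sq (x : R) : 0 <= x -> x `^ (gamma + 2) = (x `^ ((gamma + 2) / 2)) ^+ 2.
  by move=> x0; rewrite -powR_mulrn ?powR_ge0// -powRrM divfK.
rewrite /abs2 /normalized_kernel normcM normcV normc_cpow /= expr0n/= addr0 sqrtr_sqr.
rewrite ger0_norm ?powR_ge0// exprMn -sq ?(ltW num_gt0)// exprVn.
rewrite powRM ?invr_ge0 ?sqr_ge0 ?(ltW num_gt0)//; congr (_ * _).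
move: (normc _) d0 => d d0.
rewrite -[(d ^+ 2)^-1](powR_inv1 (sqr_ge0 d)) -powRrM mulN1r powRN; congr (_^-1).
by rewrite !expr2 powRM// ltW.
Qed.

Lemma kernel_bounded : exists B : R, forall p, D2 p -> abs2 k p <= B.
Proof.
exists (((1 - xin ^+ 2) / (1 - xin) ^+ 2) `^ (gamma + 2)) => p pD.
have x1 : 0 < 1 - xin by rewrite subr_gt0.
have d0 := normc_denom_gt0 pD.
rewrite kernel_abs2// ge0_ler_powR ?nnegrE ?(ltW gamma2)//.
- by rewrite divr_ge0 ?sqr_ge0 ?(ltW num_gt0).
- by rewrite divr_ge0 ?sqr_ge0 ?(ltW num_gt0).
- rewrite ler_wpM2l ?(ltW num_gt0)// lef_pV2 ?posrE ?exprn_gt0//.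
  by rewrite lerXn2r ?nnegrE ?(ltW x1) ?(ltW d0)// normc_denom.
Qed.

(* The inversion centred at [xi / |xi|^2] exchanges [0] and [xi], and transports
   the weighted area measure to [|k|^2] times itself. *)
Let cx : R := complex.Re xi / xin ^+ 2.
Let cy : R := complex.Im xi / xin ^+ 2.

Lemma kernel_integral (F : R[i] -> R[i]) : holomorphic_on disk F ->
  (\int[mu]_(p in D2) (`|re_part F p| * abs2 k p)%:E < +oo)%E ->
  (\int[mu]_(p in D2) (re_part F p * abs2 k p)%:E = (complex.Re (F xi))%:E)%E.
Proof.
move=> hF.
have xi_n : xin ^+ 2 = complex.Re xi ^+ 2 + complex.Im xi ^+ 2 by exact: normc_sqr.
(* For [xi = 0] the inversion has no centre, but then the kernel is 1 on the disk. *)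
have [xi0|xi0] := eqVneq (xin ^+ 2) 0.
  have xiE : xi = toC (0, 0).
    move: xi0; rewrite xi_n => /eqP; rewrite paddr_eq0 ?sqr_ge0// !sqrf_eq0.
    by case: (xi) => a b /= /andP[/eqP -> /eqP ->].
  have k1 p : D2 p -> abs2 k p = 1.
    move=> pD; rewrite kernel_abs2// xi0.
    rewrite [_ * toC p](_ : _ = 0); last first.
      by apply/eqP; rewrite xiE eq_complex /= oppr0 !mul0r addr0 subr0 eqxx.
    by rewrite !subr0 normc1 expr1n divr1 powR1.
  rewrite (eq_integral (fun p : plane R => `|re_part F p|%:E)); last first.
    by move=> p; rewrite inE => pD; rewrite k1// mulr1.
  move=> Foo; rewrite (eq_integral (fun p : plane R => (re_part F p)%:E)); last first.
    by move=> p; rewrite inE => pD; rewrite k1// mulr1.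
  by rewrite (holomorphic_integral_dA hF Foo) xiE.
have n0 : 0 < xin ^+ 2 by rewrite lt_neqAle eq_sym xi0 sqr_ge0.
have n1 : xin ^+ 2 < 1 by rewrite expr_lt1 ?normc_ge0.
have cE : cx ^+ 2 + cy ^+ 2 = (xin ^+ 2)^-1.
  rewrite /cx /cy !exprMn -mulrDl -xi_n; move: (xin ^+ 2) xi0 => n nn; field.
  exact: nn.
have kappa_gt0 : 0 < cx ^+ 2 + cy ^+ 2 - 1 by rewrite cE subr_gt0 invf_gt1.
(* With [c = xi / |xi|^2] one has [|1 - conj xi * w| = |xi| |w - c|] and [|c|^2 = 1 / |xi|^2], which
   turns the base into [kappa / |w - c|^2]. *)
have kE p : D2 p -> abs2 k p =
    ((cx ^+ 2 + cy ^+ 2 - 1) / sqn (p.1 - cx, p.2 - cy)) `^ (gamma + 2).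
  move=> pD; rewrite kernel_abs2//; congr (_ `^ _).
  have d0 : normc (1 - xi^* * toC p) ^+ 2 = xin ^+ 2 * sqn (p.1 - cx, p.2 - cy).
    rewrite normc_sqr /sqn /cx /cy /toC; move: xi0; rewrite xi_n.
    by case: (xi) => a b /= nn; field.
  have dn : sqn (p.1 - cx, p.2 - cy) != 0.
    have : normc (1 - xi^* * toC p) ^+ 2 != 0 by rewrite expf_neq0// gt_eqF// normc_denom_gt0.
    by rewrite d0 mulf_eq0 negb_or => /andP[].
  rewrite cE d0; move: (xin ^+ 2) xi0 (sqn _) dn => n nn s sn; field.
  by rewrite nn sn.
have zE : kelvin cx cy (0, 0) = (complex.Re xi, complex.Im xi).
  rewrite /kelvin /sqn /= !sub0r !sqrrN cE /cx /cy.
  by move: (xin ^+ 2) xi0 => n nn; congr (_, _); field.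
rewrite (eq_integral (fun p : plane R => (`|re_part F p| * ((cx ^+ 2 + cy ^+ 2 - 1) /
  sqn (p.1 - cx, p.2 - cy)) `^ (gamma + 2))%:E)); last first.
  by move=> p; rewrite inE => pD; rewrite kE.
move=> Foo; rewrite (eq_integral (fun p : plane R => (re_part F p * ((cx ^+ 2 + cy ^+ 2 - 1) /
  sqn (p.1 - cx, p.2 - cy)) `^ (gamma + 2))%:E)); last first.
  by move=> p; rewrite inE => pD; rewrite kE.
rewrite (holomorphic_integral_moebius kappa_gt0 hF Foo) zE.
by rewrite /re_part /=; case: (xi).
Qed.

End Kernel.

(** * The projection and the Berezin transform *)

Section Reproducing.
Context {R : realType} {gamma : R} (hgamma : -1 < gamma).
Local Notation mu := (dA_ hgamma).
Local Notation D2 := (@disk2 R).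
Local Notation lambda := (@lebesgue_measure R).
Local Notation J := (`](- (pi / 2))%R, (pi / 2)%R[%classic : set R).

(** [kernel_integral] concerns real parts, and the imaginary part of [F] is the real part of
    [- i F]. The bound [G] supplies the integrability. *)
Lemma kernel_reproducing (xi : R[i]) (F : R[i] -> R[i]) (G : plane R -> R) : disk xi ->
  holomorphic_on disk F -> mu.-integrable D2 (EFin \o G) ->
  (forall p, D2 p -> normc (F (toC p)) * abs2 (@normalized_kernel R gamma xi) p <= G p) ->
  let FK := fun w => F w * (@normalized_kernel R gamma xi w * (@normalized_kernel R gamma xi w)^*) in
  cintegrable hgamma FK /\ cintegral mu disk FK = F xi.
Proof.
set k := @normalized_kernel R gamma xi => xiD hF iG FG FK.
have hk : holomorphic_on disk k by exact: kernel_holomorphic.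
have mk := holomorphic_cmeasurable hk.
have kk w : k w * (k w)^* = (normc (k w) ^+ 2)%:C.
  by rewrite normc_sqr; case: (k w) => a b; simpc; congr (_ +i* _); ring.
have reE (H : R[i] -> R[i]) p : re_part (fun w => H w * (k w * (k w)^*)) p = re_part H p * abs2 k p.
  by rewrite /re_part /abs2 /comp kk; case: (H _) => a b /=; rewrite mulr0 subr0.
have imE p : im_part FK p = im_part F p * abs2 k p.
  by rewrite /im_part /abs2 /FK /comp kk; case: (F _) => a b /=; rewrite mulr0 add0r.
have iFK : cintegrable hgamma FK.
  apply: (cintegrable_le _ iG).
    apply: cmeasurableM; first exact: holomorphic_cmeasurable.
    by apply: cmeasurableM => //; exact: cmeasurable_conj.
  move=> p /FG; rewrite normcM kk; congr (_ * _ <= _).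
  by rewrite /= expr0n/= addr0 sqrtr_sqr ger0_norm// sqr_ge0.
split => //.
have reI (H : R[i] -> R[i]) : holomorphic_on disk H ->
    mu.-integrable D2 (EFin \o (re_part (fun w => H w * (k w * (k w)^*)) : plane R -> R)) ->
    Rintegral mu D2 (re_part (fun w => H w * (k w * (k w)^*)) : plane R -> R) = complex.Re (H xi).
  move=> hH iH; rewrite /Rintegral.
  rewrite (eq_integral (fun p : plane R => (re_part H p * abs2 k p)%:E)); last first.
    by move=> p _; rewrite reE.
  rewrite (kernel_integral xiD hH)//.
  case/integrableP : iH => _; apply: le_lt_trans.
  rewrite le_eqVlt; apply/orP; left; apply/eqP; apply: eq_integral => p _ /=.
  by rewrite reE normrM [`|abs2 _ _|]ger0_norm// abs2_ge0.
have hNi : holomorphic_on disk (fun w => F w * - 'i).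
  by move=> w wD; apply: derivableM => //; exact: hF.
have imF H p : im_part H p = re_part (fun w => H w * - 'i) p.
  by rewrite /im_part /re_part /comp; case: (H _) => a b /=; ring.
have E : (re_part (fun w => F w * - 'i * (k w * (k w)^*)) : plane R -> R) = im_part FK.
  by apply/funext => p; rewrite reE imE imF.
have [i1 i2] := iFK.
rewrite /cintegral.
have -> : Rintegral mu D2 (@complex.Re R \o FK \o toC) = complex.Re (F xi) by exact: reI.
have -> : Rintegral mu D2 (@complex.Im R \o FK \o toC) = complex.Im (F xi).
  have := reI _ hNi; rewrite E => /(_ i2) ->.
  by case: (F xi) => a b /=; ring.
by case: (F xi).
Qed.

Lemma integrable_bounded (u : plane R -> R) (M : R) : measurable_fun D2 u ->
  {ae mu, forall p, D2 p -> `|u p| <= M} -> (\int[mu]_(p in D2) (u p ^+ 2)%:E < +oo)%E.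
Proof.
move=> m_u aeM; have mD := @measurable_disk2 R.
have mu2 : measurable_fun D2 (EFin \o (fun p => u p ^+ 2)).
  by apply/measurable_EFinP; exact: measurable_funX.
have := @integral_le_bound _ _ _ mu D2 (EFin \o (fun p => u p ^+ 2)) (M ^+ 2)%:E mD mu2.
rewrite lee_fin sqr_ge0 => /(_ isT) H.
have {}H := H _.
apply: (@le_lt_trans _ _ ((M ^+ 2)%:E * mu D2)%E).
  rewrite (eq_integral (fun p : plane R => `|(EFin \o (fun q => (u q ^+ 2)%R)) p|%E)); last first.
    by move=> p _ /=; rewrite ger0_norm// sqr_ge0.
  apply: H; apply: filterS aeM => p uM pD; have := uM pD => h.
  rewrite /= lee_fin ger0_norm ?sqr_ge0// -real_normK ?num_real// lerXn2r ?nnegrE//.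
  exact: le_trans h.
have -> : mu D2 = 1%E.
  by rewrite -(integral_dA_1 hgamma) integral_cst// mul1e.
by rewrite mule1 ltry.
Qed.

(* The mean value property of [f ^+ 2] bounds the square mean of the imaginary
   part of [f] by that of its real part. *)
Lemma A2_of_re_part (f : R[i] -> R[i]) : holomorphic_on disk f ->
  (\int[mu]_(p in D2) (re_part f p ^+ 2)%:E < +oo)%E -> A2 hgamma f.
Proof.
move=> hf foo; have mD := @measurable_disk2 R.
have [m1 m2] := holomorphic_measurable hf.
pose u2 (p : plane R) := (re_part f p ^+ 2)%:E.
pose v2 (p : plane R) := (im_part f p ^+ 2)%:E.
have mu2 : measurable_fun D2 u2 by apply/measurable_EFinP; exact: measurable_funX.
have mv2 : measurable_fun D2 v2 by apply/measurable_EFinP; exact: measurable_funX.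
have u20 p : (0 <= u2 p)%E by rewrite lee_fin sqr_ge0.
have v20 p : (0 <= v2 p)%E by rewrite lee_fin sqr_ge0.
pose f2 w := f w * f w.
have hf2 : holomorphic_on disk f2 by move=> w wD; apply: derivableM; exact: hf.
pose c := re_part f2 (0, 0).
have nc0 : 0 <= `|c| + c by rewrite -lerBlDr sub0r -normrN ler_norm.
(* The real part of [f ^ 2] is the difference of the two squares, and [c] is its value at 0. All
   terms are kept nonnegative, because the integral of [v2] might still be infinite here. *)
have E : (\int[mu]_(p in D2) v2 p + (`|c| + c)%:E = \int[mu]_(p in D2) u2 p + `|c|%:E)%E.
  rewrite (ge0_integral_dA_slice hgamma nc0 mv2 v20).
  rewrite (ge0_integral_dA_slice hgamma (normr_ge0 c) mu2 u20).
  apply: eq_integral => s; rewrite inE/= in_itv/= => /andP[s0 s1]; congr (_ * _)%E.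
  set r := Num.sqrt s.
  have r01 : 0 < r < 1 by rewrite sqrtr_gt0 s0 -[X in _ < X]sqrtr1 ltr_sqrt.
  have pD t : disk2 (polar s t) by rewrite disk2E /= sqn_polar// ltW.
  pose fN z := f (- z).
  have hN : holomorphic_on disk fN.
    by move=> z zD; apply: derivable_compN; apply: hf; rewrite /disk/= normcN.
  have cE g : holomorphic_on disk g ->
      cont_on (fun t => re_part g (polar s t)) (- (pi / 2)) (pi / 2) /\
      cont_on (fun t => im_part g (polar s t)) (- (pi / 2)) (pi / 2).
    move=> hg; split=> t _; have [a [b [H1 H2]]] := derivable_frechet (hg _ (pD t)).
      exact: (frechet_continuous_snd (polar_frechet H1)).
    exact: (frechet_continuous_snd (polar_frechet H2)).
  have [cu cv] := cE f hf; have [cuN cvN] := cE fN hN.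
  pose U t := re_part f (polar s t) ^+ 2 + re_part fN (polar s t) ^+ 2.
  pose V t := im_part f (polar s t) ^+ 2 + im_part fN (polar s t) ^+ 2.
  have csq (g : R -> R) : cont_on g (- (pi / 2)) (pi / 2) ->
      cont_on (fun t => g t ^+ 2) (- (pi / 2)) (pi / 2).
    by move=> cg t tI; apply: (@continuous_comp _ _ _ g (fun x => x ^+ 2));
      [exact: cg|exact: exprn_continuous].
  have cU : cont_on U (- (pi / 2)) (pi / 2).
    by move=> t tI; apply: cvgD; [exact: (csq _ cu)|exact: (csq _ cuN)].
  have cV : cont_on V (- (pi / 2)) (pi / 2).
    by move=> t tI; apply: cvgD; [exact: (csq _ cv)|exact: (csq _ cvN)].
  have sliceE (W : R -> R) : cont_on W (- (pi / 2)) (pi / 2) ->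
      (\int[lambda]_(t in J) (W t)%:E = (sint W (- (pi / 2)) (pi / 2))%:E)%E.
    move=> cW; have iW := cont_on_integrable cW.
    have jW : lambda.-integrable J (EFin \o W).
      by apply: integrableS iW => //; exact: subset_itv_oo_cc.
    rewrite /sint /Rintegral fineK; last by apply: integrable_fin_num => //; exact: iW.
    rewrite [RHS](integral_itv_bndoo)//.
    exact: (measurable_int lambda jW).
  have -> : slice v2 s = (sint V (- (pi / 2)) (pi / 2))%:E by rewrite -sliceE.
  have -> : slice u2 s = (sint U (- (pi / 2)) (pi / 2))%:E by rewrite -sliceE.
  have := holomorphic_circle_mean hf2 r01; rewrite -/c => mc.
  have UV : sint (fun t => U t - V t) (- (pi / 2)) (pi / 2) = 2 * pi * c.
    rewrite -mc; apply: eq_Rintegral => t _; rewrite /U /V /re_part /im_part /comp /f2 /fN.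
    rewrite -[toC (- _, - _)]/(- toC (polar s t)) -[toC (_, _)]/(toC (polar s t)).
    by case: (f (toC _)) => a b; case: (f (- _)) => a' b' /=; ring.
  move: UV; rewrite sintB// => UV.
  by rewrite -!EFinD; congr (_%:E); rewrite mulrDr -UV; ring.
have voo : (\int[mu]_(p in D2) v2 p < +oo)%E.
  have h : (\int[mu]_(p in D2) v2 p + (`|c| + c)%:E < +oo)%E by rewrite E lte_add_pinfty// ltry.
  by apply: le_lt_trans h; rewrite leeDl// lee_fin.
split => //; split; first exact: holomorphic_cmeasurable.
rewrite (eq_integral (fun p : plane R => u2 p + v2 p)%E); last first.
  by move=> p _; rewrite -[_ ^+ 2]/(abs2 f p) abs2E.
by rewrite ge0_integralD// lte_add_pinfty.
Qed.

(** If [Re phi = Re f1] and [Im phi = Re f2], then [f = (f1 + i f2) / 2] and [g = (f1 - i f2) / 2]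
    give [f + conj g = Re f1 + i Re f2]. *)
Lemma bounded_harmonic_decomposition (phi : R[i] -> R[i]) :
  Linfty hgamma phi -> harmonic_on disk phi ->
  exists f g, [/\ A2 hgamma f, A2 hgamma g & forall w, phi w = f w + (g w)^*].
Proof.
move=> [[m1 m2] [M aeM]] [h1 h2].
have [f1 [hf1 f1E]] := harmonic_re_part h1; have [f2 [hf2 f2E]] := harmonic_re_part h2.
have le_norm (z : R[i]) : `|complex.Re z| <= normc z /\ `|complex.Im z| <= normc z.
  have n0 : 0 <= normc z by case: (z) => a b; rewrite sqrtr_ge0.
  by split; rewrite -ler_sqr ?nnegrE// real_normK ?num_real// normc_sqr ?lerDl ?lerDr sqr_ge0.
have A1 : A2 hgamma f1.
  apply: A2_of_re_part => //; rewrite f1E; apply: (integrable_bounded (M := M)) => //.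
  apply: filterS aeM => p H /H; apply: le_trans; exact: (le_norm _).1.
have A2' : A2 hgamma f2.
  apply: A2_of_re_part => //; rewrite f2E; apply: (integrable_bounded (M := M)) => //.
  apply: filterS aeM => p H /H; apply: le_trans; exact: (le_norm _).2.
have hc (c : R[i]) : holomorphic_on disk (fun=> c) by move=> w _; exact: derivable_cst.
have Am f (c : R[i]) : A2 hgamma f -> A2 hgamma (fun w => f w * c).
  move=> Af; exact: (@A2_mul_bounded _ _ hgamma f (fun=> c) (normc c ^+ 2) Af (hc c)).
pose h : R[i] := (2^-1)%:C.
exists (fun w => f1 w * h + f2 w * (h * 'i)), (fun w => f1 w * h + f2 w * - (h * 'i)).
split; [by apply: A2_add; exact: Am|by apply: A2_add; exact: Am|].
move=> w; have e1 := congr1 (@^~ (complex.Re w, complex.Im w)) f1E.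
have e2 := congr1 (@^~ (complex.Re w, complex.Im w)) f2E.
move: e1 e2; rewrite /re_part /comp (_ : toC _ = w); last by case: (w).
case: (phi w) => a b; case: (f1 w) => a1 b1; case: (f2 w) => a2 b2 /= -> ->.
by rewrite /h; simpc; congr (_ +i* _); field.
Qed.

Lemma berezin_toeplitz (phi : R[i] -> R[i]) (xi : R[i]) : Linfty hgamma phi ->
  harmonic_on disk phi -> disk xi -> berezin hgamma (toeplitz hgamma phi) xi = phi xi.
Proof.
move=> phib phih xiD; rewrite /berezin /toeplitz.
set k := normalized_kernel xi.
have [f [g [Af Ag phiE]]] := bounded_harmonic_decomposition phib phih.
have mD := @measurable_disk2 R.
have hk : holomorphic_on disk k by exact: kernel_holomorphic.
have [B kB] := kernel_bounded hgamma xiD.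
have k0 w : disk w -> k w != 0 by exact: kernel_neq0.
have kA f' : A2 hgamma f' -> A2 hgamma (fun w => f' w * k w).
  by move=> Af'; exact: A2_mul_bounded kB.
have Ak : A2 hgamma k.
  have := kA _ (A2_cst hgamma 1); congr (A2 _ _).
  by apply/funext => w; rewrite mul1r.
have amgm (F1 F2 : R[i] -> R[i]) p : normc (F1 (toC p)) * normc (F2 (toC p)) <= abs2 F1 p + abs2 F2 p.
  rewrite /abs2; set x := normc _; set y := normc _.
  by have := sqr_ge0 (x - y); have := sqr_ge0 (x + y); rewrite sqrrB sqrrD; lra.
have iA2 f1 f2 : A2 hgamma f1 -> A2 hgamma f2 ->
    mu.-integrable D2 (EFin \o (fun p => abs2 f1 p + abs2 f2 p)).
  move=> A1 A2'; have := integrableD mD (A2_integrable A1) (A2_integrable A2').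
  by congr (_.-integrable _ _).
have rep f' : A2 hgamma f' -> let FK := fun w => f' w * (k w * (k w)^*) in
    cintegrable hgamma FK /\ cintegral mu disk FK = f' xi.
  move=> Af'; apply: (kernel_reproducing xiD Af'.1 (iA2 _ _ (kA _ Af') Ak)) => p _.
  by apply: le_trans (amgm (fun w => f' w * k w) k p); rewrite normcM -mulrA -expr2.
pose H w := (f w + (g xi)^*) * k w.
have AH : A2 hgamma H by exact: (kA _ (A2_add Af (A2_cst hgamma (g xi)^*))).
have conjE (a b c d e : R[i]) : ((a + b^*) * c - (a + d^*) * c) * e^* = ((b - d) * e * c^*)^*.
  by case: a b c d e => [a a'] [b b'] [c c'] [d d'] [e e']; simpc; congr (_ +i* _); ring.
have projH : is_bergman_proj hgamma (fun w => phi w * k w) H.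
  split => // h Ah; rewrite /inner.
  pose g' w := g w + - g xi.
  have Ag' : A2 hgamma g' := A2_add Ag (A2_cst hgamma (- g xi)).
  pose F w := g' w * h w / k w.
  have hF : holomorphic_on disk F.
    move=> w wD; apply: derivableM; first by apply: derivableM; [exact: Ag'.1|exact: Ah.1].
    by apply: derivableV; [exact: k0|exact: hk].
  have [|iF FE] := kernel_reproducing xiD hF (iA2 _ _ (kA _ Ag') Ah).
    move=> p pD; apply: le_trans (amgm (fun w => g' w * k w) h p).
    rewrite /abs2 (normcM (g' (toC p) * h (toC p))) (normcM (g' _) (h _)) normcV.
    rewrite (normcM (g' (toC p)) (k _)); set x := normc (k _).
    have x0 : x != 0.
      by apply/eqP => /eq0_normc/eqP; rewrite (negbTE (k0 _ pD)).
    by rewrite le_eqVlt; apply/orP; left; apply/eqP; field.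
  transitivity (cintegral mu disk (fun w => (F w * (k w * (k w)^*))^*)).
    apply: eq_cintegral => w wD; rewrite /F /g' /H phiE -[_ / k w * _]mulrA mulKf ?k0//.
  by rewrite (cintegral_conj iF) FE /F /g' subrr !mul0r rmorph0.
rewrite /bergman_proj.
(* [H] only shows that a projection exists. The function [T] picked by [xget] is used through the
   orthogonality of [phi k - T] to [k], by which [T] and [phi k] have the same pairing with [k]. *)
have [AT orthT] := @xgetPex _ (fun=> 0) (is_bergman_proj hgamma (fun w => phi w * k w)) (ex_intro _ H projH).
set T := xget _ _ in AT orthT *.
have [if_ fE] := rep f Af; have [ig_ gE] := rep g Ag.
(* This is [phi |k|^2], split into two integrable terms that [rep] evaluates, the second one after
   conjugation. *)
pose A w := f w * (k w * (k w)^*) + (g w * (k w * (k w)^*))^*.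
have iA : cintegrable hgamma A := cintegrableD if_ (cintegrable_conj ig_).
have AE w : A w = phi w * k w * (k w)^*.
  rewrite /A phiE; case: (f w) (g w) (k w) => [a a'] [b b'] [c c'].
  by simpc; congr (_ +i* _); ring.
have iT := cintegrable_mul AT Ak.
have := orthT k Ak; rewrite /inner => orth.
have := cintegralB iA iT.
rewrite (@eq_cintegral _ _ hgamma _ (fun w => (phi w * k w - T w) * (k w)^*)); last first.
  by move=> w _; rewrite AE mulrBl.
rewrite orth => /esym/eqP; rewrite subr_eq0 => /eqP <-.
rewrite /A (cintegralD if_ (cintegrable_conj ig_)) (cintegral_conj ig_) fE gE.
by rewrite phiE.
Qed.

End Reproducing.

Theorem theorem2p1 (R : realType) (gamma : R) (hgamma : -1 < gamma)
    (phi : R[i] -> R[i]) (phi_bounded : Linfty hgamma phi)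
    (phi_harmonic : harmonic_on disk phi) :
  Ber hgamma (toeplitz hgamma phi) = phi @` disk.
Proof.
by rewrite /Ber; apply: eq_imagel => xi xiD; exact: berezin_toeplitz.
Qed.
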